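(* Let $(X,d,\mu)$ be a space of homogeneous type and let $1\le q<p<\infty$. If $W\in A_p$ is an $n\times n$ matrix weight, then $$\|M_{p,W}\vec f\|_{L^p}\lesssim [W]_{A_p}^{\frac1p}\,[W^{-\frac{1}{p-1}}]_{A^{sc}_{\infty,p'}}^{\frac1p}\,\|\vec f\|_{L^p},$$ and if $W\in A_q$, then $$\|M_{p,W}\vec f\|_{L^p}\lesssim [W]_{A_q}^{\frac1p}\,\|\vec f\|_{L^p},$$ for every $\vec f\in L^p(X;\mathbb{R}^n)$.
   Context: Space of homogeneous type $(X,d,\mu)$: $X$ is a set with a quasi-metric $d$, i.e. $d(x,y)\le c_d(d(x,z)+d(z,y))$ for some $c_d\ge1$, and a Borel measure $\mu$ with $\mu(B(x,2\rho))\le c_\mu\mu(B(x,\rho))$, where $B(x,\rho)=\{y:d(x,y)<\rho\}$. All balls are Borel sets with $0<\mu(B)<\infty$, and the Lebesgue differentiation theorem holds. A matrix weight is a measurable function $W$ on $X$ with values in real $n\times n$ matrices that is symmetric and positive definite a.e. $|\cdot|_{op}$ is the operator norm, and suprema below are over balls $B$. For $1<p<\infty$, $$[W]_{A_p}=\sup_B\frac1{\mu(B)}\int_B\left(\frac1{\mu(B)}\int_B|W^{-\frac1p}(y)W^{\frac1p}(x)|_{op}^{p'}d\mu(y)\right)^{\frac p{p'}}d\mu(x),$$ and $[W]_{A_1}=\sup_B\operatorname{ess\,sup}_{y\in B}\frac1{\mu(B)}\int_B|W(x)W^{-1}(y)|_{op}\,d\mu(x)$. $W\in A_p$ means $[W]_{A_p}<\infty$.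 For a scalar weight $w$, $[w]_{A_\infty}=\sup_B\frac1{w(B)}\int_BM(w\chi_B)\,d\mu$ with $w(B)=\int_Bw\,d\mu$ and $M$ the Hardy–Littlewood maximal operator over balls containing the point. For a matrix weight $V$ and $1\le t<\infty$, $[V]_{A^{sc}_{\infty,t}}=\sup_{\vec e\ne0}\big[|V^{\frac1t}(\cdot)\vec e|^t\big]_{A_\infty}$. The Christ–Goldberg maximal function is $M_{p,W}\vec f(x)=\sup_{B\ni x}\frac1{\mu(B)}\int_B|W^{\frac1p}(x)W^{-\frac1p}(y)\vec f(y)|\,d\mu(y)$. $\|\vec f\|_{L^p}=(\int_X|\vec f|^pd\mu)^{1/p}$. $\lesssim$ means inequality up to a constant independent of $\vec f$ and $W$ (it may depend on $n$, $p$, $q$ and the space). *)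

(* Defs.v *)
From HB Require Import structures.
From mathcomp Require Import all_boot all_order all_algebra.
From mathcomp Require Import all_classical all_reals all_analysis.

Set Implicit Arguments.
Unset Strict Implicit.
Unset Printing Implicit Defensive.

Import Order.TTheory GRing.Theory Num.Theory.
Import numFieldNormedType.Exports.

Local Open Scope classical_set_scope.
Local Open Scope ring_scope.

Section euclidean_matrices.
Context {R : realType} {n : nat}.

(* The library's norm on matrices is the max norm, hence the definitions of
   the Euclidean norm and of the operator norm it induces. *)
Definition enorm (v : 'cV[R]_n) : R := Num.sqrt (\sum_i v i ord0 ^+ 2).

Definition opnorm (A : 'M[R]_n) : R :=
  sup [set enorm (A *m v) | v in [set v : 'cV[R]_n | enorm v <= 1]].

Definition posdefmx (A : 'M[R]_n) : Prop :=
  A^T = A /\ forall v : 'cV[R]_n, v != 0 -> 0 < (v^T *m A *m v) ord0 ord0.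

(* Real powers by functional calculus: if A = U^T diag(D) U with U orthogonal,
   then A^s = U^T diag(D^s) U, which does not depend on the diagonalization.
   The value is 0 when A is not symmetric. *)
Definition mxpow (A : 'M[R]_n) (s : R) : 'M[R]_n :=
  xget 0 [set B | exists (U : 'M[R]_n) (D : 'rV[R]_n),
    [/\ U *m U^T = 1%:M,
        A = U^T *m diag_mx D *m U &
        B = U^T *m diag_mx (map_mx (fun a => a `^ s) D) *m U]].

End euclidean_matrices.

Section quasi_metric.
Context {R : realType} {T : Type}.
Implicit Type rho : T -> T -> R.

Definition quasi_metric rho : Prop :=
  [/\ forall x y, 0 <= rho x y,
      forall x y, rho x y = 0 <-> x = y,
      forall x y, rho x y = rho y x &
      exists2 c : R, 1 <= c &
        forall x y z, rho x y <= c * (rho x z + rho z y)].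

Definition qball rho (x : T) (r : R) : set T := [set y | rho x y < r].

Definition qballs rho : set (set T) :=
  [set B | exists x r, 0 < r /\ B = qball rho x r].

(* Quasi-metric balls need not be open in this topology, so that a maximal
   function may fail to be measurable; the library's integral of a nonnegative
   function is then the supremum of the integrals of the nonnegative simple
   functions below it. *)
Definition qopen rho : set (set T) :=
  [set O | forall x, O x -> exists2 r, 0 < r & qball rho x r `<=` O].

End quasi_metric.

Section homogeneous_type.
Context {R : realType} {d : measure_display} {T : measurableType d}.
Implicit Types (mu : {measure set T -> \bar R}) (rho : T -> T -> R).
Local Open Scope ereal_scope.

Definition avg mu (B : set T) (g : T -> \bar R) : \bar R :=
  (mu B)^-1 * \int[mu]_(y in B) g y.

Definition differentiation_property mu rho : Prop :=
  forall f : T -> R,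
    (forall B, qballs rho B -> mu.-integrable B (EFin \o f)) ->
    {ae mu, forall x,
      avg mu (qball rho x r) (EFin \o f) @[r --> 0%R^'+] --> (f x)%:E}.

Record space_of_homogeneous_type mu rho : Prop := {
  sht_quasi_metric : quasi_metric rho ;
  sht_borel : @measurable d T = <<s qopen rho >> ;
  sht_ball_measurable : forall B, qballs rho B -> measurable B ;
  sht_ball_measure : forall B, qballs rho B -> 0 < mu B < +oo ;
  sht_doubling : exists c : R, forall x (r : R), (0 < r)%R ->
    mu (qball rho x (2 * r)) <= c%:E * mu (qball rho x r) ;
  sht_differentiation : differentiation_property mu rho }.

Definition ess_sup_on mu (B : set T) (g : T -> \bar R) : \bar R :=
  ereal_inf [set c | {ae mu, forall y, B y -> g y <= c}].

Definition HLmax mu rho (g : T -> R) (x : T) : \bar R :=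
  ereal_sup [set avg mu B (fun y => `|g y|%:E)
            | B in [set B | qballs rho B /\ B x]].

Definition Ainfty_const mu rho (w : T -> R) : \bar R :=
  ereal_sup [set (\int[mu]_(y in B) (w y)%:E)^-1 *
                 \int[mu]_(x in B) HLmax mu rho (w \* \1_B)%R x
            | B in qballs rho].

Definition conj_exp (p : R) : R := (p / (p - 1))%R.

Section matrix_weights.
Context {n : nat}.
Implicit Types W V : T -> 'M[R]_n.

Definition matrix_weight mu W : Prop :=
  (forall i j, measurable_fun [set: T] (fun x => W x i j)) /\
  {ae mu, forall x, posdefmx (W x)}.

Definition A1_const mu rho W : \bar R :=
  ereal_sup [set ess_sup_on mu B (fun y =>
                   avg mu B (fun x => (opnorm (W x *m invmx (W y)))%:E))
            | B in qballs rho].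

Definition Ap_gt1_const mu rho (p : R) W : \bar R :=
  ereal_sup [set avg mu B (fun x =>
                   avg mu B (fun y =>
                     (opnorm (mxpow (W y) (- p^-1) *m mxpow (W x) p^-1)
                        `^ conj_exp p)%:E)
                   `^ (p / conj_exp p))
            | B in qballs rho].

Definition Ap_const mu rho (p : R) W : \bar R :=
  if p == 1%R then A1_const mu rho W else Ap_gt1_const mu rho p W.

Definition Ainfty_sc_const mu rho (t : R) V : \bar R :=
  ereal_sup [set Ainfty_const mu rho
                   (fun x => (enorm (mxpow (V x) t^-1 *m e) `^ t)%R)
            | e in [set e : 'cV[R]_n | e != 0%R]].

Definition CGmax mu rho (p : R) W (f : T -> 'cV[R]_n) (x : T) : \bar R :=
  ereal_sup [set avg mu B (fun y =>
                   (enorm (mxpow (W x) p^-1 *m mxpow (W y) (- p^-1) *m f y))%:E)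
            | B in [set B | qballs rho B /\ B x]].

Definition vLnorm mu (p : R) (f : T -> 'cV[R]_n) : \bar R :=
  'N[mu]_p%:E[EFin \o (enorm \o f)].

Definition in_vLp mu (p : R) (f : T -> 'cV[R]_n) : Prop :=
  (forall i, measurable_fun [set: T] (fun x => f x i ord0)) /\
  vLnorm mu p f < +oo.

End matrix_weights.
End homogeneous_type.

(* Main.v *)
Require Import Defs.
From HB Require Import structures.
From mathcomp Require Import all_boot all_order all_algebra finmap.
From mathcomp Require Import all_classical all_reals all_analysis.
From mathcomp Require Import measurable_realfun ring lra.

Import Order.TTheory GRing.Theory Num.Theory.
Import numFieldNormedType.Exports.

Local Open Scope classical_set_scope.
Local Open Scope ring_scope.

Set Implicit Arguments.
Unset Strict Implicit.
Unset Printing Implicit Defensive.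

(* The kernel [|W^{1/p}(x) W^{-1/p}(y) f(y)|] of the Christ-Goldberg maximal
   function is split on each ball [B] into products of a function of [x] and a
   function of [y]: if [N(z)] is the averaged norm [(avg_B |W^{-1/q} z|^{q'})^{1/q'}],
   a greedy choice gives an orthonormal basis [e_i] with
   [N(e_i) |<e_i, z>| <= 2^n N(z)], so that the [A_q] condition bounds the average
   of [(N(e_i) |W^{1/q} e_i|)^q] while [|W^{-1/q} e_i| / N(e_i)] has average one in
   [L^{q'}].  For [q < p] Jensen's inequality for the spectral measure of [W] passes
   from the exponent [1/q] to [1/p] and leaves room in Hoelder's inequality: the
   averages of the second factor are bounded by those of [|f|^{p/t}] with
   [t = p - q + 1 > 1].  For [q = p] the room comes from the reverse Hoelder
   inequality for the [A_infty] weights [|W^{-1/p} e_i|^{p'}], with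
   [t - 1] comparable to the inverse of the [A_infty] constant.

   It remains to bound the maximal function of a kernel that splits on every ball.
   On a dyadic grid with smallest scale [eps], stop at the maximal subcubes where
   the average of the second factor exceeds a multiple of its average on the given
   cube: off the stopped cubes the first factor controls everything, the stopped
   cubes have at most half of the measure, and induction on the level gives a
   measurable majorant whose integral is controlled by that of [(M h)^t], with
   [h^t = |f|^p].  The constant [1 / (t - 1)] is that of the strong type inequality
   for [M], and [eps -> 0] by Fatou's lemma. *)

(** * Euclidean norm and orthogonal matrices *)

(** Maximal functions over balls may fail to be measurable, and lower integrals are not subadditive,
    so all additions are made on measurable majorants. On a grid this is free: a function of cubes
    takes countably many values on measurable pieces. All balls are then reached by an inequality
    under Fatou's lemma. One grid per scale is enough, because averages are taken over a ball [star]
    containing the cube: a ball through [x], of scale not below that of the grid, lies in the star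
    of a cube around [x], of comparable measure. No adjacent grids are needed. The exponent [1/p] of
    the A_infty constant arises because only the strong type inequality degenerates as [t] tends to
    1: its factor [1 / (t - 1)] stands in front of an integral of [p]-th powers. All other
    constants, that of the reverse Hoelder inequality included, must stay bounded in [t]. An
    orthonormal basis adapted to the averaged norm takes the place of its John ellipsoid, at the
    price [2 ^+ n]; it makes the kernel a sum of products of scalar functions. *)

Section euclidean_norm.
Context {R : realType} {n : nat}.
Implicit Types (u v w : 'cV[R]_n) (A U : 'M[R]_n).

Definition dot u v : R := (u^T *m v) ord0 ord0.

Lemma dotE u v : dot u v = \sum_i u i ord0 * v i ord0.
Proof. by rewrite /dot mxE; apply: eq_bigr => i _; rewrite mxE. Qed.

Lemma dotC u v : dot u v = dot v u.
Proof. by rewrite !dotE; apply: eq_bigr => i _; rewrite mulrC. Qed.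

Lemma dotDl u v w : dot (u + v) w = dot u w + dot v w.
Proof. by rewrite /dot linearD mulmxDl mxE. Qed.

Lemma dotDr u v w : dot w (u + v) = dot w u + dot w v.
Proof. by rewrite /dot mulmxDr mxE. Qed.

Lemma dotZl a u v : dot (a *: u) v = a * dot u v.
Proof. by rewrite /dot linearZ /= -scalemxAl mxE. Qed.

Lemma dotZr a u v : dot u (a *: v) = a * dot u v.
Proof. by rewrite /dot -scalemxAr mxE. Qed.

Lemma dotNr u v : dot u (- v) = - dot u v.
Proof. by rewrite /dot mulmxN mxE. Qed.

Lemma dot_mulmxl A u v : dot (A *m u) v = dot u (A^T *m v).
Proof. by rewrite /dot trmx_mul mulmxA. Qed.

Lemma dot_mulmxr A u v : dot u (A *m v) = dot (A^T *m u) v.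
Proof. by rewrite dot_mulmxl trmxK. Qed.

Lemma dot_ge0 u : 0 <= dot u u.
Proof. by rewrite dotE sumr_ge0// => i _; rewrite -expr2 sqr_ge0. Qed.

Lemma dot_eq0 u : (dot u u == 0) = (u == 0).
Proof.
rewrite dotE psumr_eq0; last by move=> i _; rewrite -expr2 sqr_ge0.
apply/idP/eqP => [/allP u0|->]; last by apply/allP => i _; rewrite !mxE mulr0 eqxx.
apply/colP => i; have := u0 i (mem_index_enum _).
by rewrite /= -expr2 sqrf_eq0 mxE => /eqP.
Qed.

Lemma enormE u : enorm u = Num.sqrt (dot u u).
Proof. by rewrite /enorm dotE; congr Num.sqrt; apply: eq_bigr. Qed.

Lemma enorm_ge0 u : 0 <= enorm u.
Proof. exact: sqrtr_ge0. Qed.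

Lemma enorm_sqr u : enorm u ^+ 2 = dot u u.
Proof. by rewrite enormE sqr_sqrtr ?dot_ge0. Qed.

Lemma enorm_eq0 u : (enorm u == 0) = (u == 0).
Proof. by rewrite -sqrf_eq0 enorm_sqr dot_eq0. Qed.

Lemma enorm0 : enorm (0 : 'cV[R]_n) = 0.
Proof. by apply/eqP; rewrite enorm_eq0. Qed.

Lemma enorm_gt0 u : (0 < enorm u) = (u != 0).
Proof. by rewrite lt_def enorm_ge0 andbT enorm_eq0. Qed.

Lemma enormZ a u : enorm (a *: u) = `|a| * enorm u.
Proof.
rewrite !enormE dotZl dotZr mulrA -expr2 sqrtrM ?sqr_ge0//.
by rewrite sqrtr_sqr.
Qed.

Lemma ler_dot u v : `|dot u v| <= enorm u * enorm v.
Proof.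
have [->|v0] := eqVneq v 0.
  by rewrite /dot mulmx0 mxE normr0 mulr_ge0 ?enorm_ge0.
have vv : 0 < dot v v by rewrite lt_def dot_eq0 v0 dot_ge0.
rewrite -ler_sqr ?nnegrE ?mulr_ge0 ?enorm_ge0// exprMn !enorm_sqr real_normK ?num_real//.
have := dot_ge0 (dot v v *: u - dot u v *: v).
rewrite -scaleNr !(dotDl, dotDr, dotZl, dotZr) (dotC v u).
set a := dot u u; set b := dot u v; set c := dot v v => h.
have : 0 <= c * (a * c - b ^+ 2) by rewrite (le_trans h)// le_eqVlt; apply/orP; left; apply/eqP; ring.
by rewrite pmulr_rge0// subr_ge0.
Qed.

Lemma ler_enormD u v : enorm (u + v) <= enorm u + enorm v.
Proof.
rewrite -ler_sqr ?nnegrE ?addr_ge0 ?enorm_ge0// sqrrD !enorm_sqr.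
rewrite dotDl !dotDr (dotC v u).
have := ler_dot u v; have := ler_norm (dot u v) => *; lra.
Qed.

Lemma ler_enorm_sum (I : Type) (s : seq I) (P : pred I) (F : I -> 'cV[R]_n) :
  enorm (\sum_(i <- s | P i) F i) <= \sum_(i <- s | P i) enorm (F i).
Proof.
elim/big_ind2 : _ => //; first by rewrite enorm0.
by move=> x1 x2 y1 y2 h1 h2; rewrite (le_trans (ler_enormD _ _))// lerD.
Qed.

Definition orthmx U := U *m U^T = 1%:M.

Lemma orthmxC U : orthmx U -> U^T *m U = 1%:M.
Proof. exact: mulmx1C. Qed.

Lemma orthmx_dot U u v : orthmx U -> dot (U *m u) (U *m v) = dot u v.
Proof. by move=> oU; rewrite dot_mulmxl mulmxA orthmxC// mul1mx. Qed.

Lemma orthmx_enorm U u : orthmx U -> enorm (U *m u) = enorm u.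
Proof. by move=> oU; rewrite !enormE orthmx_dot. Qed.

Lemma orthmx_tr U : orthmx U -> orthmx U^T.
Proof. by move=> oU; rewrite /orthmx trmxK orthmxC. Qed.

Lemma ler_norm_enorm u i : `|u i ord0| <= enorm u.
Proof.
rewrite -ler_sqr ?nnegrE ?enorm_ge0// enorm_sqr real_normK ?num_real// dotE.
rewrite (bigD1 i)//= -expr2 lerDl sumr_ge0// => j _.
by rewrite -expr2 sqr_ge0.
Qed.

Lemma col_sum_delta u : u = \sum_i u i ord0 *: delta_mx i ord0.
Proof.
apply/colP => i; rewrite summxE (bigD1 i)//= big1 ?addr0 => [|j ji].
  by rewrite !mxE !eqxx mulr1.
by rewrite !mxE eq_sym (negbTE ji) mulr0.
Qed.

Section seminorm.
Variable N : 'cV[R]_n -> R.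
Hypothesis ND : forall u v, N (u + v) <= N u + N v.
Hypothesis NZ : forall a u, N (a *: u) = `|a| * N u.

Lemma seminorm_ge0 u : 0 <= N u.
Proof.
have N0 : N 0 = 0 by rewrite -(scale0r 0) NZ normr0 mul0r.
have := ND u (- u); rewrite subrr N0 -scaleN1r NZ normrN1 mul1r => h; lra.
Qed.

Lemma seminorm_sum (I : Type) (s : seq I) (F : I -> 'cV[R]_n) :
  N (\sum_(i <- s) F i) <= \sum_(i <- s) N (F i).
Proof.
elim: s => [|i s ih]; first by rewrite !big_nil -(scale0r 0) NZ normr0 mul0r.
by rewrite !big_cons (le_trans (ND _ _))// lerD2l.
Qed.

Lemma seminorm_le_coords u (c : R) : (forall i, `|u i ord0| <= c) ->
  N u <= c * \sum_i N (delta_mx i ord0).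
Proof.
move=> uc; rewrite {1}(col_sum_delta u) (le_trans (seminorm_sum _ _))//.
rewrite mulr_sumr ler_sum// => i _.
by rewrite NZ ler_wpM2r ?seminorm_ge0.
Qed.

End seminorm.

End euclidean_norm.

Section opnorm.
Context {R : realType} {n : nat}.
Implicit Types (v : 'cV[R]_n) (A : 'M[R]_n).

Let enorm_mul_bound A v : enorm v <= 1 ->
  enorm (A *m v) <= \sum_i enorm (A *m delta_mx i ord0).
Proof.
move=> v1; rewrite -[leRHS]mul1r.
apply: (@seminorm_le_coords _ _ (fun u => enorm (A *m u))).
- by move=> x y; rewrite mulmxDr ler_enormD.
- by move=> a x; rewrite -scalemxAr enormZ.
- by move=> i; rewrite (le_trans (ler_norm_enorm _ _)).
Qed.

Lemma opnorm_ub A v : enorm v <= 1 -> enorm (A *m v) <= opnorm A.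
Proof.
move=> v1; apply: ub_le_sup; last by exists v.
exists (\sum_i enorm (A *m delta_mx i ord0)) => _ [u /= u1 <-].
exact: enorm_mul_bound.
Qed.

Lemma opnorm_ge0 A : 0 <= opnorm A.
Proof.
by rewrite (le_trans _ (@opnorm_ub A 0 _)) ?enorm_ge0// enorm0.
Qed.

End opnorm.

Section maximal_direction.
Context {R : realType}.

Lemma continuous_seminorm n (N : 'cV[R]_n -> R) :
  (forall u v, N (u + v) <= N u + N v) -> (forall a u, N (a *: u) = `|a| * N u) ->
  continuous (fun r : 'rV[R]_n => N r^T).
Proof.
move=> ND NZ r; apply/(@cvgrPdist_le _ _ _ _ (nbhs_filter r)) => /= e e0.
pose S := \sum_i N (delta_mx i ord0).
have S0 : 0 < S + 1.
  by rewrite ltr_wpDl// sumr_ge0// => i _; exact: seminorm_ge0.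
have h2 (x y : 'rV[R]_n) : `|x - y| <= e / (S + 1) -> N x^T - N y^T <= e.
  move=> xy; have := ND (x^T - y^T) y^T; rewrite subrK -lerBlDr => /le_trans -> //.
  rewrite (le_trans (@seminorm_le_coords _ _ _ ND NZ _ (e / (S + 1)) _))//.
    move=> i; rewrite (le_trans _ xy)// {2}/Num.norm /= mx_normrE.
    by apply/bigmax_geP; right => /=; exists (ord0, i) => //=; rewrite !mxE.
  rewrite -mulrA ler_piMr// ?(ltW e0)// mulrC ler_pdivrMr// mul1r.
  by rewrite -/S lerDl.
near=> t.
have h : `|r - t| <= e / (S + 1).
  by near: t; apply: cvgr_dist_le; [exact: cvg_id|rewrite divr_gt0].
by rewrite ler_norml h2// andbT lerNl opprB h2// distrC.
Unshelve. all: by end_near. Qed.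

(** Compactness of the unit sphere and homogeneity. The dimension [n.+1] keeps the sphere nonempty,
    and row vectors occur because [EVT_max_rV] is about them. *)
Lemma seminorm_attained n (N : 'cV[R]_n.+1 -> R) :
  (forall u v, N (u + v) <= N u + N v) -> (forall a u, N (a *: u) = `|a| * N u) ->
  exists2 v, enorm v = 1 & forall z, N z <= N v * enorm z.
Proof.
move=> ND NZ; pose q (r : 'rV[R]_n.+1) : R := enorm r^T.
have cq : continuous q.
  by apply: continuous_seminorm => *; [exact: ler_enormD|exact: enormZ].
have [] := @EVT_max_rV R n.+1 (fun r => N r^T) (q @^-1` [set 1]).
- exists (delta_mx ord0 ord0); rewrite /= /q trmx_delta.
  rewrite /enorm (bigD1 ord0)//= big1 ?addr0.
    by rewrite !mxE !eqxx expr1n sqrtr1.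
  by move=> i i0; rewrite !mxE (negbTE i0) expr0n.
- apply: bounded_closed_compact.
    exists 1; split; first exact: num_real.
    move=> x x1 r /= qr; rewrite (le_trans _ (ltW x1))//.
    rewrite {1}/Num.norm /= mx_normrE; apply/bigmax_leP; split => // -[i j] _ /=.
    rewrite (ord1 i) (_ : r ord0 j = r^T j ord0) ?mxE//.
    by rewrite -qr (le_trans _ (ler_norm_enorm _ j))// mxE.
  apply: closed_comp; last exact: closed_eq.
  by move=> x _; exact: cq.
- by apply: continuous_subspaceT; exact: continuous_seminorm.
- move=> c; rewrite inE /= => qc cmax.
  exists c^T => // z; have [->|z0] := eqVneq z 0.
    by rewrite enorm0 mulr0 -(scale0r 0) NZ normr0 mul0r.
  rewrite -ler_pdivrMr ?enorm_gt0//.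
  have := cmax ((enorm z)^-1 *: z^T); rewrite inE /= /q linearZ /= trmxK.
  rewrite enormZ NZ ger0_norm ?invr_ge0 ?enorm_ge0//.
  by rewrite mulVf ?enorm_eq0// => /(_ erefl); rewrite mulrC.
Qed.

(* Perturb the maximizer [v] in the direction orthogonal to it. *)
Lemma seminorm_ge_max n (N : 'cV[R]_n -> R) v z :
  (forall u v, N (u + v) <= N u + N v) -> (forall a u, N (a *: u) = `|a| * N u) ->
  enorm v = 1 -> (forall z, N z <= N v * enorm z) ->
  N v * `|dot v z| <= N z.
Proof.
move=> ND NZ v1 vmax.
have vv : dot v v = 1 by rewrite -enorm_sqr v1 expr1n.
have M0 := seminorm_ge0 ND NZ v.
suff key w : dot v w = 0 -> N v <= N (v + w).
  have [vz0|vz0] := eqVneq (dot v z) 0.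
    by rewrite vz0 normr0 mulr0 seminorm_ge0.
  have := key ((dot v z)^-1 *: z - v).
  rewrite dotDr dotNr dotZr vv mulVf// subrr addrC subrK NZ normfV => /(_ erefl).
  by rewrite ler_pdivlMl ?normr_gt0// mulrC.
move=> vw; apply/ler_addgt0Pr => e e0.
(* From [(1 + t) v = t (v + w) + (v - t w)] and [|v - t w| <= 1 + t^2 s] follows
   [M <= N (v + w) + M t s]; this [t] makes the error [M t s] at most [e]. *)
pose M := N v; pose s := enorm w ^+ 2; pose t := e / (1 + M * s).
have s0 : 0 <= s by rewrite sqr_ge0.
have den : 0 < 1 + M * s by rewrite ltr_pwDl// mulr_ge0.
have t0 : 0 < t by rewrite divr_gt0.
have h1 : N ((1 + t) *: v) <= t * N (v + w) + N (v - t *: w).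
  rewrite -(ger0_norm (ltW t0)) -NZ ger0_norm ?(ltW t0)// (le_trans _ (ND _ _))//.
  by rewrite scalerDr scalerDl scale1r addrACA subrr addr0 addrC.
have h2 : N (v - t *: w) <= M * (1 + t ^+ 2 * s).
  rewrite (le_trans (vmax _))// ler_wpM2l//.
  have h3 : enorm (v - t *: w) ^+ 2 = 1 + t ^+ 2 * s.
    rewrite /s !enorm_sqr -scaleNr !(dotDl, dotDr, dotZl, dotZr) vv vw (dotC w) vw.
    by ring.
  have h4 : 1 <= 1 + t ^+ 2 * s by rewrite lerDl mulr_ge0 ?sqr_ge0.
  rewrite -ler_sqr ?nnegrE ?enorm_ge0 ?(le_trans _ h4)// h3.
  by rewrite expr2 ler_peMr// (le_trans ler01).
move: h1; rewrite NZ ger0_norm ?addr_ge0 ?(ltW t0)// -/M => h1.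
rewrite -(ler_pM2l t0).
have h5 : t * M <= t * N (v + w) + M * t ^+ 2 * s.
  have := le_trans h1 (lerD (lexx _) h2); set X := t * N _; set Y := t ^+ 2.
  by rewrite mulrDl mul1r mulrDr mulr1 mulrA; lra.
rewrite (le_trans h5)// mulrDr lerD2l.
rewrite (_ : M * t ^+ 2 * s = t * (t * (M * s))); last by ring.
rewrite ler_wpM2l ?(ltW t0)// {1}/t -mulrA ler_piMr ?(ltW e0)//.
by rewrite mulrC ler_pdivrMr// mul1r lerDr.
Qed.

(** Householder reflection in the hyperplane orthogonal to [v - e], which exchanges the unit vectors
    [v] and [e]. It degenerates for [v = e], where the identity serves. *)
Lemma orthmx_complete n (v : 'cV[R]_n.+1) : enorm v = 1 ->
  exists2 H : 'M[R]_n.+1, orthmx H & H *m v = delta_mx ord0 ord0.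
Proof.
move=> v1; set e := delta_mx _ _.
have vv : dot v v = 1 by rewrite -enorm_sqr v1 expr1n.
have ee : dot e e = 1.
  rewrite dotE (bigD1 ord0)//= big1 ?addr0; first by rewrite !mxE !eqxx mulr1.
  by move=> i i0; rewrite !mxE (negbTE i0) mulr0.
have [->|ve] := eqVneq v e; first by exists 1%:M; rewrite /orthmx ?trmx1 mul1mx.
pose w := v - e; pose c := dot w w.
have c0 : c != 0 by rewrite dot_eq0 subr_eq0.
pose H : 'M[R]_n.+1 := 1%:M - (2 / c) *: (w *m w^T).
have HT : H^T = H by rewrite /H linearB /= linearZ /= trmx1 trmx_mul trmxK.
have Hx x : H *m x = x - (2 / c * dot w x) *: w.
  rewrite /H mulmxBl mul1mx -scalemxAl -mulmxA -scalerA; congr (_ - _ *: _).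
  by rewrite [w^T *m x]mx11_scalar mul_mx_scalar.
have cE : c = 2 * dot w v.
  by rewrite /c /w -scaleN1r !(dotDl, dotDr, dotZl, dotZr) vv ee (dotC e v); ring.
exists H.
  rewrite /orthmx HT {2}/H mulmxBr mulmx1 -scalemxAr mulmxA Hx -/c -mulrA mulVf// mulr1.
  rewrite (_ : w - 2 *: w = - w); last by rewrite scaler_nat mulr2n opprD addrA subrr add0r.
  by rewrite mulNmx scalerN opprK /H subrK.
rewrite Hx (_ : 2 / _ * _ = 1) ?scale1r; first by rewrite /w opprB addrC subrK.
by rewrite mulrAC -cE mulfV.
Qed.

End maximal_direction.

(** * Spectral theorem and axes of a seminorm *)

Section spectral.
Context {R : realType}.

Lemma block_orthmx n (U : 'M[R]_n) :
  orthmx U -> orthmx (block_mx 1%:M 0 0 U : 'M[R]_(1 + n)).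
Proof.
move=> oU; rewrite /orthmx tr_block_mx mulmx_block !trmx0 trmx1 !mulmx0 !mul0mx.
by rewrite mulmx1 !addr0 add0r oU -scalar_mx_block.
Qed.

Lemma orthmxM n (U V : 'M[R]_n) : orthmx U -> orthmx V -> orthmx (U *m V).
Proof.
by rewrite /orthmx => oU oV; rewrite trmx_mul mulmxA -(mulmxA U) oV mulmx1.
Qed.

(** A maximizer [v] of [|A u|] on the unit sphere satisfies [A^2 v = m^2 v], because [A] maps
    vectors orthogonal to [v] to vectors orthogonal to [A v]. Hence [(A - m) (A + m) v = 0], and
    either [v] or [(A + m) v] is an eigenvector. *)
Lemma symmx_eigenvector n (A : 'M[R]_n.+1) : A^T = A ->
  exists (v : 'cV[R]_n.+1) (a : R), enorm v = 1 /\ A *m v = a *: v.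
Proof.
move=> AT; pose N (u : 'cV[R]_n.+1) := enorm (A *m u).
have ND u v : N (u + v) <= N u + N v by rewrite /N mulmxDr ler_enormD.
have NZ a u : N (a *: u) = `|a| * N u by rewrite /N -scalemxAr enormZ.
have [v v1 vmax] := seminorm_attained ND NZ.
have vv : dot v v = 1 by rewrite -enorm_sqr v1 expr1n.
pose m := N v.
have orth w : dot v w = 0 -> dot (A *m v) (A *m w) = 0.
  move=> vw; apply/eqP; apply/contraT => /negPf b0.
  pose b := dot (A *m v) (A *m w); pose c := dot (A *m w) (A *m w).
  have h t : 0 <= 2 * t * b + t ^+ 2 * c.
    have := @seminorm_ge_max _ _ N v (v + t *: w) ND NZ v1 vmax.
    rewrite dotDr dotZr vw vv mulr0 addr0 normr1 mulr1.
    rewrite -ler_sqr ?nnegrE ?enorm_ge0// /N !enorm_sqr mulmxDr -scalemxAr.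
    rewrite !(dotDl, dotDr, dotZl, dotZr) (dotC (A *m w) (A *m v)) -/b -/c.
    by move=> h; lra.
  have c0 : 0 <= c := dot_ge0 _.
  (* Close to the minimum of the quadratic; [c + 1] instead of [c] avoids a division by zero and
     still gives a negative value when [b] is nonzero. *)
  have := h (- b / (c + 1)).
  have c1 : c + 1 != 0 by rewrite gt_eqF// ltr_wpDl.
  rewrite (_ : _ + _ = - (b / (c + 1)) ^+ 2 * (c + 2)); last by field.
  rewrite mulNr oppr_ge0 pmulr_lle0; last by rewrite ltr_wpDl.
  rewrite le_eqVlt ltNge sqr_ge0 orbF sqrf_eq0 mulf_eq0 invr_eq0 (negbTE c1) orbF.
  by rewrite b0.
have AAv : A *m (A *m v) = m ^+ 2 *: v.
  pose w := A *m (A *m v) - m ^+ 2 *: v.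
  have vw : dot v w = 0.
    rewrite /w -scaleNr dotDr dotZr vv dot_mulmxr AT mulr1 /m enorm_sqr.
    by rewrite subrr.
  apply/eqP; rewrite -subr_eq0 -dot_eq0 -/w {1}/w -scaleNr dotDl dotZl vw mulr0 addr0.
  by rewrite dot_mulmxl AT orth.
have [Av|Av] := eqVneq (A *m v + m *: v) 0.
  by exists v, (- m); split => //; rewrite scaleNr; apply/eqP; rewrite -addr_eq0 Av.
have nz := Av; rewrite -enorm_eq0 in nz.
exists ((enorm (A *m v + m *: v))^-1 *: (A *m v + m *: v)), m; split.
  by rewrite enormZ ger0_norm ?invr_ge0 ?enorm_ge0// mulVf.
rewrite -scalemxAr scalerA mulrC -scalerA; congr (_ *: _).
by rewrite mulmxDr AAv -scalemxAr scalerDr scalerA -expr2 addrC.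
Qed.

(** Deflation: once an eigenvector is rotated to the first basis vector, symmetry clears the first
    row along with the first column, and induction treats the remaining block. *)
Theorem symmx_spectral n (A : 'M[R]_n) : A^T = A ->
  exists (U : 'M[R]_n) (D : 'rV[R]_n), orthmx U /\ A = U^T *m diag_mx D *m U.
Proof.
elim: n A => [A _|n IH A AT].
  by exists 1%:M, 0; rewrite /orthmx trmx1 mulmx1; split => //; apply/matrixP => -[].
have [v [a [v1 Av]]] := symmx_eigenvector AT.
have [H oH Hv] := orthmx_complete v1.
pose B : 'M[R]_(1 + n) := H *m A *m H^T.
have BT : B^T = B by rewrite /B !trmx_mul trmxK AT mulmxA.
have vE : v = H^T *m delta_mx ord0 ord0 by rewrite -Hv mulmxA orthmxC// mul1mx.
have Bcol : B *m (delta_mx ord0 ord0 : 'cV_(1 + n)) = a *: delta_mx ord0 ord0.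
  by rewrite /B -!mulmxA -vE Av -scalemxAr Hv.
have Bi0 i : B i ord0 = a *+ (i == ord0).
  have /matrixP/(_ i ord0) := Bcol; rewrite -colE !mxE eqxx andbT => ->.
  by rewrite mulr_natr.
have AE : A = H^T *m B *m H.
  by rewrite /B !mulmxA orthmxC// mul1mx -!mulmxA orthmxC// mulmx1.
clearbody B.
have drT : (drsubmx B)^T = drsubmx B by rewrite trmx_drsub BT.
have [U [D [oU dE]]] := IH _ drT.
have l0 : lshift n ord0 = ord0 :> 'I_(1 + n) by apply/val_inj.
have dl0 : dlsubmx B = 0.
  by apply/matrixP => i j; rewrite (ord1 j) !mxE l0 Bi0.
have ur0 : ursubmx B = 0 by rewrite -BT -trmx_dlsub dl0 trmx0.
have ulE : ulsubmx B = a%:M.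
  by apply/matrixP => i j; rewrite (ord1 i) (ord1 j) !mxE l0 Bi0 !eqxx.
have BE : B = block_mx a%:M 0 0 (drsubmx B).
  by rewrite -[LHS]submxK dl0 ur0 ulE.
pose V : 'M[R]_(1 + n) := block_mx 1%:M 0 0 U.
have oV : orthmx V := block_orthmx oU.
exists (V *m H), (row_mx a%:M D : 'rV[R]_(1 + n)); split; first exact: orthmxM.
suff VB : B = V^T *m diag_mx (row_mx a%:M D : 'rV[R]_(1 + n)) *m V.
  by rewrite AE VB trmx_mul !mulmxA.
rewrite BE diag_mx_row /V tr_block_mx !mulmx_block !trmx0 !mulmx0 !mul0mx !addr0 !add0r.
rewrite trmx1 mul1mx mulmx1 dE !mul0mx; congr block_mx.
by apply/matrixP => i j; rewrite (ord1 i) (ord1 j) !mxE eqxx !mulr1n.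
Qed.

(* Greedy choice: the first axis maximizes the seminorm on the unit sphere,
   and the others are chosen by recursion in its orthogonal complement. *)
Theorem seminorm_orthogonal_axes n (N : 'cV[R]_n -> R) :
  (forall u v, N (u + v) <= N u + N v) -> (forall a u, N (a *: u) = `|a| * N u) ->
  exists2 U : 'M[R]_n, orthmx U &
    forall i z, N (col i U^T) * `|dot (col i U^T) z| <= 2 ^+ n * N z.
Proof.
elim: n N => [N ND NZ|n IH N ND NZ].
  by exists 1%:M; [rewrite /orthmx trmx1 mulmx1|case].
have [v v1 vmax] := seminorm_attained ND NZ.
have [H oH Hv] := orthmx_complete v1.
have vE : v = H^T *m delta_mx ord0 ord0 by rewrite -Hv mulmxA orthmxC// mul1mx.
(* The seminorm on the orthogonal complement of [v], in the coordinates given by [H]. *)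
pose N' (y : 'cV[R]_n) := N (H^T *m col_mx (0 : 'cV_1) y).
have N'D u w : N' (u + w) <= N' u + N' w.
  by rewrite /N' -{1}(addr0 0) -add_col_mx mulmxDr ND.
have N'Z a u : N' (a *: u) = `|a| * N' u.
  by rewrite /N' -NZ -[in LHS](scaler0 _ a) -scale_col_mx -scalemxAr.
have [U oU UN] := IH N' N'D N'Z.
pose V : 'M[R]_(1 + n) := block_mx 1%:M 0 0 U.
have oV : orthmx V := block_orthmx oU.
have N0 z : 0 <= N z := seminorm_ge0 ND NZ z.
exists (V *m H); first exact: orthmxM.
move=> i z.
have -> : col i (V *m H)^T = H^T *m col i V^T by rewrite trmx_mul !colE mulmxA.
have VT : V^T = block_mx 1%:M 0 0 U^T by rewrite tr_block_mx !trmx0 trmx1.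
have le2 : 1 <= 2 ^+ n :> R by rewrite exprn_ege1// ler1n.
have colL (j : 'I_1) : col (lshift n j) V^T = delta_mx ord0 ord0 :> 'cV_(1 + n).
  rewrite VT block_mxEh colKl; apply/colP => k; rewrite !mxE (ord1 j).
  case: splitP => k' kk'; rewrite !mxE.
    by rewrite (ord1 k') /= (_ : k = ord0) ?eqxx//; apply/val_inj; rewrite /= kk' (ord1 k').
  by rewrite (_ : k == ord0 = false)// -(inj_eq val_inj) /= kk'.
have colR (j : 'I_n) : col (rshift 1 j) V^T = col_mx 0 (col j U^T) :> 'cV_(1 + n).
  by rewrite VT block_mxEh colKr col_col_mx col0.
case: (@splitP 1 n i) => j ij.
  rewrite (_ : i = lshift n j); last exact/val_inj.
  rewrite colL -vE (le_trans (seminorm_ge_max z ND NZ v1 vmax))//.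
  by rewrite ler_peMl// exprS (le_trans le2)// ler_peMl ?exprn_ge0// ler1n.
rewrite (_ : i = rshift 1 j); last exact/val_inj.
rewrite colR.
have zE : z = H^T *m (H *m z) by rewrite mulmxA orthmxC// mul1mx.
pose y : 'cV[R]_(1 + n) := H *m z.
pose z' := H^T *m col_mx (0 : 'cV_1) (dsubmx y).
have vz : dot v z = y ord0 ord0.
  rewrite vE dot_mulmxl trmxK -/y dotE (bigD1 ord0)//= big1 ?addr0.
    by rewrite mxE eqxx mul1r.
  by move=> l l0; rewrite mxE (negbTE l0) mul0r.
have z'E : z' = z + (- dot v z) *: v.
  rewrite {1}zE -/y /z' vz vE scalemxAr -mulmxDr.
  congr (_ *m _); clearbody y; apply/colP => k; rewrite !mxE.
  case: splitP => k' kk'; rewrite ?mxE.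
    have -> : k = ord0 by apply/val_inj; rewrite /= kk' (ord1 k').
    by rewrite eqxx mulr1 subrr.
  rewrite (_ : k == ord0 = false) ?mulr0 ?addr0; last by rewrite -(inj_eq val_inj) /= kk'.
  by congr (y _ _); apply/val_inj; rewrite /= kk'.
have dE : dot (H^T *m col_mx (0 : 'cV_1) (col j U^T)) z = dot (col j U^T) (dsubmx y).
  rewrite dot_mulmxl trmxK -/y /dot.
  rewrite (_ : _ *m y = (col_mx 0 (col j U^T))^T *m col_mx (usubmx y) (dsubmx y)); last first.
    by rewrite vsubmxK.
  by rewrite tr_col_mx mul_row_col trmx0 mul0mx add0r.
(* [z'] is the projection of [z] off [v], and [N z' <= N z + |dot v z| N v <= 2 N z]: each dimension
   costs a factor 2, whence [2 ^+ n]. *)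
rewrite dE; apply: (le_trans (UN j (dsubmx y))).
rewrite (_ : N' (dsubmx y) = N z')//.
rewrite exprSr -mulrA ler_wpM2l ?exprn_ge0// z'E (le_trans (ND _ _))// NZ normrN.
have := seminorm_ge_max z ND NZ v1 vmax; rewrite mulrC => ?; lra.
Qed.

End spectral.

(** * Functional calculus and its measurability *)

Section functional_calculus.
Context {R : realType} {n : nat}.
Implicit Types (A : 'M[R]_n) (phi psi : R -> R).

(** The calculus of [mxpow] with an arbitrary scalar function in place of a power, so that [phi] can
    be varied in the measurability proof. *)
Definition mxcalc phi A : 'M[R]_n :=
  xget 0 [set B | exists (U : 'M[R]_n) (D : 'rV[R]_n),
    [/\ U *m U^T = 1%:M, A = U^T *m diag_mx D *m U &
        B = U^T *m diag_mx (map_mx phi D) *m U]].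

Lemma mxpow_mxcalc A s : mxpow A s = mxcalc (fun a => a `^ s) A.
Proof. by []. Qed.

(** [P = V U^T] intertwines the two diagonal matrices, so a nonzero entry [P i j] forces the
    eigenvalues [E_i] and [D_j] to agree, and with them their images under [phi]. *)
Lemma diagonalization_indep phi (U V : 'M[R]_n) (D E : 'rV[R]_n) :
  orthmx U -> orthmx V ->
  U^T *m diag_mx D *m U = V^T *m diag_mx E *m V ->
  U^T *m diag_mx (map_mx phi D) *m U = V^T *m diag_mx (map_mx phi E) *m V.
Proof.
move=> oU oV UV; pose P := V *m U^T.
have com : diag_mx E *m P = P *m diag_mx D.
  have /(congr1 (fun M => V *m M *m U^T)) := UV.
  rewrite !mulmxA oV mul1mx -!mulmxA oU mulmx1 => <-.
  by rewrite /P !mulmxA.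
have comphi : diag_mx (map_mx phi E) *m P = P *m diag_mx (map_mx phi D).
  move: com; generalize P => Q com.
  apply/matrixP => i j; have /matrixP/(_ i j) := com.
  rewrite !mul_diag_mx !mul_mx_diag !mxE.
  have [-> _|P0] := eqVneq (Q i j) 0; first by rewrite mulr0 mul0r.
  by rewrite mulrC => /(mulfI P0) ->; rewrite mulrC.
have VE : V = P *m U by rewrite /P -mulmxA orthmxC// mulmx1.
have UE : U^T = V^T *m P by rewrite /P mulmxA orthmxC// mul1mx.
by rewrite UE -(mulmxA V^T P) -comphi mulmxA -(mulmxA _ P U) -VE.
Qed.

Lemma mxcalcE phi (U : 'M[R]_n) (D : 'rV[R]_n) : orthmx U ->
  mxcalc phi (U^T *m diag_mx D *m U) = U^T *m diag_mx (map_mx phi D) *m U.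
Proof.
move=> oU; rewrite /mxcalc; case: xgetP => [B _ [V [E [oV UV ->]]]|].
  exact/esym/diagonalization_indep.
by move=> /(_ (U^T *m diag_mx (map_mx phi D) *m U)) /=; case; exists U, D.
Qed.

Lemma mxcalc_nsym phi A : A^T <> A -> mxcalc phi A = 0.
Proof.
move=> AT; rewrite /mxcalc; case: xgetP => // B _ [U [D [oU AE _]]].
by exfalso; apply: AT; rewrite AE !trmx_mul trmxK tr_diag_mx mulmxA.
Qed.

Lemma conj_diag_entry (U : 'M[R]_n) (D : 'rV[R]_n) i j :
  (U^T *m diag_mx D *m U) i j = \sum_k U k i * D ord0 k * U k j.
Proof.
by rewrite mxE; apply: eq_bigr => k _; rewrite mul_mx_diag !mxE.
Qed.

Lemma map_diag_mulmx (U : 'M[R]_n) (D E : 'rV[R]_n) : orthmx U ->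
  (U^T *m diag_mx D *m U) *m (U^T *m diag_mx E *m U) =
  U^T *m diag_mx (\row_k (D ord0 k * E ord0 k)) *m U.
Proof.
move=> oU; rewrite -!mulmxA (mulmxA U) oU mul1mx (mulmxA (diag_mx D)).
by rewrite mulmx_diag.
Qed.

Section algebra.
Variable A : 'M[R]_n.
Hypothesis AT : A^T = A.

Lemma mxcalcM phi psi :
  mxcalc (fun a => phi a * psi a) A = mxcalc phi A *m mxcalc psi A.
Proof.
have [U [D [oU ->]]] := symmx_spectral AT.
rewrite !mxcalcE// map_diag_mulmx//; congr (_ *m diag_mx _ *m _).
by apply/rowP => k; rewrite !mxE.
Qed.

Lemma mxcalcD phi psi :
  mxcalc (fun a => phi a + psi a) A = mxcalc phi A + mxcalc psi A.
Proof.
have [U [D [oU ->]]] := symmx_spectral AT.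
rewrite !mxcalcE// -mulmxDl -mulmxDr -linearD /=; congr (_ *m diag_mx _ *m _).
by apply/rowP => k; rewrite !mxE.
Qed.

Lemma mxcalc_cst c : mxcalc (fun=> c) A = c%:M.
Proof.
have [U [D [oU ->]]] := symmx_spectral AT.
rewrite mxcalcE// (_ : map_mx _ _ = const_mx c); last by apply/rowP => k; rewrite !mxE.
by rewrite diag_const_mx mul_mx_scalar -scalemxAl orthmxC// scalemx1.
Qed.

Lemma mxcalc_id : mxcalc id A = A.
Proof. by have [U [D [oU ->]]] := symmx_spectral AT; rewrite mxcalcE// map_mx_id. Qed.

Lemma mxcalc_cvg (f : (R -> R)^nat) phi i j :
  (forall a, f m a @[m --> \oo] --> phi a) ->
  mxcalc (f m) A i j @[m --> \oo] --> mxcalc phi A i j.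
Proof.
move=> fphi; have [U [D [oU ->]]] := symmx_spectral AT.
rewrite mxcalcE// conj_diag_entry.
under eq_fun do rewrite mxcalcE// conj_diag_entry.
apply: (@cvg_big _ _ _ _ _ _ _ _ _ (fun k m => U k i * map_mx (f m) D ord0 k * U k j)).
  exact: add_continuous.
move=> k _; apply: cvgMl; apply: cvgMr; rewrite mxE.
by under eq_fun do rewrite mxE; exact: fphi.
Qed.

Lemma mxcalc_tr phi : (mxcalc phi A)^T = mxcalc phi A.
Proof.
have [U [D [oU ->]]] := symmx_spectral AT.
by rewrite mxcalcE// !trmx_mul trmxK tr_diag_mx mulmxA.
Qed.

End algebra.

End functional_calculus.

Section measurable_calculus.
Context {R : realType} {n : nat} {d : measure_display} {T : measurableType d}.
Variable S : T -> 'M[R]_n.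
Hypothesis ST : forall x, (S x)^T = S x.
Hypothesis mS : forall i j, measurable_fun setT (fun x => S x i j).

(** Eigenvectors are never chosen measurably in [x]. Instead this class of functions [phi] contains
    the constants and the identity, is closed under sums, products and pointwise limits, and grows
    from there to all nonnegative Borel functions. *)
Let P (phi : R -> R) := forall i j, measurable_fun setT (fun x => mxcalc phi (S x) i j).

Let P_cst c : P (fun=> c).
Proof. by move=> i j; under eq_fun do rewrite mxcalc_cst//; exact: measurable_cst. Qed.

Let P_id : P id.
Proof. by move=> i j; under eq_fun do rewrite mxcalc_id//; exact: mS. Qed.

Let P_M phi psi : P phi -> P psi -> P (fun a => phi a * psi a).
Proof.
move=> h1 h2 i j; under eq_fun do rewrite mxcalcM// mxE.
by apply: measurable_sum => k; exact: measurable_funM.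
Qed.

Let P_D phi psi : P phi -> P psi -> P (fun a => phi a + psi a).
Proof.
move=> h1 h2 i j; under eq_fun do rewrite mxcalcD// mxE.
exact: measurable_funD.
Qed.

Let P_cvg (f : (R -> R)^nat) phi :
  (forall m, P (f m)) -> (forall a, f m a @[m --> \oo] --> phi a) -> P phi.
Proof.
move=> mf fphi i j; apply: (@measurable_fun_cvg _ _ _ _ (fun m x => mxcalc (f m) (S x) i j)).
  by move=> m; exact: mf.
by move=> x _; exact: mxcalc_cvg.
Qed.

Let P_X phi m : P phi -> P (fun a => phi a ^+ m).
Proof.
move=> h; elim: m => [|m ih]; first by under eq_fun do rewrite expr0; exact: P_cst.
by under eq_fun do rewrite exprS; exact: P_M.
Qed.

Let P_sum (I : Type) (s : seq I) (phi : I -> R -> R) :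
  (forall k, P (phi k)) -> P (fun a => \sum_(k <- s) phi k a).
Proof.
move=> h; elim: s => [|k s ih]; first by under eq_fun do rewrite big_nil; exact: P_cst.
by under eq_fun do rewrite big_cons; exact: P_D.
Qed.

Let P_exp phi : P phi -> P (fun a => expR (phi a)).
Proof.
move=> h; apply: (@P_cvg (fun m a => series (exp_coeff (phi a)) m)).
  move=> m; rewrite /series /=; apply: P_sum => k; rewrite /exp_coeff /=.
  by apply: P_M; [exact: P_X|exact: P_cst].
by move=> a; exact: is_cvg_series_exp_coeff.
Qed.

(* [exp (- exp (m (a - c)))] tends to 1, 1/e or 0 as [a] is below, at or above
   [c]; powers of this limit tend to the indicator of [a < c]. *)
Let P_ray c : P (\1_(`]-oo, c[%classic)).
Proof.
pose g (a : R) : R := if a < c then 1 else if a == c then expR (- 1) else 0.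
have Pg : P g.
  apply: (@P_cvg (fun m a => expR (- (expR (a - c)) ^+ m))).
    move=> m; apply: P_exp; under eq_fun do rewrite -mulN1r.
    by apply: P_M; [exact: P_cst|apply: P_X; apply: P_exp; apply: P_D; [exact: P_id|exact: P_cst]].
  move=> a; rewrite /g; case: ltgtP => [ac|ca|->].
  - have h : (expR (a - c)) ^+ m @[m --> \oo] --> (0 : R).
      by apply: cvg_expr; rewrite ger0_norm ?expR_ge0// -expR0 ltr_expR subr_lt0.
    rewrite -(@expR0 R) -(@oppr0 R); apply: continuous_cvg; first exact: continuous_expR.
    exact: cvgN.
  (* Bernoulli's inequality [(1 + b)^m >= m b] bounds the term by [exp(-b)^m]. *)
  - pose b := expR (a - c) - 1.
    have b0 : 0 < b by rewrite subr_gt0 -expR0 ltr_expR subr_gt0.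
    apply: (@squeeze_cvgr _ _ _ _ (fun=> 0) (fun m => expR (- b) ^+ m)).
    + apply: nearW => m; rewrite expR_ge0 /= -[leRHS]expRM_natl ler_expR mulrN lerN2.
      rewrite (_ : expR (a - c) = 1 + b); last by rewrite /b [RHS]addrC subrK.
      elim: m => [|m ih]; first by rewrite mul0r expr0.
      rewrite exprS mulrDl mul1r -natr1 mulrDl mul1r lerD// ler_peMr ?(ltW b0)//.
      by rewrite exprn_ege1// lerDl ltW.
    + exact: cvg_cst.
    + by apply: cvg_expr; rewrite ger0_norm ?expR_ge0// -expR0 ltr_expR oppr_lt0.
  - by under eq_fun do rewrite subrr expR0 expr1n; exact: cvg_cst.
apply: (@P_cvg (fun m a => g a ^+ m)) => [m|a]; first exact: P_X.
rewrite /g indicE; case: ltgtP => [ac|ca|->].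
- rewrite mem_set//=.
  by under eq_fun do rewrite expr1n; exact: cvg_cst.
- rewrite memNset//=; last by rewrite /= in_itv/= ltNge (ltW ca).
  by apply: cvg_expr; rewrite normr0.
- rewrite memNset//=; last by rewrite /= in_itv/= ltxx.
  by apply: cvg_expr; rewrite ger0_norm ?expR_ge0// -expR0 ltr_expR oppr_lt0.
Qed.

(** Good sets principle: the rays of [P_ray] generate the Borel sets, and a countable union is the
    limit of complements of finite intersections of complements. *)
Let P_indic (B : set R) : measurable B -> P (\1_B).
Proof.
pose G : set (set R) := [set B | P (\1_B)].
suff GB : sigma_algebra setT G.
  move=> mB; move: (mB : measurable (B : set (measurableTypeR R))).
  rewrite (RGenInftyO.measurableE R) => mB'.
  by apply: (@smallest_sub _ _ _ G GB _ B mB') => _ [c ->]; exact: P_ray.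
have G0 : G set0 by rewrite /G /= indic0; exact: P_cst.
have GC C : G C -> G (~` C).
  rewrite /G /= => h; rewrite (_ : \1_(~` C) = (fun a => 1 + (-1) * \1_C a)).
    exact: P_D (P_cst 1) (P_M (P_cst (-1)) h).
  apply/funext => a; rewrite !indicE in_setC; case: (a \in C) => /=; lra.
have GI C E : G C -> G E -> G (C `&` E).
  by rewrite /G /= indicI; exact: P_M.
split; [exact: G0|by move=> C; rewrite setTD; exact: GC|].
move=> F FG; rewrite /G /=.
pose H m := \big[setI/setT]_(k < m) (~` F k).
have GH m : G (H m).
  apply: big_ind; [by rewrite /G /= indicT; exact: P_cst|exact: GI|by move=> k _; exact: GC].
apply: (@P_cvg (fun m => \1_(~` (H m)))); first by move=> m; exact: GC.
move=> a; have [[k _ Fka]|nF] := pselect ((\bigcup_k F k) a).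
  apply: cvg_near_cst; exists k.+1 => // m /= km; rewrite !indicE !mem_set//.
    by exists k.
  by rewrite /H -(bigcap_mkord m (fun k => ~` F k)) => /(_ k km) /=; apply.
rewrite (_ : \1__ a = 0); last by rewrite indicE memNset.
apply: cvg_near_cst; apply: nearW => m; rewrite indicE memNset// => /=; apply.
by rewrite /H -(bigcap_mkord m (fun k => ~` F k)) => k /= _ Fka; apply: nF; exists k.
Qed.

Import HBNNSimple.

Lemma measurable_mxcalc (phi : R -> R) i j :
  measurable_fun setT phi -> (forall a, 0 <= phi a) ->
  measurable_fun setT (fun x => mxcalc phi (S x) i j).
Proof.
move=> /measurable_EFinP mphi phi0; move: i j; rewrite -/(P _).
pose f := nnsfun_approx (@measurableT _ (measurableTypeR R)) mphi.
have h1 m : P (fun a => f m a).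
  rewrite (_ : (fun a => _) = fun a : R => \sum_(y \in range (f m)) y * \1_(f m @^-1` [set y]) a).
    under eq_fun do rewrite fsbig_finite//=.
    apply: (P_sum _ (phi := fun y (a : R) => y * \1_(f m @^-1` [set y]) a)) => y.
    by apply: P_M; [exact: P_cst|apply: P_indic; exact: (measurable_sfunP (f m) (measurable_set1 y))].
  by apply/funext => a; exact: fimfunE.
have h2 a : f m a @[m --> \oo] --> phi a.
  have := @cvg_nnsfun_approx _ _ R _ (@measurableT _ (measurableTypeR R)) _ mphi.
  have p0 (x : R) : [set: R] x -> (0%R <= (EFin \o phi) x)%E by rewrite lee_fin.
  by move=> /(_ p0 a I) /fine_cvgP[_].
exact: (P_cvg h1 h2).
Qed.

End measurable_calculus.

(** [W x] may fail to be symmetric at some [x]. The calculus is applied to its symmetric part, and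
    the default value 0 is taken off the measurable set where [W x] is symmetric. *)
Lemma measurable_mxpow {R : realType} {n : nat} {d : measure_display}
    {T : measurableType d} (W : T -> 'M[R]_n) s i j :
  (forall i j, measurable_fun setT (fun x => W x i j)) ->
  measurable_fun setT (fun x => mxpow (W x) s i j).
Proof.
move=> mW; pose S x := 2^-1 *: (W x + (W x)^T).
have ST x : (S x)^T = S x by rewrite /S linearZ /= linearD /= trmxK addrC.
have mS k l : measurable_fun setT (fun x => S x k l).
  under eq_fun do rewrite !mxE; apply: measurable_funM => //.
  exact: measurable_funD.
rewrite (_ : (fun x => _) = fun x => if \big[andb/true]_k \big[andb/true]_l
   (W x k l == W x l k) then mxcalc (fun a => a `^ s) (S x) i j else 0); last first.
  apply/funext => x; case: ifPn => [h|h].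
    have WT : (W x)^T = W x.
      apply/matrixP => k l; rewrite mxE; apply/eqP.
      move: h; rewrite big_all => /allP /(_ l (mem_index_enum _)).
      by rewrite big_all => /allP /(_ k (mem_index_enum _)) /eqP ->.
    rewrite mxpow_mxcalc; congr (mxcalc _ _ i j).
    by apply/matrixP => k l; rewrite /S WT !mxE; field.
  rewrite mxpow_mxcalc mxcalc_nsym ?mxE// => WT; apply/negP: h; apply/negPn.
  rewrite big_all; apply/allP => k _; rewrite big_all; apply/allP => l _.
  by rewrite -{1}WT mxE eqxx.
have mbig (I : Type) (s0 : seq I) (b : I -> T -> bool) :
    (forall k, measurable_fun setT (b k)) ->
    measurable_fun setT (fun x => \big[andb/true]_(k <- s0) b k x).
  move=> mb; elim: s0 => [|k s0 ih].
    by under eq_fun do rewrite big_nil; exact: measurable_cst.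
  by under eq_fun do rewrite big_cons; exact: measurable_and.
apply: measurable_fun_ifT => //.
  by apply: (mbig) => k; apply: (mbig) => l; exact: measurable_fun_eqr.
by apply: (@measurable_mxcalc _ _ _ _ S ST mS _ _ _ (@measurable_powR R s)) => a; exact: powR_ge0.
Qed.

(** * Real powers of positive definite matrices *)

Section posdef_powers.
Context {R : realType} {n : nat}.
Implicit Types (A B : 'M[R]_n) (e u v : 'cV[R]_n).

Lemma posdef_spectral A : posdefmx A ->
  exists (U : 'M[R]_n) (D : 'rV[R]_n),
    [/\ orthmx U, A = U^T *m diag_mx D *m U & forall k, 0 < D ord0 k].
Proof.
move=> [AT Apos]; have [U [D [oU AE]]] := symmx_spectral AT.
exists U, D; split => // k.
pose e : 'cV[R]_n := delta_mx k ord0.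
have := Apos (U^T *m e).
have -> : U^T *m e != 0.
  rewrite -enorm_eq0 orthmx_enorm; last exact: orthmx_tr.
  rewrite enorm_eq0; apply/eqP => /colP/(_ k); rewrite !mxE !eqxx.
  by move/eqP; rewrite oner_eq0.
move=> /(_ erefl); rewrite AE trmx_mul trmxK !mulmxA -(mulmxA _ U U^T) oU mulmx1.
rewrite -(mulmxA _ U U^T) oU mulmx1 trmx_delta -mulmxA -rowE mxE.
by rewrite mul_diag_mx !mxE !eqxx mulr1.
Qed.

Lemma mxpowE (U : 'M[R]_n) (D : 'rV[R]_n) s : orthmx U ->
  mxpow (U^T *m diag_mx D *m U) s = U^T *m diag_mx (map_mx (fun a => a `^ s) D) *m U.
Proof. exact: mxcalcE. Qed.

Lemma enorm_conj_diag (U : 'M[R]_n) (D : 'rV[R]_n) u : orthmx U ->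
  enorm (U^T *m diag_mx D *m U *m u) ^+ 2 =
  \sum_k (D ord0 k ^+ 2 * (U *m u) k ord0 ^+ 2).
Proof.
move=> oU; rewrite -!mulmxA orthmx_enorm; last exact: orthmx_tr.
rewrite enorm_sqr dotE; apply: eq_bigr => k _.
by rewrite mul_diag_mx !mxE -exprMn expr2.
Qed.

Section one_matrix.
Variable A : 'M[R]_n.
Hypothesis Apd : posdefmx A.

Lemma mxpow_tr s : (mxpow A s)^T = mxpow A s.
Proof. by rewrite mxpow_mxcalc mxcalc_tr//; case: Apd. Qed.

Lemma mxpowD s t : mxpow A (s + t) = mxpow A s *m mxpow A t.
Proof.
have [U [D [oU -> D0]]] := posdef_spectral Apd.
rewrite !mxpowE// map_diag_mulmx//; congr (_ *m diag_mx _ *m _).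
by apply/rowP => k; rewrite !mxE powRD// (gt_eqF (D0 k)) implybT.
Qed.

Lemma mxpow0 : mxpow A 0 = 1%:M.
Proof.
rewrite mxpow_mxcalc -(@mxcalc_cst _ _ A _ 1); last by case: Apd.
by congr mxcalc; apply/funext => a; rewrite powRr0.
Qed.

Lemma mxpow1 : mxpow A 1 = A.
Proof.
have [U [D [oU -> D0]]] := posdef_spectral Apd.
rewrite !mxpowE//; congr (_ *m diag_mx _ *m _).
by apply/rowP => k; rewrite !mxE powRr1// ltW.
Qed.

Lemma mxpowNK s : mxpow A s *m mxpow A (- s) = 1%:M.
Proof. by rewrite -mxpowD subrr mxpow0. Qed.

Lemma mxpowKN s : mxpow A (- s) *m mxpow A s = 1%:M.
Proof. by rewrite -mxpowD addNr mxpow0. Qed.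

Lemma mxpow_inv : invmx A = mxpow A (- 1).
Proof.
have h : A *m mxpow A (- 1) = 1%:M by rewrite -{1}mxpow1 mxpowNK.
have uA : A \in unitmx by have [] := mulmx1_unit h.
by rewrite -[RHS](mulKmx uA) h mulmx1.
Qed.

Lemma mxpow_mxpow s t : mxpow (mxpow A s) t = mxpow A (s * t).
Proof.
have [U [D [oU -> D0]]] := posdef_spectral Apd.
rewrite (mxpowE D (s * t) oU) (mxpowE D s oU) mxpowE// -map_mx_comp; congr (_ *m diag_mx _ *m _).
by apply/rowP => k; rewrite !mxE /= -powRrM.
Qed.

Lemma enorm_mxpow_gt0 s e : e != 0 -> 0 < enorm (mxpow A s *m e).
Proof.
move=> e0; rewrite enorm_gt0; apply: contra_neq e0 => h.
by rewrite -[e]mul1mx -(mxpowKN s) -mulmxA h mulmx0.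
Qed.

Lemma powRXn (x r : R) m : 0 <= x -> (x `^ r) ^+ m = (x ^+ m) `^ r.
Proof.
move=> x0; elim: m => [|m ih]; first by rewrite !expr0 powR1.
by rewrite !exprS powRM ?exprn_ge0// ih.
Qed.

(** The right-hand side is the tangent at [c] of a concave power; Young's inequality with exponents
    [1 / th] and [1 / (1 - th)] proves it. *)
Lemma powR_tangent (x c th : R) : 0 <= x -> 0 < c -> 0 < th -> th <= 1 ->
  x `^ th <= c `^ th * (th * (x / c) + (1 - th)).
Proof.
move=> x0 c0 th0; rewrite le_eqVlt => /predU1P[->|th1].
  by rewrite !powRr1 ?(ltW c0)// mul1r subrr addr0 mulrC divfK ?gt_eqF.
have th'0 : 0 < 1 - th by rewrite subr_gt0.
have xc : 0 <= x / c by rewrite divr_ge0// ltW.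
rewrite -{1}[x](divfK (lt0r_neq0 c0)) powRM ?(ltW c0)// mulrC ler_wpM2l ?powR_ge0//.
have := @conjugate_powR R ((x / c) `^ th) 1 th^-1 (1 - th)^-1.
rewrite !invrK powR_ge0 ler01 !invr_gt0 th0 th'0 addrC subrK => /(_ isT isT isT isT erefl).
by rewrite mulr1 powR1 -powRrM divff ?gt_eqF// powRr1// mul1r [_ * th]mulrC.
Qed.

(* Jensen's inequality for the spectral measure of [A] at the unit vector [e]. *)
Lemma enorm_mxpow_interp a th e : 0 < th -> th <= 1 -> enorm e = 1 ->
  enorm (mxpow A (a * th) *m e) <= enorm (mxpow A a *m e) `^ th.
Proof.
move=> th0 th1 e1.
have e0 : e != 0 by rewrite -enorm_gt0 e1.
have := enorm_mxpow_gt0 a e0.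
have [U [D [oU -> D0]]] := posdef_spectral Apd.
rewrite !mxpowE//.
set N1 := enorm _; set N2 := enorm _ => N1p.
pose w k := (U *m e) k ord0 ^+ 2.
have w1 : \sum_k w k = 1.
  rewrite -(expr1n _ 2) -e1 -(orthmx_enorm e oU) enorm_sqr dotE.
  by apply: eq_bigr => k _; rewrite /w expr2.
pose X k := (D ord0 k `^ a) ^+ 2.
have N1E : N1 ^+ 2 = \sum_k X k * w k.
  by rewrite /N1 enorm_conj_diag//; apply: eq_bigr => k _; rewrite mxE.
have N2E : N2 ^+ 2 = \sum_k X k `^ th * w k.
  rewrite /N2 enorm_conj_diag//; apply: eq_bigr => k _; rewrite mxE /X.
  by rewrite powRrM powRXn ?powR_ge0.
have c0 : 0 < N1 ^+ 2 by rewrite exprn_gt0.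
rewrite -ler_sqr ?nnegrE ?enorm_ge0 ?powR_ge0// N2E.
have -> : (N1 `^ th) ^+ 2 = (N1 ^+ 2) `^ th.
  exact: powRXn (ltW N1p).
(* Tangent at the mean: the weights [w] have total mass one and [X] has mean [N1 ^+ 2], so the
   affine bounds sum to exactly the wanted value. *)
apply: (@le_trans _ _ (\sum_k ((N1 ^+ 2) `^ th * (th * (X k / N1 ^+ 2) + (1 - th)) * w k))).
  apply: ler_sum => k _; rewrite ler_wpM2r ?sqr_ge0//.
  by rewrite powR_tangent// sqr_ge0.
under eq_bigr do rewrite -mulrA mulrDl.
rewrite -mulr_sumr big_split /= -(mulr_sumr _ _ w) w1.
rewrite (_ : \sum_i _ = th / N1 ^+ 2 * \sum_k X k * w k); last first.
  by rewrite mulr_sumr; apply: eq_bigr => k _; ring.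
by rewrite -N1E divfK ?gt_eqF// mulr1 addrC subrK mulr1.
Qed.

End one_matrix.

Lemma orthmx_expand (U : 'M[R]_n) v : orthmx U ->
  v = \sum_i dot (col i U^T) v *: col i U^T.
Proof.
move=> oU; rewrite -{1}[v]mul1mx -(orthmxC oU) -mulmxA.
rewrite {1}(col_sum_delta (U *m v)) mulmx_sumr; apply: eq_bigr => i _.
rewrite -scalemxAr -colE; congr (_ *: _).
rewrite dotE mxE; apply: eq_bigr => k _; by rewrite !mxE.
Qed.

Lemma enorm_orthmx_col (U : 'M[R]_n) i : orthmx U -> enorm (col i U^T) = 1.
Proof.
move=> oU; rewrite colE orthmx_enorm; last exact: orthmx_tr.
rewrite /enorm (bigD1 i)//= big1 ?addr0; first by rewrite !mxE !eqxx expr1n sqrtr1.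
by move=> j ji; rewrite !mxE (negbTE ji) expr0n.
Qed.

(** The identity, resolved along the axes, is inserted between [A] and [B]; Cauchy-Schwarz bounds
    each coefficient. *)
Lemma enorm_mul_split (U A B : 'M[R]_n) u : orthmx U -> B^T = B ->
  enorm (A *m B *m u) <=
  \sum_i enorm (A *m col i U^T) * enorm (B *m col i U^T) * enorm u.
Proof.
move=> oU BT; rewrite -mulmxA {1}(orthmx_expand (B *m u) oU) mulmx_sumr.
rewrite (le_trans (ler_enorm_sum _ _ _))//; apply: ler_sum => i _.
rewrite -scalemxAr enormZ mulrC -mulrA ler_wpM2l ?enorm_ge0//.
by rewrite dot_mulmxr BT ler_dot.
Qed.

(* Test the bound on [z = A (A e)]. *)
Lemma dual_axis_bound (A : 'M[R]_n) e (c K : R) : A^T = A -> 0 <= K ->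
  (forall u, c * `|dot e (A *m u)| <= K * enorm u) ->
  c * enorm (A *m e) <= K.
Proof.
move=> AT K0 h; have [->|Ae] := eqVneq (A *m e) 0; first by rewrite enorm0 mulr0.
have := h (A *m e); rewrite dot_mulmxr AT -enorm_sqr ger0_norm ?sqr_ge0//.
by rewrite expr2 mulrA ler_pM2r ?enorm_gt0.
Qed.

End posdef_powers.

Lemma measurable_enorm {R : realType} {n : nat} {d : measure_display}
    {T : measurableType d} (v : T -> 'cV[R]_n) :
  (forall i, measurable_fun setT (fun x => v x i ord0)) ->
  measurable_fun setT (fun x => enorm (v x)).
Proof.
move=> mv; rewrite /enorm.
apply: (@measurableT_comp _ _ _ _ _ _ (@Num.sqrt R)).
  by apply: continuous_measurable_fun; exact: sqrt_continuous.
by apply: measurable_sum => i; exact: measurable_funX.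
Qed.

Lemma measurable_enorm_mul {R : realType} {n : nat} {d : measure_display}
    {T : measurableType d} (M : T -> 'M[R]_n) (v : T -> 'cV[R]_n) :
  (forall i j, measurable_fun setT (fun x => M x i j)) ->
  (forall i, measurable_fun setT (fun x => v x i ord0)) ->
  measurable_fun setT (fun x => enorm (M x *m v x)).
Proof.
move=> mM mv; apply: measurable_enorm => i; under eq_fun do rewrite mxE.
by apply: measurable_sum => j; exact: measurable_funM.
Qed.

(** * Lower integrals and averages *)

Section integral_toolkit.
Context {R : realType} {d : measure_display} {T : measurableType d}.
Variable mu : {measure set T -> \bar R}.
Local Open Scope ereal_scope.

Lemma measurable_powR_comp (D : set T) (f : T -> R) r :
  measurable_fun setT f -> measurable_fun D (fun x => ((f x) `^ r)%:E).
Proof.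
move=> mf; apply/measurable_EFinP; apply: measurable_funS (_ : measurable_fun setT _) => //.
by apply: (@measurableT_comp _ _ _ _ _ _ (fun y : R => y `^ r)%R) => //; exact: measurable_powR.
Qed.

(* No measurability is needed: the integral of a nonnegative function is a
   supremum over simple functions. *)
Lemma le_integral_any (D E : set T) (f g : T -> \bar R) :
  (forall x, D x -> 0 <= f x) -> (forall x, E x -> 0 <= g x) ->
  (forall x, D x -> f x != 0 -> E x /\ f x <= g x) ->
  \int[mu]_(x in D) f x <= \int[mu]_(x in E) g x.
Proof.
move=> f0 g0 fg; rewrite !ge0_integralE//; apply: le_ereal_sup => _ [h /= hf <-].
exists h => //= x; rewrite (le_trans (hf x))// !patchE.
case: ifPn => [/set_mem Dx|_]; last by case: ifPn => [/set_mem Ex|//]; exact: g0.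
have [->|fx0] := eqVneq (f x) 0.
  by case: ifPn => [/set_mem Ex|//]; exact: g0.
by have [Ex fgx] := fg x Dx fx0; rewrite mem_set.
Qed.

Lemma le_integral_dom (D : set T) (f g : T -> \bar R) :
  (forall x, D x -> 0 <= f x) -> (forall x, D x -> f x <= g x) ->
  \int[mu]_(x in D) f x <= \int[mu]_(x in D) g x.
Proof.
move=> f0 fg; apply: le_integral_any => // [x Dx|x Dx _]; last by split => //; exact: fg.
exact: le_trans (f0 x Dx) (fg x Dx).
Qed.

Lemma le_integral_sub (D E : set T) (f : T -> \bar R) :
  (forall x, E x -> 0 <= f x) -> D `<=` E ->
  \int[mu]_(x in D) f x <= \int[mu]_(x in E) f x.
Proof.
by move=> f0 DE; apply: le_integral_any => // x Dx; [exact/f0/DE|split => //; exact: DE].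
Qed.

Import HBNNSimple.

(** [f] may be non-measurable, so the null set is removed from every simple function below [f]
    rather than from [f]. *)
Lemma ge0_integral_setD_null (D N : set T) (f : T -> \bar R) :
  measurable D -> measurable N -> mu N = 0 -> (forall x, D x -> 0 <= f x) ->
  \int[mu]_(x in D) f x <= \int[mu]_(x in D `\` N) f x.
Proof.
move=> mD mN N0 f0; rewrite [leLHS]ge0_integralE//.
apply: ge_ereal_sup => _ [h /= hf <-].
have h0 x : 0 <= (h x)%:E by rewrite lee_fin.
have mh : measurable_fun setT (EFin \o h) by exact/measurable_EFinP.
rewrite -integralT_nnsfun (ge0_negligible_integral _ _ _ _ N0)//.
apply: le_integral_any => [x _|x [Dx _]|x [_ Nx] hx0].
- by [].
- exact: f0.
- have := hf x; rewrite patchE; case: ifPn => [/set_mem Dx|_].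
    by move=> hfx; split.
  by move=> hx; move: hx0; rewrite eq_le h0 hx.
Qed.

Lemma ae_le_integral_any (D : set T) (f g : T -> \bar R) :
  measurable D -> (forall x, D x -> 0 <= f x) -> (forall x, D x -> 0 <= g x) ->
  {ae mu, forall x, D x -> f x <= g x} ->
  \int[mu]_(x in D) f x <= \int[mu]_(x in D) g x.
Proof.
move=> mD f0 g0 [N [mN N0 fgN]].
rewrite (le_trans (ge0_integral_setD_null mD mN N0 f0))//.
apply: le_integral_any => // [x [Dx _]|x [Dx Nx] _]; first exact: f0.
by split => //; apply: contrapT => h; apply: Nx; apply: fgN => /(_ Dx).
Qed.

Lemma le_limn_einf (u : (\bar R)^nat) a N : (forall m, (N <= m)%N -> a <= u m) ->
  a <= limn_einf u.
Proof.
move=> h; rewrite limn_einf_lim (cvg_lim _ (@cvg_einfs_sup _ u))//.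
apply: le_trans (ereal_sup_ubound _); last by exists N.
by apply: le_ereal_inf_tmp => _ [m /= Nm <-]; exact: h.
Qed.

Lemma limn_einf_le (u : (\bar R)^nat) a : (forall m, u m <= a) -> limn_einf u <= a.
Proof.
move=> h; rewrite limn_einf_lim (cvg_lim _ (@cvg_einfs_sup _ u))//.
apply: ge_ereal_sup => _ [N _ <-]; rewrite /einfs /=.
by apply: le_trans (h N); apply: ereal_inf_lbound; exists N => /=.
Qed.

Lemma measurable_limn_einf (f : (T -> \bar R)^nat) :
  (forall m, measurable_fun setT (f m)) ->
  measurable_fun setT (fun x => limn_einf (f^~ x)).
Proof.
move=> mf; rewrite /limn_einf.
apply: measurableT_comp; first exact: oppe_measurable.
apply: (@measurable_fun_limn_esup _ _ _ _ (fun m x => - f m x)) => m.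
by apply: measurableT_comp => //; exact: oppe_measurable.
Qed.

(** The measurable [f m] carry the bound, while [g] may be a non-measurable maximal function. Every
    limit over grids or cut-offs is taken in this form. *)
Lemma fatou_le (D : set T) (f : (T -> \bar R)^nat) (g : T -> \bar R) K :
  measurable D -> (forall m, measurable_fun setT (f m)) -> (forall m x, 0 <= f m x) ->
  (forall m, \int[mu]_(x in D) f m x <= K) -> (forall x, D x -> 0 <= g x) ->
  (forall x, D x -> g x <= limn_einf (f^~ x)) ->
  \int[mu]_(x in D) g x <= K.
Proof.
move=> mD mf f0 fK g0 gf.
apply: (@le_trans _ _ (\int[mu]_(x in D) limn_einf (f^~ x))).
  exact: le_integral_dom.
apply: le_trans (fatou mu mD _ _) _.
- by move=> m; exact: measurable_funS (mf m).
- by move=> m x _; exact: f0.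
- exact: limn_einf_le.
Qed.

End integral_toolkit.

Section averages.
Context {R : realType} {d : measure_display} {T : measurableType d}.
Variable mu : {measure set T -> \bar R}.
Local Open Scope ereal_scope.
Variable B : set T.
Hypothesis B0 : 0 < mu B < +oo.

Lemma muB_fin : mu B \is a fin_num.
Proof. by have /andP[? ?] := B0; rewrite ge0_fin_numE. Qed.

Lemma fine_muB_gt0 : (0 < fine (mu B))%R.
Proof. by apply: fine_gt0. Qed.

Lemma avgE g : avg mu B g = (fine (mu B))^-1%:E * \int[mu]_(y in B) g y.
Proof.
by rewrite /avg -{1}(fineK muB_fin) inver gt_eqF ?fine_muB_gt0.
Qed.

Lemma avg_ge0 g : (forall y, B y -> 0 <= g y) -> 0 <= avg mu B g.
Proof.
by move=> g0; rewrite avgE mule_ge0 ?integral_ge0.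
Qed.

Lemma avg_le g a : (avg mu B g <= a) = (\int[mu]_(y in B) g y <= mu B * a).
Proof. by rewrite avgE lee_pdivrMl ?fine_muB_gt0// fineK// muB_fin. Qed.

Lemma avg_lt g a : (a < avg mu B g) = (mu B * a < \int[mu]_(y in B) g y).
Proof. by rewrite avgE lte_pdivlMl ?fine_muB_gt0// fineK// muB_fin. Qed.

Lemma avg_mul g : mu B * avg mu B g = \int[mu]_(y in B) g y.
Proof.
rewrite avgE muleA -{1}(fineK muB_fin) -EFinM mulfV ?mul1e//.
by rewrite gt_eqF// fine_muB_gt0.
Qed.

Lemma le_avg f g : (forall y, B y -> 0 <= f y) ->
  (forall y, B y -> f y <= g y) -> avg mu B f <= avg mu B g.
Proof.
by move=> f0 fg; rewrite !avgE lee_wpmul2l ?le_integral_dom.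
Qed.

End averages.

Lemma avg_sub {R : realType} {d : measure_display} {T : measurableType d}
    (mu : {measure set T -> \bar R}) (A B : set T) (C : R) (g : T -> \bar R) :
  (0 < mu A < +oo)%E -> (0 < mu B < +oo)%E -> (forall y, B y -> (0 <= g y)%E) ->
  A `<=` B -> (mu B <= C%:E * mu A)%E -> (avg mu A g <= C%:E * avg mu B g)%E.
Proof.
move=> A0 B0 g0 AB BA; rewrite avg_le//.
apply: le_trans (le_integral_sub mu g0 AB) _.
by rewrite -(avg_mul B0) [leRHS]muleA [(mu A * _)%E]muleC lee_wpmul2r// avg_ge0.
Qed.

(** * Countable measurable partitions *)

Section glue.
Context {R : realType} {d : measure_display} {T : measurableType d}.
Variable mu : {measure set T -> \bar R}.
Variable idx : T -> nat.
Hypothesis midx : forall k, measurable (idx @^-1` [set k]).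
Local Open Scope ereal_scope.

Lemma measurable_idx (P : set nat) : measurable (idx @^-1` P).
Proof.
rewrite (_ : _ @^-1` _ = \bigcup_(k in P) (idx @^-1` [set k])).
  by apply: bigcup_measurable => k _.
by apply/seteqP; split => [x Px|x [k Pk /= xk]]; [exists (idx x)|rewrite /= xk].
Qed.

Variables (J : Type) (kap : T -> J).
Hypothesis kapE : forall x y, idx x = idx y -> kap x = kap y.

(** The preimage is a union of fibers of [idx], of which there are countably many; this makes every
    set built from cubes measurable. *)
Lemma measurable_kap (P : set J) : measurable (kap @^-1` P).
Proof.
rewrite (_ : _ @^-1` _ = idx @^-1` [set k | exists2 x, idx x = k & P (kap x)]).
  exact: measurable_idx.
apply/seteqP; split => [x Px|x /= [y yx Py]]; first by exists x.
by rewrite /= -(kapE yx).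
Qed.

Lemma measurable_glue d' (T' : measurableType d') (F : J -> T -> T') :
  (forall j, measurable_fun setT (F j)) -> measurable_fun setT (fun x => F (kap x) x).
Proof.
move=> mF _ Y mY; rewrite setTI.
pose A k := [set x | idx x = k /\ Y (F (kap x) x)].
rewrite (_ : _ @^-1` _ = \bigcup_k A k); last first.
  by apply/seteqP; split => [x Yx|x [k _ []//]]; exists (idx x).
apply: bigcup_measurable => k _.
have [[x xk]|nk] := pselect (exists x, idx x = k).
  rewrite (_ : A k = idx @^-1` [set k] `&` (F (kap x) @^-1` Y)).
    by apply: measurableI => //; rewrite -[X in measurable X]setTI; exact: mF.
  have kk y : idx y = k -> kap y = kap x by move=> yk; apply: kapE; rewrite yk.
  by apply/seteqP; split => y /= [yk Yy]; split => //; move: Yy; rewrite /= (kk _ yk).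
rewrite (_ : A k = set0)//; apply/seteqP; split => y // [yk _].
by case: nk; exists y.
Qed.

Let rep_ex x : exists m, `[< exists2 y, idx y = m & kap y = kap x >].
Proof. by exists (idx x); apply/asboolP; exists x. Qed.

(** Numbers each fiber of [kap] by the least value of [idx] on it, which turns a partition labelled
    by [J] into a sequence of sets. *)
Let rep x := ex_minn (rep_ex x).

Let repP x : exists2 y, idx y = rep x & kap y = kap x.
Proof. by rewrite /rep; case: ex_minnP => m /asboolP. Qed.

Let rep_kap x y : kap x = kap y -> rep x = rep y.
Proof.
move=> xy; rewrite /rep; apply: eq_ex_minn => m.
by apply/idP/idP => /asboolP[z zm zx]; apply/asboolP; exists z => //; rewrite zx.
Qed.

Let kap_rep x y : rep x = rep y -> kap x = kap y.
Proof.
have [x' x'r <-] := repP x; have [y' y'r <-] := repP y => xy.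
by apply: kapE; rewrite x'r y'r.
Qed.

Lemma glue_le (D : set T) (F : J -> T -> \bar R) (G : T -> \bar R) :
  measurable D ->
  (forall j, measurable_fun setT (F j)) -> measurable_fun setT G ->
  (forall j x, 0 <= F j x) -> (forall x, 0 <= G x) ->
  (forall x, D x -> \int[mu]_(y in D `&` kap @^-1` [set kap x]) F (kap x) y <=
                    \int[mu]_(y in D `&` kap @^-1` [set kap x]) G y) ->
  \int[mu]_(x in D) F (kap x) x <= \int[mu]_(x in D) G x.
Proof.
move=> mD mF mG F0 G0 h.
pose A m := D `&` rep @^-1` [set m].
have mA m : measurable (A m).
  apply: measurableI => //.
  rewrite (_ : _ @^-1` _ = kap @^-1` [set j | exists2 x, kap x = j & rep x = m]).
    exact: measurable_kap.
  apply/seteqP; split => [x /= xm|x /= [y yx <-]]; first by exists x.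
  exact: rep_kap.
have DE : D = \bigcup_m A m.
  by apply/seteqP; split => [x Dx|x [m _ []]//]; exists (rep x).
have tA : trivIset setT A.
  by move=> m1 m2 _ _ [x [[_ /= <-] [_ /= <-]]].
rewrite DE !ge0_integral_bigcup//=; last 2 first.
  by rewrite -DE; exact: measurable_funS mG.
  by rewrite -DE; apply: (@measurable_funS _ _ _ _ setT) => //; exact: measurable_glue.
apply: lee_nneseries => [m _ _|m _].
  by apply: integral_ge0 => x _; exact: F0.
have [[x Ax]|nA] := pselect (A m !=set0); last first.
  rewrite (_ : A m = set0) ?integral_set0//.
  by apply/seteqP; split => // x Ax; case: nA; exists x.
have -> : A m = D `&` kap @^-1` [set kap x].
  case: Ax => _ /= <-; apply/seteqP; split => y [Dy /= yx]; split => //=.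
    exact: kap_rep.
  exact: rep_kap.
apply: le_trans (h x Ax.1); apply: le_integral_dom => [y _|y [_ /= ->]//].
exact: F0.
Qed.

End glue.

(** * Quasi-metric balls and dyadic grids *)

Lemma ex_le_nat {R : realType} (a : R) : exists k : nat, a <= k%:R.
Proof.
exists (Num.bound `|a|); rewrite (le_trans (ler_norm a))// ltW//.
exact: archi_boundP.
Qed.

Lemma ex_le_exp2 {R : realType} (a : R) : exists k : nat, a <= 2 ^+ k.
Proof.
have [k ak] := ex_le_nat a; exists k; apply: le_trans ak _.
elim: k => [|k ih]; first by rewrite expr0 ler01.
by rewrite exprS -natr1 mulr_natl mulr2n lerD// exprn_ege1// ler1n.
Qed.

Section homogeneous_geometry.
Context {R : realType} {d : measure_display} {T : measurableType d}.
Variables (mu : {measure set T -> \bar R}) (rho : T -> T -> R).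
Hypothesis sht : space_of_homogeneous_type mu rho.
Local Notation B := (qball rho).

Lemma qball_measurable x r : 0 < r -> measurable (B x r).
Proof. by move=> r0; apply: (sht_ball_measurable sht); exists x, r. Qed.

Lemma qball_measure x r : 0 < r -> (0 < mu (B x r) < +oo)%E.
Proof. by move=> r0; apply: (sht_ball_measure sht); exists x, r. Qed.

Lemma rho_sym x y : rho x y = rho y x.
Proof. by have [_ _ + _] := sht_quasi_metric sht; apply. Qed.

Lemma rho_refl x : rho x x = 0.
Proof. by have [_ + _ _] := sht_quasi_metric sht => /(_ x x)[_]; apply. Qed.

Lemma qball_center x r : 0 < r -> B x r x.
Proof. by move=> r0; rewrite /qball /= rho_refl. Qed.

Lemma le_qball x r s : r <= s -> B x r `<=` B x s.
Proof. by move=> rs y /= h; exact: lt_le_trans h rs. Qed.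

Lemma le_mu_qball x y r s : 0 < r -> 0 < s -> B x r `<=` B y s ->
  (mu (B x r) <= mu (B y s))%E.
Proof.
by move=> r0 s0 h; apply: le_measure => //; rewrite inE; exact: qball_measurable.
Qed.

Lemma qball_dilate (A : R) : exists2 C : R, 1 <= C &
  forall x r, 0 < r -> (mu (B x (A * r)) <= C%:E * mu (B x r))%E.
Proof.
have [c0 hc0] := sht_doubling sht; pose c := Num.max 1 c0.
have c1 : 1 <= c by rewrite le_max lexx.
have hc x r : 0 < r -> (mu (B x (2 * r)) <= c%:E * mu (B x r))%E.
  move=> r0; apply: le_trans (hc0 x r r0) _.
  by rewrite lee_wpmul2r// lee_fin le_max lexx orbT.
have key k x r : 0 < r -> (mu (B x (2 ^+ k * r)) <= (c ^+ k)%:E * mu (B x r))%E.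
  move=> r0; elim: k => [|k ih]; first by rewrite !expr0 mul1r mul1e.
  rewrite !exprS -mulrA; apply: le_trans (hc _ _ _) _; first by rewrite mulr_gt0// exprn_gt0.
  by rewrite EFinM -muleA lee_wpmul2l// lee_fin (le_trans ler01).
have [k Ak] := ex_le_exp2 A.
exists (c ^+ k); first exact: exprn_ege1.
move=> x r r0; apply: le_trans (key k x r r0).
have [A0|A0] := leP A 0.
  rewrite (_ : B x (A * r) = set0) ?measure0//; apply/seteqP; split => // y.
  rewrite /qball /= => h; have [+ _ _ _] := sht_quasi_metric sht => /(_ x y).
  by rewrite leNgt (lt_le_trans h)// pmulr_lle0.
apply: le_mu_qball; rewrite ?mulr_gt0// ?exprn_gt0//.
by apply: le_qball; rewrite ler_pM2r.
Qed.

Section constant.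
Variable kap : R.
Hypothesis kap1 : 1 <= kap.
Hypothesis rho_tri : forall x y z, rho x y <= kap * (rho x z + rho z y).

Let kap0 : 0 < kap := lt_le_trans ltr01 kap1.

Lemma rho_lt x y z a b : rho x z < a -> rho z y < b -> rho x y < kap * (a + b).
Proof.
by move=> xz zy; apply: le_lt_trans (rho_tri x y z) _; rewrite ltr_pM2l// ltrD.
Qed.

Lemma qball_sub_move x y r s : rho y x < s -> B x r `<=` B y (kap * (s + r)).
Proof. by move=> yx w /= xw; exact: rho_lt yx xw. Qed.

Lemma qball_comparable (A : R) : exists2 C : R, 1 <= C &
  forall x y r, 0 < r -> rho x y < A * r ->
    (mu (B x (A * r)) <= C%:E * mu (B y r))%E.
Proof.
have [C C1 hC] := qball_dilate (kap * (A + A)).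
exists C => // x y r r0 xy; apply: le_trans (hC y r r0).
have Ar : 0 < A * r.
  by apply: le_lt_trans xy; have [+ _ _ _] := sht_quasi_metric sht; apply.
rewrite -mulrA mulrDl; apply: le_mu_qball => //; first by rewrite mulr_gt0// addr_gt0.
by apply: qball_sub_move; rewrite rho_sym.
Qed.

(** The centers of a maximal family of disjoint balls of radius [s]: the second clause is
    disjointness, and the third is what maximality gives. *)
Definition net (s : R) (E : set T) : Prop :=
  [/\ countable E,
      forall z z' x, E z -> E z' -> rho z x < s -> rho z' x < s -> z = z' &
      forall x, exists2 z, E z & rho x z < kap * (s + s)].

(** Zorn's lemma gives a maximal family. It is countable by doubling: the disjoint balls with
    centers in a fixed ball lie in one ball whose measure is at most [C] times that of each of them,
    so at most [C] of them fit. *)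
Lemma net_exists s : 0 < s -> exists E, net s E.
Proof.
move=> s0; have [E [_ tE maxE]] := ex_maximal_disjoint_subcollection (fun z => B z s) setT.
have sep z z' x : E z -> E z' -> rho z x < s -> rho z' x < s -> z = z'.
  by move=> Ez Ez' zx z'x; apply: tE => //; exists x.
exists E; split => //; last first.
  move=> x; apply: contrapT => nx.
  have Ex : ~ E x.
    by move=> Ex; apply: nx; exists x => //; rewrite rho_refl mulr_gt0// addr_gt0.
  apply: (maxE (E `|` [set x])) => //.
    split; first by move=> z Ez; left.
    by move=> /(_ x) h; apply: Ex; apply: h; right.
  have nE z : E z -> ~ (B z s `&` B x s !=set0).
    move=> Ez [y [/= zy xy]]; apply: nx; exists z => //.
    by apply: rho_lt xy _; rewrite rho_sym.
  move=> z z' [Ez|->] [Ez'|->] //.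
  - exact: tE.
  - by move=> /(nE _ Ez).
  - by rewrite setIC => /(nE _ Ez').
have xE m : finite_set (E `&` B point m.+1%:R).
  apply: contrapT => infE.
  pose r : R := kap * (m.+1%:R + s).
  have r0 : 0 < r by rewrite mulr_gt0// addr_gt0.
  pose A := r / s.
  have Ar : A * s = r by rewrite /A divfK ?gt_eqF.
  have [C C1 hC] := qball_comparable A.
  have [K CK] := ex_le_nat C.
  have [F FE sF] := infinite_set_fset K.+1 infE.
  have finF : finite_set [set` F] by [].
  have mur := qball_measure point r0.
  have : (mu (\bigcup_(z in [set` F]) B z s) <= mu (B point r))%E.
    apply: le_measure.
    - rewrite inE; apply: fin_bigcup_measurable => // z _; exact: qball_measurable.
    - by rewrite inE; exact: qball_measurable.
    - move=> y [z /FE [Ez pz] zy]; exact: (qball_sub_move pz).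
  rewrite measure_fin_bigcup//; last 2 first.
  - by move=> z z' /FE[Ez _] /FE[Ez' _]; exact: tE.
  - by move=> z _; exact: qball_measurable.
  rewrite fsbig_finite//= set_fsetK.
  have lbz z : z \in F -> ((C^-1)%:E * mu (B point r) <= mu (B z s))%E.
    move=> zF; have [Ez pz] := FE z zF.
    rewrite lee_pdivrMl ?(lt_le_trans ltr01)//.
    rewrite -Ar; apply: hC => //; rewrite Ar (lt_trans pz)//.
    rewrite /r mulrDr ltr_pwDr ?mulr_gt0//.
    by rewrite ler_peMl.
  set N := size _ in sF.
  have : (N%:R%:E * ((C^-1)%:E * mu (B point r)) <= \sum_(z <- F) mu (B z s))%E.
    rewrite (_ : _ * _ = \sum_(z <- F) (C^-1)%:E * mu (B point r))%E; last first.
      by rewrite big_const_seq count_predT iter_addr_0 mule_natl.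
    by rewrite big_seq [leRHS]big_seq; apply: lee_sum => z zF; exact: lbz.
  move=> /le_trans h /h; rewrite -(fineK (muB_fin mur)) -!EFinM lee_fin mulrA.
  rewrite ger_pMl ?(fine_muB_gt0 mur)// ler_pdivrMr ?(lt_le_trans ltr01)// mul1r.
  rewrite leNgt => /negP; apply; apply: le_lt_trans CK _.
  by rewrite ltr_nat.
have -> : E = \bigcup_m (E `&` B point m.+1%:R).
  apply/seteqP; split => [x Ex|x [m _ []]//].
  have [m xm] := ex_le_nat (rho point x).
  by exists m => //; split => //; apply: le_lt_trans xm _; rewrite ltr_nat.
by apply: bigcup_countable => // m _; exact: finite_set_countable.
Qed.

End constant.

End homogeneous_geometry.

Section grid.
Context {R : realType} {d : measure_display} {T : measurableType d}.
Variables (mu : {measure set T -> \bar R}) (rho : T -> T -> R).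
Hypothesis sht : space_of_homogeneous_type mu rho.
Local Notation B := (qball rho).

(* Nested dyadic partitions of [T] from the finest scale [eps] upwards: the cube
   of level [i] (scale [eps * Lam ^ i]) around [x] is the fiber of [cen i]
   through [x], and [star i (cen i x)] is a ball containing it, of comparable
   measure.  Every cube is a union of fibers of [gidx]. *)
Record grid (C H Lam eps : R) : Type := Grid {
  gidx : T -> nat ;
  cen : nat -> T -> T ;
  star : nat -> T -> set T ;
  gidx_measurable : forall k, measurable (gidx @^-1` [set k]) ;
  cen_gidx : forall x y, gidx x = gidx y -> cen 0 x = cen 0 y ;
  cen_nest : forall i x y, cen i x = cen i y -> cen i.+1 x = cen i.+1 y ;
  star_ball : forall i z, qballs rho (star i z) ;
  cube_star : forall i x, star i (cen i x) x ;
  star_nest : forall i x, star i (cen i x) `<=` star i.+1 (cen i.+1 x) ;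
  star_cube_le : forall i x,
    (mu (star i (cen i x)) <= C%:E * mu (cen i @^-1` [set cen i x]))%E ;
  star_parent_le : forall i x,
    (mu (star i.+1 (cen i.+1 x)) <= C%:E * mu (star i (cen i x)))%E ;
  star_cover : forall i z r x, eps * Lam ^+ i <= r * Lam -> r <= eps * Lam ^+ i ->
    rho z x < r ->
    [/\ B z r `<=` star i (cen i x), star i (cen i x) `<=` B z (H * r) &
        (mu (star i (cen i x)) <= C%:E * mu (B z r))%E] }.

Section construction.
Variable kap : R.
Hypothesis kap1 : 1 <= kap.
Hypothesis rho_tri : forall x y z, rho x y <= kap * (rho x z + rho z y).

Let kap0 : 0 < kap := lt_le_trans ltr01 kap1.

(** Besides staying close, a parent must be the net point within [s] whenever there is one; this is
    what puts a ball around the center inside each cube. *)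
Lemma net_parent s E : net rho kap s E -> 0 < s ->
  exists par : T -> T, forall w, [/\ E (par w), rho w (par w) < kap * (s + s) &
    forall z, E z -> rho w z < s -> par w = z].
Proof.
move=> [_ sep cov] s0.
suff /choice[par hpar] : forall w, exists z', [/\ E z', rho w z' < kap * (s + s) &
    forall z, E z -> rho w z < s -> z' = z] by exists par.
move=> w.
have [[z Ez wz]|nz] := pselect (exists2 z, E z & rho w z < s).
  exists z; split => //.
    by rewrite (lt_le_trans wz)// mulrDr ler_wpDr ?mulr_ge0 ?(ltW s0)// ?ler_peMl// ltW.
  by move=> z' Ez' wz'; apply: (sep z z' w) => //; rewrite (rho_sym sht).
have [z Ez wz] := cov w; exists z; split => // z' Ez' wz'.
by case: nz; exists z'.
Qed.

(** Taking the first ball of the enumerated covering that contains [x] gives measurable pieces. Only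
    the finest scale needs this, coarser cubes being unions of these pieces. *)
Lemma net_index s E : net rho kap s E -> 0 < s ->
  exists (idx : T -> nat) (c : nat -> T),
    (forall k, measurable (idx @^-1` [set k])) /\
    forall x, rho x (c (idx x)) < kap * (s + s).
Proof.
move=> [cE _ cov] s0; have /countable_injP[e einj] := cE.
pose r := kap * (s + s); have r0 : 0 < r by rewrite mulr_gt0// addr_gt0.
pose P k x := exists z, [/\ E z, e z = k & rho x z < r].
have Pex x : exists k, `[< P k x >].
  by have [z Ez xz] := cov x; exists (e z); apply/asboolP; exists z.
pose idx x := ex_minn (Pex x).
have mP k : measurable [set x | P k x].
  have [[z [Ez ez]]|nz] := pselect (exists z, E z /\ e z = k).
    rewrite (_ : [set x | _] = B z r); first exact: (qball_measurable sht).
    apply/seteqP; split => x /=.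
      move=> [z' [Ez' ez' xz']]; rewrite /qball /= (rho_sym sht).
      by rewrite (einj z z')// ?inE// ez.
    by rewrite /qball /= => zx; exists z; rewrite (rho_sym sht).
  rewrite (_ : [set x | _] = set0)//; apply/seteqP; split => // x [z [Ez ez _]].
  by case: nz; exists z.
have [c hc] : exists c : nat -> T, forall k, forall z, E z -> e z = k -> c k = z.
  suff /choice[c hc] : forall k, exists z', forall z, E z -> e z = k -> z' = z by exists c.
  move=> k; have [[z [Ez ez]]|nz] := pselect (exists z, E z /\ e z = k).
    by exists z => z' Ez' ez'; apply: einj; rewrite ?inE// ez.
  by exists point => z Ez ez; case: nz; exists z.
exists idx, c; split.
  move=> k; rewrite (_ : _ @^-1` _ = [set x | P k x] `\` \bigcup_(m in `I_k) [set x | P m x]).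
    by apply: measurableD => //; apply: bigcup_measurable => m _.
  apply/seteqP; split => x; rewrite /idx /=; case: ex_minnP => m /asboolP Pm mmin.
    move=> <-; split => // -[l /= lm Pl].
    by have := mmin l (asboolT Pl); rewrite leqNgt lm.
  move=> [Pk nk]; apply/eqP; rewrite eqn_leq (mmin k (asboolT Pk))/= leqNgt.
  by apply/negP => mk; apply: nk; exists m.
move=> x; rewrite /idx; case: ex_minnP => m /asboolP[z [Ez ez xz]] _.
by rewrite (hc m z).
Qed.

(** [Lam] is the ratio of scales: points stay within [4 kap^2 s_i] of their center, and
    [kap (4 kap^2 / Lam + 1 / (2 kap)) = 1] keeps the ball of radius [s_i / (2 kap)] around a center
    inside its cube. [A] is the relative radius of [star]: [kap (4 kap^2 + 2 kap) <= A] lets it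
    swallow balls of radius up to [s_i]. [H] collects the same distances seen from a ball of radius
    at least [s_i / Lam]. *)
Let Lam := 8 * kap ^+ 3.
Let A := 6 * kap ^+ 3.
Let H := kap + kap ^+ 2 * (4 * kap ^+ 2 + A) * Lam.

Lemma grid_at_scale : exists2 C : R, 1 <= C &
  forall eps, 0 < eps -> exists _ : grid C H Lam eps, True.
Proof.
have k1 : 1 <= kap ^+ 1 by rewrite expr1.
have kk i : kap ^+ i <= kap ^+ i.+1 by rewrite exprS ler_peMl// exprn_ge0// ltW.
have k2 := kk 1%N; have k3 := kk 2%N; have k4 := kk 3%N; have k5 := kk 4%N.
have k6 := kk 5%N; have k7 := kk 6%N.
have kp i : 0 < kap ^+ i by rewrite exprn_gt0.
have Lam0 : 0 < Lam by rewrite mulr_gt0.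
have A0 : 0 < A by rewrite mulr_gt0.
have H0 : 0 < H by rewrite addr_gt0// !mulr_gt0// addr_gt0// mulr_gt0.
have [C1 C11 hC1] := qball_dilate sht (A * (2 * kap)).
have [C2 C21 hC2] := qball_dilate sht (kap * (2 * kap + A) * Lam / A).
have [C3 C31 hC3] := qball_dilate sht H.
pose C := Num.max C1 (Num.max C2 C3).
have CC1 : C1 <= C by rewrite le_max lexx.
have CC2 : C2 <= C by rewrite !le_max lexx orbT.
have CC3 : C3 <= C by rewrite !le_max lexx !orbT.
exists C; first exact: le_trans CC1.
move=> eps eps0.
pose s i := eps * Lam ^+ i.
have s0 i : 0 < s i by rewrite mulr_gt0// exprn_gt0.
have sS i : s i.+1 = Lam * s i by rewrite /s exprS mulrCA.
pose s' := eps / Lam.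
have s'0 : 0 < s' by rewrite divr_gt0.
have s0E : s 0%N = Lam * s' by rewrite /s /s' expr0 mulr1 mulrC divfK ?gt_eqF.
have [E0 nE0] := net_exists sht kap1 rho_tri s'0.
have [idx [c [midx hidx]]] := net_index nE0 s'0.
have [E nE] : exists E : nat -> set T, forall i, net rho kap (s i) (E i).
  suff /choice[E hE] : forall i, exists E, net rho kap (s i) E by exists E.
  by move=> i; exact: (net_exists sht kap1 rho_tri).
have [par hpar] : exists par : nat -> T -> T, forall i w,
    [/\ E i (par i w), rho w (par i w) < kap * (s i + s i) &
    forall z, E i z -> rho w z < s i -> par i w = z].
  suff /choice[par hpar] : forall i, exists par, forall w,
    [/\ E i (par w), rho w (par w) < kap * (s i + s i) &
    forall z, E i z -> rho w z < s i -> par w = z] by exists par.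
  by move=> i; exact: net_parent.
(* The ancestor of [x] in the net just below level [i]: that of scale [eps / Lam] for [i = 0], that
   of level [i - 1] otherwise. *)
pose pre := fix pre i x := if i is j.+1 then par j (pre j x) else c (idx x).
pose cen i x := par i (pre i x).
have preS i x : pre i.+1 x = cen i x by [].
have cenE i x : cen i.+1 x = par i.+1 (cen i x) by [].
have pre_lt i x : rho x (pre i x) * Lam < 4 * kap ^+ 2 * s i.
  elim: i => [|i ih] /=.
    rewrite s0E [_ * (Lam * _)]mulrCA [ltRHS]mulrC ltr_pM2r//.
    have := hidx x; move/lt_le_trans; apply.
    have : kap ^+ 1 * s' <= kap ^+ 2 * s' by rewrite ler_pM2r.
    have : 0 < kap ^+ 2 * s' by rewrite mulr_gt0.
    lra.
  have [_ h1 _] := hpar i (pre i x).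
  rewrite sS [_ * (Lam * _)]mulrCA [ltRHS]mulrC ltr_pM2r//.
  have h2 : rho x (pre i x) < 4 * kap ^+ 2 * s i / Lam by rewrite ltr_pdivlMr.
  apply: lt_le_trans (rho_lt kap1 rho_tri h2 h1) _.
  rewrite mulrDr (_ : kap * (4 * _ * _ / _) = s i / 2); last first.
    by rewrite /Lam; field; rewrite gt_eqF.
  have : kap ^+ 1 * s i <= kap ^+ 2 * s i by rewrite ler_pM2r.
  have : 1 * s i <= kap ^+ 1 * s i by rewrite ler_pM2r.
  have := s0 i; lra.
have cen_lt i x : rho x (cen i x) < 4 * kap ^+ 2 * s i.
  by have := pre_lt i.+1 x; rewrite sS [_ * (Lam * _)]mulrCA [ltRHS]mulrC ltr_pM2r.
have pre_lt' i x : rho x (pre i x) < 4 * kap ^+ 2 * s i / Lam by rewrite ltr_pdivlMr.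
have inner i x y : rho (cen i x) y < s i / (2 * kap) -> cen i y = cen i x.
  move=> xy; have [Ex _ _] := hpar i (pre i x).
  have [_ _] := hpar i (pre i y); apply => //.
  have h1 : rho (pre i y) y < 4 * kap ^+ 2 * s i / Lam by rewrite (rho_sym sht).
  rewrite (rho_sym sht) in xy.
  apply: lt_le_trans (rho_lt kap1 rho_tri h1 xy) _.
  rewrite le_eqVlt; apply/orP; left; apply/eqP; rewrite /Lam; field.
  by rewrite gt_eqF.
pose star i z := B z (A * s i).
have As0 i : 0 < A * s i by rewrite mulr_gt0.
have cube_star i x : star i (cen i x) x.
  rewrite /star /qball /= (rho_sym sht) (lt_le_trans (cen_lt i x))// ler_pM2r//.
  have := kp 2%N; rewrite /A; lra.
have cennest i x y : cen i x = cen i y -> cen i.+1 x = cen i.+1 y.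
  by rewrite !cenE => ->.
have cen0 x y : idx x = idx y -> cen 0%N x = cen 0%N y.
  by rewrite /cen /= => ->.
have mcube i z : measurable (cen i @^-1` [set z]).
  apply: (measurable_kap midx) => x y xy.
  by elim: i => [|i ih]; [exact: cen0|exact: cennest].
have leC (D : R) a b : D <= C -> (a <= D%:E * mu b)%E -> (a <= C%:E * mu b)%E.
  by move=> DC h; apply: le_trans h _; rewrite lee_wpmul2r.
have cover i z r x : s i <= r * Lam -> r <= s i -> rho z x < r ->
    [/\ B z r `<=` star i (cen i x), star i (cen i x) `<=` B z (H * r) &
        (mu (star i (cen i x)) <= C%:E * mu (B z r))%E].
  move=> ri rs zx.
  have r0 : 0 < r by rewrite -(pmulr_lgt0 _ Lam0) (lt_le_trans (s0 i)).
  have h1 : B z r `<=` star i (cen i x).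
    move=> y /= zy; rewrite (rho_sym sht) in zx.
    have xy := rho_lt kap1 rho_tri zx zy.
    have h : rho (cen i x) x < 4 * kap ^+ 2 * s i by rewrite (rho_sym sht).
    apply: lt_le_trans (rho_lt kap1 rho_tri h xy) _.
    have : kap ^+ 2 * s i <= kap ^+ 3 * s i by rewrite ler_pM2r.
    have : kap ^+ 2 * r <= kap ^+ 2 * s i by rewrite ler_pM2l.
    by rewrite /A; lra.
  have h2 : star i (cen i x) `<=` B z (H * r).
    move=> y /= cy.
    have xy := rho_lt kap1 rho_tri (cen_lt i x) cy.
    apply: lt_le_trans (rho_lt kap1 rho_tri zx xy) _.
    pose G := kap ^+ 2 * (4 * kap ^+ 2 + A).
    have G0 : 0 < G by rewrite mulr_gt0// addr_gt0// mulr_gt0.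
    rewrite (_ : kap * _ = kap * r + G * s i); last by rewrite /G; ring.
    rewrite (_ : H * r = kap * r + G * (r * Lam)); last by rewrite /H /G; ring.
    by rewrite lerD2l ler_pM2l.
  split => //; apply: (leC C3) => //; apply: le_trans (hC3 z r r0).
  by apply: (le_mu_qball sht) => //; rewrite mulr_gt0.
unshelve eexists (@Grid C H Lam eps idx cen star midx cen0 cennest _ cube_star _ _ _ cover) => //.
- by move=> i z; exists z, (A * s i).
- move=> i x y /= xy.
  have [_ h _] := hpar i.+1 (cen i x); rewrite -cenE (rho_sym sht) in h.
  apply: lt_le_trans (rho_lt kap1 rho_tri h xy) _.
  rewrite sS /A /Lam.
  have : kap ^+ 4 * s i <= kap ^+ 5 * s i by rewrite ler_pM2r.
  have : kap ^+ 5 * s i <= kap ^+ 6 * s i by rewrite ler_pM2r.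
  have := kp 6%N; have : 0 < kap ^+ 6 * s i by rewrite mulr_gt0.
  lra.
- move=> i x; pose r := s i / (2 * kap).
  have r0 : 0 < r by rewrite divr_gt0// mulr_gt0.
  have := hC1 (cen i x) r r0.
  rewrite (_ : A * (2 * kap) * r = A * s i); last by rewrite /r; field; rewrite gt_eqF.
  move/(leC C1 _ _ CC1) => /le_trans; apply.
  rewrite lee_wpmul2l//; first by rewrite lee_fin (le_trans ler01)// (le_trans C11).
  apply: le_measure; rewrite ?inE//; first exact: (qball_measurable sht).
  by move=> y /= h; exact: inner.
- move=> i x; have := hC2 (cen i x) (A * s i) (As0 i).
  rewrite (_ : _ / A * _ = kap * (2 * kap + A) * Lam * s i); last first.
    by field; rewrite gt_eqF.
  move/(leC C2 _ _ CC2); apply: le_trans.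
  have G0 : 0 < kap * (2 * kap + A) * Lam * s i.
    by do 3! [apply: mulr_gt0 => //]; apply: addr_gt0 => //; exact: mulr_gt0.
  apply: (le_mu_qball sht) => //.
  have [_ h _] := hpar i.+1 (cen i x); rewrite -cenE in h.
  rewrite (_ : _ * s i = kap * (kap * (s i.+1 + s i.+1) + A * s i.+1)).
    exact: (qball_sub_move kap1 rho_tri h).
  by rewrite sS; ring.
Qed.

Lemma grid_level eps r : 0 < eps -> eps <= r * Lam ->
  exists2 i, eps * Lam ^+ i <= r * Lam & r <= eps * Lam ^+ i.
Proof.
move=> eps0 er.
have L2 : 2 <= Lam.
  by have : 1 <= kap ^+ 3 by [rewrite exprn_ege1]; rewrite /Lam; lra.
have Lp m : 0 < Lam ^+ m by rewrite exprn_gt0// (lt_le_trans _ L2).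
have ex : exists i, r <= eps * Lam ^+ i.
  have [k hk] := ex_le_exp2 (r / eps).
  exists k; rewrite -ler_pdivrMl// mulrC (le_trans hk)//.
  by rewrite lerXn2r ?nnegrE// (le_trans _ L2).
exists (ex_minn ex); case: ex_minnP => // -[_ _|m rm mmin]; first by rewrite expr0 mulr1.
rewrite exprSr mulrA ler_pM2r ?(lt_le_trans _ L2)//.
by rewrite leNgt; apply/negP => /ltW /mmin; rewrite ltnn.
Qed.

End construction.

Theorem grids_exist : exists (C H Lam : R),
  [/\ 1 <= C, 1 <= H, 1 <= Lam,
      forall eps, 0 < eps -> exists _ : grid C H Lam eps, True &
      forall eps r, 0 < eps -> eps <= r * Lam ->
        exists2 i, eps * Lam ^+ i <= r * Lam & r <= eps * Lam ^+ i].
Proof.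
have [_ _ _ [kap kap1 tri]] := sht_quasi_metric sht.
have [C C1 hC] := grid_at_scale kap1 tri.
have k3 : 1 <= kap ^+ 3 by rewrite exprn_ege1.
have kp m : 0 < kap ^+ m by rewrite exprn_gt0// (lt_le_trans ltr01).
do 3 eexists; split; first exact: C1; last 2 first.
- exact: hC.
- exact: grid_level.
- rewrite -[leLHS]addr0; apply: lerD => //; apply: ltW.
  have h : 0 < 4 * kap ^+ 2 + 6 * kap ^+ 3 by apply: addr_gt0; exact: mulr_gt0.
  by rewrite (mulr_gt0 (mulr_gt0 (kp 2%N) h))// mulr_gt0.
- lra.
Qed.

End grid.

(** * Maximal inequalities on a grid *)

Section vitali.
Context {R : realType} {d : measure_display} {T : measurableType d}.
Variables (mu : {measure set T -> \bar R}) (rho : T -> T -> R).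
Hypothesis sht : space_of_homogeneous_type mu rho.
Local Notation B := (qball rho).
Local Open Scope ereal_scope.

Let U (s : seq (T * R)) := \bigcup_(b in [set` s]) B b.1 b.2.

Let mU s : (forall b, b \in s -> (0 < b.2)%R) -> measurable (U s).
Proof.
move=> s0; apply: fin_bigcup_measurable => // b /= bs.
by apply: (qball_measurable sht); exact: s0.
Qed.

Let ex_max_radius (b : T * R) s : exists2 c, c \in b :: s &
  forall c', c' \in b :: s -> (c'.2 <= c.2)%R.
Proof.
elim: s b => [|b' s ih] b.
  by exists b; rewrite ?mem_head// => c'; rewrite inE => /eqP ->.
have [c cs cmax] := ih b'.
have [bc|cb] := leP b.2 c.2.
  exists c; first by rewrite in_cons cs orbT.
  by move=> c'; rewrite in_cons => /predU1P[->//|]; exact: cmax.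
exists b; first exact: mem_head.
move=> c'; rewrite in_cons => /predU1P[->//|/cmax h].
by rewrite (le_trans h)// ltW.
Qed.

(* Vitali's selection by induction: remove a ball of largest radius together
   with all the balls that meet it. *)
Lemma vitali_finite : exists2 C : R, (1 <= C)%R &
  forall (g : T -> \bar R) (lam : R) (s : seq (T * R)),
    measurable_fun setT g -> (forall x, 0 <= g x) -> (0 < lam)%R ->
    (forall b, b \in s -> (0 < b.2)%R /\
       lam%:E * mu (B b.1 b.2) <= \int[mu]_(x in B b.1 b.2) g x) ->
    lam%:E * mu (\bigcup_(b in [set` s]) B b.1 b.2) <=
    C%:E * \int[mu]_(x in \bigcup_(b in [set` s]) B b.1 b.2) g x.
Proof.
have [_ _ _ [kap kap1 tri]] := sht_quasi_metric sht.
have kap0 : (0 < kap)%R := lt_le_trans ltr01 kap1.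
(* A ball of radius at most [r] that meets [B z r] lies in [B z (K * r)]. *)
pose K : R := (kap * (kap * (1 + 1) + 1))%R.
have [C C1 hC] := qball_dilate sht K.
exists C => // g lam s mg g0 lam0; rewrite -/(U s).
have [n] := ubnP (size s); elim: n s => // n IH [|b0 s'] //.
  by move=> _ _; rewrite /U set_nil bigcup_set0 measure0 integral_set0 !mule0.
set s := b0 :: s' => sn hs.
have [[z r] bs bmax] := ex_max_radius b0 s'.
have [/= r0 br] := hs _ bs.
pose s1 := [seq c <- s | `[< B c.1 c.2 `&` B z r = set0 >]].
have s1s c : c \in s1 -> c \in s by rewrite mem_filter => /andP[].
have s1dis c : c \in s1 -> B c.1 c.2 `&` B z r = set0.
  by rewrite mem_filter => /andP[/asboolP].
have s1n : (size s1 < n)%N.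
  have : (size s1 < size s)%N.
    rewrite size_filter -(count_predC [pred c | `[< B c.1 c.2 `&` B z r = set0 >]] s).
    rewrite -[ltnLHS]addn0 ltn_add2l -has_count; apply/hasP; exists (z, r) => //=.
    apply/negP => /asboolP; apply/eqP/set0P; exists z; split; exact: (qball_center sht).
  by move=> h; apply: leq_trans h _.
have K0 : (0 < K)%R by rewrite mulr_gt0// addr_gt0// mulr_gt0.
have mz : measurable (B z r) by exact: (qball_measurable sht).
have mKz : measurable (B z (K * r)%R) by apply: (qball_measurable sht); rewrite mulr_gt0.
have ms1 : measurable (U s1) by apply: mU => c /s1s /hs[].
have ms : measurable (U s) by apply: mU => c /hs[].
have cov : U s `<=` B z (K * r)%R `|` U s1.
  move=> y [c /= cs cy]; have [cz|cz] := pselect (B c.1 c.2 `&` B z r = set0).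
    right; exists c => //=; rewrite mem_filter; apply/andP; split => //.
    exact/asboolP.
  left; have /eqP/set0P[w [/= cw zw]] := cz.
  have cr : (c.2 <= r)%R := bmax c cs.
  rewrite /qball /= (rho_sym sht) in cw.
  have zc := rho_lt kap1 tri zw (lt_le_trans cw cr).
  apply: lt_le_trans (rho_lt kap1 tri zc (lt_le_trans cy cr)) _.
  by rewrite le_eqVlt; apply/orP; left; apply/eqP; rewrite /K; ring.
have int_split : \int[mu]_(x in B z r) g x + \int[mu]_(x in U s1) g x <=
    \int[mu]_(x in U s) g x.
  rewrite -ge0_integral_setU//.
  - apply: le_integral_sub => // y [zy|[c /= cs cy]]; first by exists (z, r).
    by exists c => //=; exact: s1s.
  - exact: measurable_funS mg.
  - apply/disj_setPS => y [zy [c /= cs cy]].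
    by have : (B c.1 c.2 `&` B z r) y by []; rewrite s1dis.
have IHs1 := IH s1 s1n (fun c cs => hs c (s1s c cs)).
apply: (@le_trans _ _ (lam%:E * (mu (B z (K * r)%R) + mu (U s1)))).
  rewrite lee_wpmul2l ?lee_fin ?(ltW lam0)//.
  apply: le_trans (measureU2 mu mKz ms1).
  by apply: le_measure => //; rewrite inE//; exact: measurableU.
rewrite ge0_muleDr//.
have h1 : lam%:E * mu (B z (K * r)%R) <= C%:E * \int[mu]_(x in B z r) g x.
  apply: (@le_trans _ _ (lam%:E * (C%:E * mu (B z r)))).
    by rewrite lee_wpmul2l ?lee_fin ?(ltW lam0)// hC.
  by rewrite muleCA lee_wpmul2l// lee_fin (le_trans ler01).
apply: le_trans (leeD h1 IHs1) _.
rewrite -ge0_muleDr ?integral_ge0//.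
by rewrite lee_wpmul2l// lee_fin (le_trans ler01).
Qed.

(** Finite subfamilies exhaust the union, and the measure is continuous from below. Countable
    families suffice for the stars of a grid. *)
Lemma weak_type_balls : exists2 C : R, (1 <= C)%R &
  forall (g : T -> \bar R) (lam : R) (F : nat -> set T) (P : set nat),
    measurable_fun setT g -> (forall x, 0 <= g x) -> (0 < lam)%R ->
    (forall m, qballs rho (F m)) ->
    (forall m, P m -> lam%:E * mu (F m) <= \int[mu]_(x in F m) g x) ->
    lam%:E * mu (\bigcup_(m in P) F m) <= C%:E * \int[mu]_x g x.
Proof.
have [C C1 hC] := vitali_finite; exists C => // g lam F P mg g0 lam0 Fb hP.
have /choice[b hb] : forall m, exists b : T * R, (0 < b.2)%R /\ F m = B b.1 b.2.
  by move=> m; have [x [r [r0 ->]]] := Fb m; exists (x, r).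
have mF m : measurable (F m) by exact: (sht_ball_measurable sht).
pose G n := \bigcup_(m in P `&` `I_n) F m.
have mG n : measurable (G n) by apply: bigcup_measurable => m _.
have GE : \bigcup_(m in P) F m = \bigcup_n G n.
  apply/seteqP; split => [x [m Pm Fx]|x [n _ [m [Pm _] Fx]]]; last by exists m.
  by exists m.+1 => //; exists m => //; split => //=.
have ndG : nondecreasing_seq G.
  move=> n m nm; apply/subsetPset => x [k [Pk /= kn] Fx]; exists k => //.
  by split => //=; exact: leq_trans nm.
rewrite GE.
have cvgG := @nondecreasing_cvg_mu _ _ _ mu _ mG (bigcupT_measurable _ mG) ndG.
have Gle n : mu (G n) <= (lam^-1)%:E * (C%:E * \int[mu]_x g x).
  rewrite lee_pdivlMl//.
  pose s := [seq b m | m <- iota 0 n & `[< P m >]].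
  have GU : G n = \bigcup_(c in [set` s]) B c.1 c.2.
    apply/seteqP; split => [x [m [Pm /= mn] Fx]|x [c /= cs cx]].
      exists (b m); last by have [_ <-] := hb m.
      by apply/mapP; exists m => //; rewrite mem_filter mem_iota mn !andbT; apply/asboolP.
    move: cs => /mapP[m]; rewrite mem_filter mem_iota => /andP[/asboolP Pm mn] cE.
    by exists m; [split|have [_ ->] := hb m; rewrite -cE].
  rewrite GU; apply: le_trans (hC g lam s mg g0 lam0 _) _.
    move=> c /mapP[m]; rewrite mem_filter => /andP[/asboolP Pm _] ->.
    by have [r0 FE] := hb m; split => //; rewrite -FE; exact: hP.
  rewrite lee_wpmul2l ?lee_fin ?(le_trans ler01)//.
  by apply: le_integral_sub.
rewrite -lee_pdivlMl//.
rewrite -(cvg_lim _ cvgG)//; apply: lime_le; first by apply/cvg_ex; eexists; exact: cvgG.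
by apply: nearW => n; exact: Gle.
Qed.

End vitali.

Section grid_maximal.
Context {R : realType} {d : measure_display} {T : measurableType d}.
Variables (mu : {measure set T -> \bar R}) (rho : T -> T -> R).
Hypothesis sht : space_of_homogeneous_type mu rho.
Local Open Scope ereal_scope.

Section one_grid.
Context {C H Lam eps : R}.
Variable G : grid mu rho C H Lam eps.

Lemma star_measurable i z : measurable (star G i z).
Proof. by apply: (sht_ball_measurable sht); exact: star_ball. Qed.

Lemma star_measure i z : 0 < mu (star G i z) < +oo.
Proof. by apply: (sht_ball_measure sht); exact: star_ball. Qed.

Lemma cen_eq_gidx i x y : gidx G x = gidx G y -> cen G i x = cen G i y.
Proof. by move=> xy; elim: i => [|i ih]; [exact: cen_gidx|exact: cen_nest]. Qed.

Lemma cen_eq_up i j x y : (i <= j)%N -> cen G i x = cen G i y -> cen G j x = cen G j y.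
Proof.
move=> /subnK <-; elim: (j - i)%N => [|k ih] // xy; rewrite addSn.
by apply: cen_nest; exact: ih.
Qed.

Lemma measurable_gidx_fun d' (T' : measurableType d') (f : T -> T') :
  (forall x y, gidx G x = gidx G y -> f x = f y) -> measurable_fun setT f.
Proof.
move=> fE _ Y _; rewrite setTI.
exact: (measurable_kap (@gidx_measurable _ _ _ _ _ _ _ _ _ G) fE).
Qed.

Lemma cube_measurable i z : measurable (cen G i @^-1` [set z]).
Proof.
apply: (measurable_kap (@gidx_measurable _ _ _ _ _ _ _ _ _ G)) => x y.
exact: cen_eq_gidx.
Qed.

Lemma star_nest_le i j x : (i <= j)%N -> star G i (cen G i x) `<=` star G j (cen G j x).
Proof.
move=> /subnK <-; elim: (j - i)%N => [|k ih] //; rewrite addSn.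
by apply: subset_trans ih _; exact: star_nest.
Qed.

Lemma cube_sub_star i x : cen G i @^-1` [set cen G i x] `<=` star G i (cen G i x).
Proof. by move=> y /= <-; exact: cube_star. Qed.

Lemma cube_measure i x : 0 < mu (cen G i @^-1` [set cen G i x]) < +oo.
Proof.
have /andP[s0 sy] := star_measure i (cen G i x).
apply/andP; split.
  rewrite lt0e measure_ge0 andbT; apply/eqP => h.
  by have := star_cube_le G i x; rewrite h mule0 leNgt s0.
apply: le_lt_trans sy; apply: le_measure; rewrite ?inE.
- exact: cube_measurable.
- exact: star_measurable.
- exact: cube_sub_star.
Qed.

Definition gavg (g : T -> \bar R) (i : nat) (z : T) := avg mu (star G i z) g.

Definition gmax (g : T -> \bar R) (x : T) : \bar R :=
  ereal_sup [set gavg g i (cen G i x) | i in [set: nat]].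

Lemma gavg_ge0 g i z : (forall x, 0 <= g x) -> 0 <= gavg g i z.
Proof. by move=> g0; apply: avg_ge0 => //; exact: star_measure. Qed.

Lemma gmax_ub g i x : gavg g i (cen G i x) <= gmax g x.
Proof. by apply: ereal_sup_ubound; exists i. Qed.

Lemma gmax_ge0 g x : (forall x, 0 <= g x) -> 0 <= gmax g x.
Proof. by move=> g0; apply: le_trans (gmax_ub g 0 x); exact: gavg_ge0. Qed.

(** The averages depend on [x] only through its fiber of [gidx], whatever [g] is. *)
Lemma measurable_gmax g : measurable_fun setT (gmax g).
Proof.
apply: measurable_gidx_fun => x y xy; congr ereal_sup; apply/seteqP.
by split => _ [i _ <-]; exists i => //; rewrite (cen_eq_gidx i xy).
Qed.

End one_grid.

(** The stars of cubes are indexed by a level and a fiber of [gidx], hence countably many. The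
    constant comes from the covering lemma alone and is the same for all grids. *)
Lemma grid_weak : exists2 Cv : R, (1 <= Cv)%R &
  forall C H Lam eps (G : grid mu rho C H Lam eps) (g : T -> \bar R) (lam : R),
    measurable_fun setT g -> (forall x, 0 <= g x) -> (0 < lam)%R ->
    lam%:E * mu [set x | lam%:E < gmax G g x] <= Cv%:E * \int[mu]_x g x.
Proof.
have [Cv Cv1 hCv] := weak_type_balls sht; exists Cv => // C H Lam eps G g lam mg g0 lam0.
have /choice[rep hrep] : forall k, exists x, forall y, gidx G y = k -> gidx G x = k.
  move=> k; have [[x xk]|nk] := pselect (exists x, gidx G x = k); first by exists x.
  by exists point => y yk; case: nk; exists y.
pose dec m : nat * nat := odflt (0%N, 0%N) (choice.unpickle m).
pose F m := star G (dec m).1 (cen G (dec m).1 (rep (dec m).2)).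
pose P := [set m | lam%:E * mu (F m) <= \int[mu]_(x in F m) g x].
apply: le_trans (hCv g lam F P mg g0 lam0 _ _); last 2 first.
- by move=> m; exact: star_ball.
- by move=> m.
rewrite lee_wpmul2l ?lee_fin ?(ltW lam0)//; apply: le_measure; rewrite ?inE.
- rewrite -[X in measurable X]setTI; apply: emeasurable_fun_o_infty => //.
  exact: measurable_gmax.
- by apply: bigcup_measurable => m _; exact: star_measurable.
move=> x /= /ereal_sup_gt[_ [i _ <-] lx].
pose m := choice.pickle (i, gidx G x).
have dm : dec m = (i, gidx G x) by rewrite /dec /m choice.pickleK.
have xr : cen G i (rep (gidx G x)) = cen G i x by apply: cen_eq_gidx; exact: hrep.
have FE : F m = star G i (cen G i x) by rewrite /F dm /= xr.
exists m; last by rewrite FE; exact: cube_star.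
move: lx; rewrite /P /= FE /gavg avg_lt; last exact: star_measure.
by rewrite muleC => /ltW.
Qed.

End grid_maximal.

Lemma le_poweR {R : realType} (r : R) (x y : \bar R) : 0 <= r ->
  (0 <= x)%E -> (x <= y)%E -> (x `^ r <= y `^ r)%E.
Proof.
move=> r0 x0 xy; apply: gt0_ler_poweR => //; rewrite in_itv /= ?leey ?andbT//.
exact: le_trans xy.
Qed.

Lemma le_powR {R : realType} (r x y : R) : 0 <= r -> 0 <= x -> x <= y ->
  x `^ r <= y `^ r.
Proof.
by move=> r0 x0 xy; apply: ge0_ler_powR => //; rewrite nnegrE// (le_trans x0).
Qed.

Lemma nneseries_ge_term {R : realType} (a : (\bar R)^nat) m :
  (forall m, (0 <= a m)%E) -> (a m <= \sum_(0 <= k <oo) a k)%E.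
Proof.
move=> a0; apply: le_trans (@nneseries_lim_ge _ a xpredT 0%N m.+1 _) => //.
by rewrite big_nat_recr//= leeDr// sume_ge0.
Qed.

Lemma nneseries_le_partial {R : realType} (a : (\bar R)^nat) b :
  (forall m, (0 <= a m)%E) -> (forall n, (\sum_(0 <= k < n) a k <= b)%E) ->
  (\sum_(0 <= k <oo) a k <= b)%E.
Proof.
move=> a0 h; apply: lime_le; first by apply: is_cvg_nneseries => *; exact: a0.
by apply: nearW => n; exact: h.
Qed.

(** * Strong type inequality by interpolation over dyadic levels *)

Section dyadic_levels.
Context {R : realType}.
Variable eps : R.
Hypothesis eps0 : 0 < eps.
Let u m := eps * 2 ^+ m.

Let u0 m : 0 < u m. Proof. by rewrite mulr_gt0// exprn_gt0. Qed.

(** One term suffices: the last level [u m] below a finite [v] satisfies [v <= 2 * u m]. An infinite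
    [v] is reached through the finite numbers below it. *)
Lemma dyadic_levels_ge (v : \bar R) (t : R) : 0 < t -> (eps%:E < v)%E ->
  (v `^ t <= \sum_(0 <= m <oo) (if (u m)%:E < v then ((2 * u m) `^ t)%:E else 0))%E.
Proof.
move=> t0 ev; set a := (X in \big[_/_]_(_ <= m <oo) X m).
have a0 m : (0 <= a m)%E by rewrite /a; case: ifPn => // _; rewrite lee_fin powR_ge0.
have key (w : R) : 0 <= w -> (w%:E <= v)%E -> ((w `^ t)%:E <= \sum_(0 <= m <oo) a m)%E.
  move=> w0 wv; have ex : exists k, w <= u k.
    have [k hk] := ex_le_exp2 (w / eps).
    by exists k; rewrite /u -ler_pdivrMl// mulrC.
  have [m mw wm] : exists2 m, ((u m)%:E < v)%E & w <= 2 * u m.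
    case: (ex_minnP ex) => -[|m] wm mmin.
      exists 0%N; rewrite /u expr0 mulr1//; rewrite /u expr0 mulr1 in wm.
      by rewrite (le_trans wm)// ler_peMl ?(ltW eps0)// ler1n.
    exists m; last by rewrite mulrCA -exprS.
    apply: lt_le_trans wv; rewrite lte_fin ltNge; apply/negP => /mmin.
    by rewrite ltnn.
  apply: le_trans (nneseries_ge_term m a0).
  by rewrite /a mw lee_fin le_powR// ltW.
have v0 : (0 <= v)%E by apply: ltW; apply: le_lt_trans ev; rewrite lee_fin ltW.
case: (ltP v +oo%E) => [vy|].
  have vfin : v \is a fin_num by rewrite ge0_fin_numE.
  rewrite -(fineK vfin) poweR_EFin; apply: key; first exact: fine_ge0.
  by rewrite fineK.
rewrite leye_eq => /eqP vy; rewrite {1}vy poweRyr ?gt_eqF//.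
rewrite leye_eq; apply/eqP; apply/eqyP => A A0.
have h : `|A| = (`|A| `^ t^-1) `^ t by rewrite -powRrM mulVf ?gt_eqF// powRr1.
apply: le_trans (key (`|A| `^ t^-1) (powR_ge0 _ _) _); last by rewrite vy leey.
by rewrite -h lee_fin ler_norm.
Qed.

(** A geometric sum is dominated by its last term, here below the power of [w]. *)
Lemma dyadic_levels_le (w s : R) : 0 <= w -> 0 < s ->
  (\sum_(0 <= m <oo) (if (u m < w)%R then (u m `^ s)%:E else 0) <=
   (w `^ s / (1 - 2 `^ (- s)))%:E)%E.
Proof.
move=> w0 s0; set q := 2 `^ (- s).
have q1 : 0 < 1 - q.
  rewrite subr_gt0 /q powRN invf_lt1 ?powR_gt0//.
  by rewrite /powR pnatr_eq0 /= expR_gt1 mulr_gt0// ln_gt0// ltr1n.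
have uS m : u m `^ s = q * u m.+1 `^ s.
  rewrite (_ : u m.+1 = 2 * u m); last by rewrite /u exprS mulrCA.
  rewrite [in RHS]powRM ?(ltW (u0 m))// /q mulrA -powRD ?addNr ?powRr0 ?mul1r//.
  by rewrite pnatr_eq0 implybT.
have geo n : \sum_(0 <= m < n.+1) u m `^ s <= u n `^ s / (1 - q).
  elim: n => [|n ih].
    by rewrite big_nat1 ler_peMr ?powR_ge0// invf_ge1// gerBl powR_ge0.
  rewrite big_nat_recr//= (le_trans (lerD ih (lexx _)))// uS.
  rewrite le_eqVlt; apply/orP; left; apply/eqP.
  by field; rewrite gt_eqF.
apply: nneseries_le_partial => [m|n]; first by case: ifPn => // _; rewrite lee_fin powR_ge0.
elim: n => [|n ih].
  by rewrite big_nat_cond big_pred0 ?lee_fin ?divr_ge0 ?powR_ge0 ?(ltW q1)// => i; rewrite andbF.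
have [nw|nw] := ltP (u n) w; last first.
  by rewrite big_nat_recr//= ltNge nw /= adde0.
apply: (@le_trans _ _ (\sum_(0 <= m < n.+1) (u m `^ s)%:E)%E).
  by apply: lee_sum => m _; case: ifPn => // _; rewrite lee_fin powR_ge0.
rewrite sumEFin lee_fin (le_trans (geo n))// ler_wpM2r ?invr_ge0 ?(ltW q1)//.
by rewrite le_powR// ltW.
Qed.

End dyadic_levels.

(** Origin of the factor [1 / min 1 (t - 1)]: with [s = t - 1], the geometric sums of
    [dyadic_levels_le] blow up no faster as [s] tends to 0. *)
Lemma one_sub_half_pow {R : realType} (s : R) : 0 < s ->
  Num.min 1 s / 2 <= 1 - 2 `^ (- s).
Proof.
move=> s0.
have h (x : R) : 0 < x -> x <= 1 -> 2 `^ (- x) <= 1 - x / 2.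
  move=> x0 x1; have := @powR_tangent R 2^-1 1 x.
  rewrite invr_ge0 ler0n ltr01 x0 x1 powR1 mul1r divr1 => /(_ isT isT isT isT).
  by rewrite -{1}powR_inv1 ?ler0n// -powRrM mulN1r => /le_trans -> //; lra.
have [s1|s1] := leP s 1; first by have := h s s0 s1; lra.
have : 2 `^ (- s) <= 2 `^ (- 1) by rewrite ler_powR ?ler1n// lerN2 ltW.
by have := h 1 ltr01 (lexx _); lra.
Qed.

Section strong_type.
Context {R : realType} {d : measure_display} {T : measurableType d}.
Variables (mu : {measure set T -> \bar R}) (rho : T -> T -> R).
Hypothesis sht : space_of_homogeneous_type mu rho.
Local Open Scope ereal_scope.

(** The values of [h] up to [u / 2] contribute at most [u / 2] to an average, so an average above
    [u] leaves more than [u / 2] to the truncation; the weak inequality at [u / 2] gives the factor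
    2. *)
Lemma grid_weak_trunc : exists2 Cv : R, (1 <= Cv)%R &
  forall C H Lam eps (G : grid mu rho C H Lam eps) (h : T -> R) (u : R),
    measurable_fun setT h -> (forall x, 0 <= h x)%R -> (0 < u)%R ->
    u%:E * mu [set x | u%:E < gmax G (EFin \o h) x] <=
    (2 * Cv)%:E * \int[mu]_x (if (u < 2 * h x)%R then (h x)%:E else 0).
Proof.
have [Cv Cv1 hCv] := grid_weak sht; exists Cv => // C H Lam eps G h u mh h0 u0.
pose g x := if (u < 2 * h x)%R then (h x)%:E else 0.
have g0 x : 0 <= g x by rewrite /g; case: ifPn => // _; rewrite lee_fin.
have mg : measurable_fun setT g.
  apply: measurable_fun_ifT => //; last exact/measurable_EFinP.
  by apply: measurable_fun_ltr => //; exact: measurable_funM.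
have u2 : (0 < u / 2)%R by rewrite divr_gt0.
have := hCv _ _ _ _ G g (u / 2)%R mg g0 u2.
rewrite {1}mulrC {1}EFinM -muleA lee_pdivrMl// muleA -EFinM; apply: le_trans.
rewrite lee_wpmul2l ?lee_fin ?(ltW u0)//; apply: le_measure; rewrite ?inE.
- rewrite -[X in measurable X]setTI; apply: emeasurable_fun_o_infty => //.
  exact: measurable_gmax.
- rewrite -[X in measurable X]setTI; apply: emeasurable_fun_o_infty => //.
  exact: measurable_gmax.
move=> x /= /ereal_sup_gt[_ [i _ <-] lx].
apply: lt_le_trans (gmax_ub G g i x).
set B := star G i (cen G i x).
have B0 : 0 < mu B < +oo := star_measure sht G i (cen G i x).
move: lx; rewrite /gavg -/B !avg_lt// => lx.
have hg : \int[mu]_(y in B) (h y)%:E <= \int[mu]_(y in B) g y + (u / 2)%:E * mu B.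
  rewrite -integral_cst; last exact: star_measurable.
  rewrite -ge0_integralD//; last 3 first.
  - exact: star_measurable.
  - exact: measurable_funS mg.
  - by move=> *; rewrite lee_fin ltW.
  apply: le_integral_dom => [y _|y _]; first by rewrite lee_fin.
  rewrite /g /=; case: ifPn => hu; first by rewrite leeDl// lee_fin ltW.
  by rewrite add0e lee_fin; move: hu; rewrite -leNgt; lra.
have mufin := muB_fin B0.
have lt2 := lt_le_trans lx hg.
have e1 : mu B * u%:E = mu B * (u / 2)%:E + (u / 2)%:E * mu B.
  rewrite [X in _ + X]muleC -muleDr ?fin_num_adde_defl//.
  by rewrite -EFinD -splitr.
move: lt2; rewrite e1 lteD2rE//.
by rewrite fin_numM.
Qed.

(** Marcinkiewicz interpolation with the trivial bound for bounded functions, dyadic levels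
    replacing the layer-cake integral. [Cs] serves all [t] up to [p], so the dependence on [t - 1]
    is explicit. *)
Theorem grid_strong (p : R) : exists2 Cs : R, (0 < Cs)%R &
  forall t, (1 < t)%R -> (t <= p)%R ->
  forall C H Lam eps (G : grid mu rho C H Lam eps) (h : T -> R),
    measurable_fun setT h -> (forall x, 0 <= h x)%R ->
    \int[mu]_x (gmax G (EFin \o h) x `^ t) <=
    (Cs / Num.min 1 (t - 1))%:E * \int[mu]_x ((h x) `^ t)%:E.
Proof.
have [Cv Cv1 hCv] := grid_weak_trunc.
have Cv0 : (0 < Cv)%R by rewrite (lt_le_trans ltr01).
exists (2 `^ p * (2 * Cv) * (2 `^ p * 2))%R; first by rewrite !mulr_gt0// powR_gt0.
move=> t t1 tp C H Lam eps G h mh h0.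
pose M := gmax G (EFin \o h).
have M0 x : 0 <= M x by apply: gmax_ge0 => // y; rewrite lee_fin.
have mM : measurable_fun setT M by exact: measurable_gmax.
have t0 : (0 < t)%R by rewrite (lt_trans ltr01).
pose s := (t - 1)%R; have s0 : (0 < s)%R by rewrite subr_gt0.
have mn0 : (0 < Num.min 1 s)%R by rewrite lt_min ltr01.
set K := (X in _ <= X%:E * _).
(* The cut-off provides a lowest dyadic level; Fatou removes it at the end. *)
pose f k x := if (2 ^- k)%:E < M x then M x `^ t else 0.
have mMt : measurable_fun setT (fun x => M x `^ t).
  by apply: (@measurableT_comp _ _ _ _ _ _ (fun y => y `^ t)) => //; exact: measurable_poweR.
have mlt (a : R) : measurable_fun setT (fun x => a%:E < M x).
  by apply: measurable_fun_lte.
apply: (@fatou_le _ _ _ mu setT f) => //.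
- by move=> k; apply: measurable_fun_ifT.
- by move=> k x; rewrite /f; case: ifPn => // _; exact: poweR_ge0.
- move=> k; pose e : R := (2 ^- k)%R.
  have e0 : (0 < e)%R by rewrite invr_gt0 exprn_gt0.
  pose u m : R := (e * 2 ^+ m)%R.
  have u0 m : (0 < u m)%R by rewrite mulr_gt0// exprn_gt0.
  pose a m x := if (u m)%:E < M x then ((2 * u m) `^ t)%:E else 0.
  pose b m x := if (u m < 2 * h x)%R then (h x)%:E else 0.
  have a0 m x : 0 <= a m x by rewrite /a; case: ifPn => // _; rewrite lee_fin powR_ge0.
  have b0 m x : 0 <= b m x by rewrite /b; case: ifPn => // _; rewrite lee_fin.
  have ma m : measurable_fun setT (a m) by apply: measurable_fun_ifT.
  have mb m : measurable_fun setT (b m).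
    apply: measurable_fun_ifT => //; last exact/measurable_EFinP.
    by apply: measurable_fun_ltr => //; exact: measurable_funM.
  pose c m : R := ((2 * u m) `^ t / u m * (2 * Cv))%R.
  have c0 m : (0 <= c m)%R.
    by rewrite mulr_ge0 ?mulr_ge0 ?powR_ge0 ?invr_ge0 ?(ltW (u0 m)) ?(ltW Cv0).
  have int_a m : \int[mu]_x a m x <= \int[mu]_x ((c m)%:E * b m x).
    pose A := [set x | (u m)%:E < M x].
    rewrite (eq_integral (fun x => ((2 * u m) `^ t)%:E * (\1_A x)%:E)); last first.
      move=> x _; rewrite /a indicE; case: ifPn => hu.
        by rewrite mem_set// mule1.
      by rewrite memNset ?mule0//; exact/negP.
    have mA : measurable A.
      by rewrite -[X in measurable X]setTI; exact: emeasurable_fun_o_infty.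
    rewrite ge0_integralZl//; last 2 first.
      by apply/measurable_EFinP; exact: measurable_indic.
      by rewrite lee_fin powR_ge0.
    rewrite integral_indic// setIT ge0_integralZl ?lee_fin//.
    rewrite /c EFinM -muleA EFinM -muleA lee_wpmul2l ?lee_fin ?powR_ge0//.
    by rewrite lee_pdivlMl//; exact: hCv.
  apply: (@le_trans _ _ (\int[mu]_x \sum_(0 <= m <oo) a m x)).
    apply: le_integral_dom => [x _|x _].
      by rewrite /f; case: ifPn => // _; exact: poweR_ge0.
    rewrite /f; case: ifPn => hM; last by apply: nneseries_ge0.
    exact: (dyadic_levels_ge e0 t0 hM).
  rewrite integral_nneseries//.
  apply: (@le_trans _ _ (\sum_(0 <= m <oo) \int[mu]_x ((c m)%:E * b m x))).
    by apply: lee_nneseries => // m _ _; apply: integral_ge0.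
  rewrite -integral_nneseries//; last 2 first.
  - by move=> m; exact: measurable_funeM.
  - by move=> m x _; rewrite mule_ge0 ?lee_fin.
  rewrite -ge0_integralZl//; last 3 first.
  - exact: measurable_powR_comp.
  - by move=> x _; rewrite lee_fin powR_ge0.
  - by rewrite lee_fin !mulr_ge0 ?powR_ge0 ?invr_ge0// ?(ltW mn0) ?(ltW Cv0).
  apply: le_integral_dom => [x _|x _].
    by apply: nneseries_ge0 => m _ _; rewrite mule_ge0 ?lee_fin.
  rewrite (_ : \sum_(0 <= m <oo) _ = \sum_(0 <= m <oo) ((2 `^ t * (2 * Cv) * h x)%:E *
      (if (u m < 2 * h x)%R then ((u m) `^ s)%:E else 0))); last first.
    apply: eq_eseriesr => m _; rewrite /b /c; case: ifPn => hu; last by rewrite !mule0.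
    rewrite -!EFinM; congr _%:E.
    rewrite powRM ?(ltW (u0 m))//.
    have -> : (u m `^ t = u m `^ s * u m)%R.
      rewrite -{3}(powRr1 (ltW (u0 m))) -powRD ?subrK//.
      by rewrite gt_eqF ?implybT.
    by field; rewrite gt_eqF.
  rewrite nneseriesZl//; last first.
    by move=> m _; case: ifPn => // _; rewrite lee_fin powR_ge0.
  have h20 : (0 <= 2 * h x)%R by rewrite mulr_ge0.
  have cc0 : (0 <= 2 `^ t * (2 * Cv) * h x)%R.
    by rewrite !mulr_ge0 ?powR_ge0 ?(ltW Cv0).
  apply: le_trans (lee_wpmul2l _ (dyadic_levels_le e0 h20 s0)) _.
    by rewrite lee_fin.
  rewrite -!EFinM lee_fin powRM//.
  have hE : (h x `^ t = h x `^ s * h x)%R.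
    have [->|hx0] := eqVneq (h x) 0%R; first by rewrite mulr0 powR0 ?gt_eqF.
    by rewrite -{3}(powRr1 (h0 x)) -powRD ?subrK// hx0 implybT.
  have q := one_sub_half_pow s0.
  have q0 : (0 < 1 - 2 `^ (- s))%R by rewrite (lt_le_trans _ q)// divr_gt0.
  rewrite hE (_ : (_ * (_ / _) = 2 `^ t * (2 * Cv) * (2 `^ s / (1 - 2 `^ (- s))) * (h x `^ s * h x))%R); last by ring.
  rewrite ler_wpM2r ?mulr_ge0 ?powR_ge0// /K -[leRHS]mulrA.
  apply: ler_pM; rewrite ?mulr_ge0 ?powR_ge0 ?invr_ge0 ?(ltW q0) ?(ltW Cv0)//.
    by rewrite ler_pM2r ?mulr_gt0// ler_powR// ler1n.
  rewrite -mulrA; apply: ler_pM; rewrite ?powR_ge0 ?invr_ge0 ?(ltW q0)//.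
    by rewrite ler_powR ?ler1n// (le_trans _ tp)// gerBl.
  rewrite (_ : (2 / _ = (Num.min 1 s / 2)^-1)%R); last by rewrite invf_div.
  by rewrite lef_pV2 ?posrE// divr_gt0.
- by move=> x _; exact: poweR_ge0.
- move=> x _; rewrite -/M; have [Mx0|Mx0] := eqVneq (M x) 0.
    rewrite Mx0 poweR0r ?gt_eqF//; apply: (@le_limn_einf _ _ _ 0%N) => m _.
    by rewrite /f; case: ifPn => // _; exact: poweR_ge0.
  have Mxp : 0 < M x by rewrite lt0e Mx0 M0.
  have [N hN] : exists N, (2 ^- N)%:E < M x.
    have [->|Mfin] := eqVneq (M x) +oo; first by exists 0%N; rewrite ltry.
    have fM : M x \is a fin_num by rewrite ge0_fin_numE// lt_neqAle Mfin leey.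
    have fp : (0 < fine (M x))%R by apply: fine_gt0; rewrite Mxp lt_neqAle Mfin leey.
    have [N hN] := ex_le_exp2 ((fine (M x))^-1 + 1)%R.
    exists N; rewrite -(fineK fM) lte_fin invf_plt ?posrE ?exprn_gt0//.
    by apply: lt_le_trans hN; rewrite ltrDl.
  rewrite -/M; apply: (@le_limn_einf _ _ _ N) => m Nm; rewrite /f ifT//.
  apply: le_lt_trans hN; rewrite lee_fin lef_pV2 ?posrE ?exprn_gt0//.
  by rewrite ler_weXn2l// ler1n.
Qed.

End strong_type.

(** * Stopping cubes and the reverse Hoelder inequality *)

Section stopping.
Context {R : realType} {d : measure_display} {T : measurableType d}.
Variables (mu : {measure set T -> \bar R}) (rho : T -> T -> R).
Hypothesis sht : space_of_homogeneous_type mu rho.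
Context {C H Lam eps : R}.
Variable G : grid mu rho C H Lam eps.
Local Open Scope ereal_scope.
Local Notation cube i z := (cen G i @^-1` [set z]).

Variables (v : nat -> T -> \bar R) (lam : \bar R).

(* The coarsest level below [j] at which the cube around [x] exceeds [lam]. *)
Fixpoint stop (j : nat) (x : T) : option nat :=
  if j is i.+1 then if lam < v i (cen G i x) then Some i else stop i x else None.

Lemma stop_None j x k : stop j x = None -> (k < j)%N -> v k (cen G k x) <= lam.
Proof.
elim: j => // j ih /=; case: ifPn => // h /ih {}ih.
by rewrite ltnS leq_eqVlt => /predU1P[->|//]; rewrite leNgt.
Qed.

Lemma stop_Some j x i : stop j x = Some i ->
  [/\ (i < j)%N, lam < v i (cen G i x) &
      forall k, (i < k < j)%N -> v k (cen G k x) <= lam].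
Proof.
elim: j => // j ih /=; case: ifPn => h.
  move=> [<-]; split => // k /andP[jk]; rewrite ltnS => kj.
  by have := leq_trans jk kj; rewrite ltnn.
move=> /ih[ij li hk]; split => //; first exact: ltn_trans ij _.
move=> k /andP[ik]; rewrite ltnS leq_eqVlt => /predU1P[->|kj]; first by rewrite leNgt.
by apply: hk; rewrite ik.
Qed.

Lemma stop_cube j x y i : stop j x = Some i -> cen G i y = cen G i x ->
  stop j y = Some i.
Proof.
elim: j => // j ih /=; case: ifPn => h; first by move=> [<-] ->; rewrite h.
move=> xi yx; have [ij _ _] := stop_Some xi.
by rewrite (cen_eq_up (ltnW ij) yx) (negbTE h); exact: ih.
Qed.

Lemma stop_gidx j x y : gidx G x = gidx G y -> stop j x = stop j y.
Proof. by move=> xy; elim: j => //= j ->; rewrite (cen_eq_gidx j xy). Qed.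

Definition stopped j z0 := [set x | cen G j x = z0 /\ stop j x <> None].

Lemma measurable_stopped j z0 : measurable (stopped j z0).
Proof.
rewrite (_ : stopped j z0 =
  (fun x => (cen G j x, stop j x)) @^-1` [set p | p.1 = z0 /\ p.2 <> None])//.
apply: (measurable_kap (@gidx_measurable _ _ _ _ _ _ _ _ _ G)) => x y xy.
by rewrite (cen_eq_gidx j xy) (stop_gidx j xy).
Qed.

Definition stop_lvl j x := odflt 0%N (stop j x).

Definition stop_key j x := (stop_lvl j x, cen G (stop_lvl j x) x).

Lemma stop_key_gidx j x y : gidx G x = gidx G y -> stop_key j x = stop_key j y.
Proof.
by move=> xy; rewrite /stop_key /stop_lvl (stop_gidx j xy) (cen_eq_gidx _ xy).
Qed.

Lemma measurable_stop_glue j (F : nat * T -> T -> \bar R) :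
  (forall k, measurable_fun setT (F k)) ->
  measurable_fun setT (fun x => F (stop_key j x) x).
Proof.
move=> mF; apply: (measurable_glue (@gidx_measurable _ _ _ _ _ _ _ _ _ G)) => //.
by move=> x y; exact: stop_key_gidx.
Qed.

(** The stopped set is the disjoint union of its maximal cubes, which are countably many fibers of
    [stop_key], so estimates on single stopping cubes add up. *)
Lemma stop_glue j z0 (F : nat * T -> T -> \bar R) (g : T -> \bar R) :
  (forall k, measurable_fun setT (F k)) -> measurable_fun setT g ->
  (forall k x, 0 <= F k x) -> (forall x, 0 <= g x) ->
  (forall x i, cen G j x = z0 -> stop j x = Some i ->
    \int[mu]_(y in cube i (cen G i x)) F (i, cen G i x) y <=
    \int[mu]_(y in cube i (cen G i x)) g y) ->
  \int[mu]_(x in stopped j z0) F (stop_key j x) x <= \int[mu]_(x in stopped j z0) g x.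
Proof.
move=> mF mg F0 g0 h.
apply: (glue_le (@gidx_measurable _ _ _ _ _ _ _ _ _ G)) => //.
- by move=> x y; exact: stop_key_gidx.
- exact: measurable_stopped.
move=> x [xz0 sx]; case sE : (stop j x) sx => [i|//] _.
have -> : stopped j z0 `&` stop_key j @^-1` [set stop_key j x] = cube i (cen G i x).
  apply/seteqP; split => y /=.
    move=> [_]; rewrite /stop_key (_ : stop_lvl j x = i); last by rewrite /stop_lvl sE.
    by move=> [->].
  move=> yx; have sy := stop_cube sE yx; have [ij _ _] := stop_Some sE.
  split; last by rewrite /stop_key /stop_lvl sE sy /= yx.
  by split; [rewrite -xz0; exact: (cen_eq_up (ltnW ij) yx)|rewrite sy].
have -> : stop_key j x = (i, cen G i x) by rewrite /stop_key /stop_lvl sE.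
exact: h.
Qed.

End stopping.

(** Tails dominated by [K * b m] mean geometric decay, which absorbs weights of ratio [q] close to
    1. In the induction, [2 * (q - 1)] times the tail is paid by [b m]. *)
Lemma geometric_weight_sum {R : realType} (b : nat -> R) (K q : R) :
  (forall m, 0 <= b m) -> 1 <= q -> 2 * (q - 1) * K <= 1 ->
  (forall m M, \sum_(k < M) b (m + k)%N <= K * b m) ->
  forall M m, \sum_(k < M) q ^+ k * b (m + k)%N <= 2 * \sum_(k < M) b (m + k)%N.
Proof.
move=> b0 q1 qK hb; elim=> [|M ih] m; first by rewrite !big_ord0 mulr0.
rewrite !big_ord_recl expr0 mul1r addn0.
have shift k : (m + bump 0 k = m.+1 + k)%N by rewrite /bump /= add1n addnS addSn.
under eq_bigr do rewrite exprS shift -mulrA.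
under [X in _ <= _ * (_ + X)]eq_bigr do rewrite shift.
rewrite -mulr_sumr; set S := \sum_(k < M) b _.
have h1 : q * \sum_(i < M) q ^+ i * b (m.+1 + i)%N <= q * (2 * S).
  by rewrite ler_wpM2l// (le_trans ler01).
have S0 : 0 <= S by rewrite sumr_ge0.
have SK : S <= K * b m.
  have := hb m M.+1; rewrite big_ord_recl addn0.
  under eq_bigr do rewrite shift.
  by rewrite -/S; have := b0 m; lra.
have h2 : 2 * (q - 1) * S <= b m.
  apply: (@le_trans _ _ (2 * (q - 1) * (K * b m))).
    by rewrite ler_wpM2l// mulr_ge0// subr_ge0.
  by rewrite mulrA ler_piMl.
lra.
Qed.

(** * Reverse Hoelder inequality on a dyadic cube *)

Section reverse_holder.
Context {R : realType} {d : measure_display} {T : measurableType d}.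
Variables (mu : {measure set T -> \bar R}) (rho : T -> T -> R).
Hypothesis sht : space_of_homogeneous_type mu rho.
Local Open Scope ereal_scope.
Variables (sig : T -> R) (A : R).
Hypothesis msig : measurable_fun setT sig.
Hypothesis sig0 : forall x, (0 <= sig x)%R.
Hypothesis sig_ball : forall B, qballs rho B -> 0 < \int[mu]_(x in B) (sig x)%:E < +oo.
Hypothesis A1 : (1 <= A)%R.
Hypothesis sigA : forall B, qballs rho B ->
  \int[mu]_(x in B) HLmax mu rho (sig \* \1_B)%R x <= A%:E * \int[mu]_(x in B) (sig x)%:E.

Let msigE : measurable_fun setT (EFin \o sig).
Proof. exact/measurable_EFinP. Qed.

Section on_grid.
Context {C H Lam eps : R}.
Variable G : grid mu rho C H Lam eps.
Hypothesis C1 : (1 <= C)%R.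
Local Notation cube i z := (cen G i @^-1` [set z]).
Local Notation a := (gavg G (EFin \o sig)).

Let C0 : (0 <= C)%R := le_trans ler01 C1.

Lemma gavg_sig_fin i z : a i z \is a fin_num.
Proof.
have B0 := star_measure sht G i z.
have /andP[s0 sy] := sig_ball (star_ball G i z).
rewrite /gavg avgE// fin_numM//= ge0_fin_numE ?integral_ge0// => x _.
by rewrite lee_fin.
Qed.

Lemma gavg_sig_gt0 i z : 0 < a i z.
Proof.
have B0 := star_measure sht G i z.
have /andP[s0 sy] := sig_ball (star_ball G i z).
by rewrite /gavg avgE// mule_gt0// lte_fin invr_gt0 fine_muB_gt0.
Qed.

(** Finitely many levels keep the maximal function finite, so that its powers and levels are handled
    as real numbers. *)
Definition lmax j x : \bar R := \big[maxe/0]_(i < j.+1) a i (cen G i x).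

Lemma lmax_ge i j x : (i <= j)%N -> a i (cen G i x) <= lmax j x.
Proof. by move=> ij; apply: (le_bigmax _ _ (Ordinal (ij : (i < j.+1)%N))). Qed.

Lemma lmax_le j x b : 0 <= b -> (forall i, (i <= j)%N -> a i (cen G i x) <= b) ->
  lmax j x <= b.
Proof. by move=> b0 h; apply: bigmax_le => // i _; apply: h; rewrite -ltnS. Qed.

Lemma lmax_ge0 j x : 0 <= lmax j x.
Proof. by apply: le_trans (lmax_ge x (leq0n j)); apply: ltW; exact: gavg_sig_gt0. Qed.

Lemma lmax_fin j x : lmax j x \is a fin_num.
Proof.
rewrite /lmax; elim/big_ind : _ => // [x1 x2 h1 h2|i _]; last exact: gavg_sig_fin.
by rewrite maxEle; case: ifPn.
Qed.

Lemma measurable_lmax j : measurable_fun setT (lmax j).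
Proof.
apply: (measurable_gidx_fun (G := G)) => x y xy; rewrite /lmax.
by apply: eq_bigr => i _; rewrite (cen_eq_gidx i xy).
Qed.

Section cube_estimates.
Variables (j : nat) (x0 : T).
Let z0 := cen G j x0.
Let lam0 := a j z0.

Let E (l : R) := [set x | cen G j x = z0 /\ l%:E < lmax j x].

(** [stop] tests only the levels strictly below [j]; level [j] itself cannot exceed [l], since
    [lam0 <= l]. *)
Let EE (l : R) : lam0 <= l%:E -> E l = stopped G a l%:E j z0.
Proof.
move=> l0; apply/seteqP; split => x [xz].
  move=> lx; split => // sN; move: lx; rewrite ltNge => /negP; apply.
  apply: lmax_le => [|i].
    by apply: le_trans l0; apply: ltW; exact: gavg_sig_gt0.
  rewrite leq_eqVlt => /predU1P[->|ij]; first by rewrite xz.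
  exact: stop_None sN ij.
case sE : (stop _ _ _ _ _) => [i|//] _; split => //.
have [ij li _] := stop_Some sE.
exact: lt_le_trans li (lmax_ge _ (ltnW ij)).
Qed.

(** By maximality the parent of a stopping cube has average at most [l]; if it is the starting cube,
    [lam0 <= l] says so. The steps from the parent's star to the star and from the star to the cube
    cost [C] each. *)
Let parent_bound (l : R) x i : lam0 <= l%:E -> cen G j x = z0 ->
  stop G a l%:E j x = Some i ->
  \int[mu]_(y in star G i (cen G i x)) (sig y)%:E <=
  (C ^+ 2 * l)%:E * mu (cube i (cen G i x)).
Proof.
move=> l0 xz sE; have [ij li hk] := stop_Some sE.
have lpos : (0 <= l)%R.
  by rewrite -lee_fin; apply: le_trans l0; apply: ltW; exact: gavg_sig_gt0.
have pl : a i.+1 (cen G i.+1 x) <= l%:E.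
  move: ij; rewrite leq_eqVlt => /predU1P[->|ij]; first by rewrite xz.
  by apply: hk; rewrite ltnSn.
apply: (@le_trans _ _ (\int[mu]_(y in star G i.+1 (cen G i.+1 x)) (sig y)%:E)).
  apply: le_integral_sub; last exact: star_nest.
  by move=> y _; rewrite lee_fin.
move: pl; rewrite /gavg avg_le; last exact: star_measure.
move=> /le_trans; apply.
rewrite [(C ^+ 2 * l)%R]mulrC EFinM -muleA muleC lee_wpmul2l ?lee_fin//.
apply: le_trans (star_parent_le G i x) _.
rewrite expr2 EFinM -muleA lee_wpmul2l ?lee_fin//; exact: star_cube_le.
Qed.

Let cube_int_const i x (c : R) : (0 <= c)%R ->
  \int[mu]_(y in cube i (cen G i x)) (cst c%:E y) = c%:E * mu (cube i (cen G i x)).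
Proof. by move=> c0; rewrite integral_cst//; exact: cube_measurable. Qed.

Lemma level_sigma (l : R) : lam0 <= l%:E ->
  \int[mu]_(x in E l) (sig x)%:E <= (C ^+ 2 * l)%:E * mu (E l).
Proof.
move=> l0.
have lpos : (0 <= l)%R.
  by rewrite -lee_fin; apply: le_trans l0; apply: ltW; exact: gavg_sig_gt0.
have c0 : (0 <= C ^+ 2 * l)%R by rewrite mulr_ge0// sqr_ge0.
rewrite EE// -integral_cst; last exact: measurable_stopped.
apply: (@stop_glue _ _ _ _ _ _ _ _ _ G a l%:E j z0 (fun _ y => (sig y)%:E)) => //.
move=> x i xz sE; rewrite cube_int_const//.
apply: le_trans (parent_bound l0 xz sE).
by apply: le_integral_sub; [move=> y _; rewrite lee_fin|exact: cube_sub_star].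
Qed.

(** The A_infty hypothesis enters here. On a stopping cube of level [i] the coarser averages stay
    below [l], hence below the average at level [i], and the others see [sig] only inside
    [B = star i]. So [lmax] is at most the maximal function of [sig] cut off to [B]. *)
Lemma level_lmax (l : R) : lam0 <= l%:E ->
  \int[mu]_(x in E l) lmax j x <= (A * (C ^+ 2 * l))%:E * mu (E l).
Proof.
move=> l0.
have lpos : (0 <= l)%R.
  by rewrite -lee_fin; apply: le_trans l0; apply: ltW; exact: gavg_sig_gt0.
have A0 : (0 <= A)%R := le_trans ler01 A1.
have c0 : (0 <= A * (C ^+ 2 * l))%R by rewrite !mulr_ge0// sqr_ge0.
rewrite EE// -integral_cst; last exact: measurable_stopped.
apply: (@stop_glue _ _ _ _ _ _ _ _ _ G a l%:E j z0 (fun _ y => lmax j y)) => //.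
- by move=> _; exact: measurable_lmax.
- by move=> _ x; exact: lmax_ge0.
move=> x i xz sE; rewrite cube_int_const// EFinM -muleA.
apply: le_trans (lee_wpmul2l _ (parent_bound l0 xz sE)); last by rewrite lee_fin.
have [ij li hk] := stop_Some sE.
set B := star G i (cen G i x).
apply: le_trans (sigA (star_ball G i (cen G i x))).
have hl y k : cen G i y = cen G i x -> (k <= i)%N ->
    a k (cen G k y) <= HLmax mu rho (sig \* \1_B)%R y.
  move=> yx ki; apply: ereal_sup_ubound; exists (star G k (cen G k y)).
    by split; [exact: star_ball|exact: cube_star].
  rewrite /gavg !avgE; try exact: star_measure.
  congr (_ * _); apply: eq_integral => w; rewrite inE => wy.
  have Bw : B w by rewrite /B -yx; exact: (star_nest_le ki wy).
  by rewrite /= indicE mem_set// mulr1 ger0_norm.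
have HL0 y : 0 <= HLmax mu rho (sig \* \1_B)%R y.
  apply: (@le_trans _ _ (avg mu (star G 0 (cen G 0 y)) (fun w => `|(sig \* \1_B)%R w|%:E))).
    by apply: avg_ge0; [exact: star_measure|move=> w _; rewrite lee_fin].
  by apply: ereal_sup_ubound; exists (star G 0 (cen G 0 y)) => //; split;
    [exact: star_ball|exact: cube_star].
apply: le_integral_any => [y _|y _|y yx _].
- exact: lmax_ge0.
- exact: HL0.
split; first exact: (cube_sub_star yx).
apply: lmax_le => // k kj; have [ki|ik] := leqP k i; first exact: hl.
have sy := stop_cube sE yx; have [_ liy hky] := stop_Some sy.
apply: (@le_trans _ _ l%:E); last by apply: le_trans (ltW liy) _; exact: hl.
move: kj; rewrite leq_eqVlt => /predU1P[->|kj]; last by apply: hky; rewrite ik.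
by rewrite (cen_eq_up (ltnW ij) yx) xz.
Qed.

Let Q := cube j z0.

Let Q0 : 0 < mu Q < +oo := cube_measure sht G j x0.

Let mE l : measurable (E l).
Proof.
rewrite (_ : E l = Q `&` [set x | l%:E < lmax j x]); last by apply/seteqP; split.
apply: measurableI; first exact: cube_measurable.
by rewrite -[X in measurable X]setTI; apply: emeasurable_fun_o_infty => //; exact: measurable_lmax.
Qed.

Let E_fin l : mu (E l) \is a fin_num.
Proof.
rewrite ge0_fin_numE//; have /andP[_ Qy] := Q0; apply: le_lt_trans Qy.
by apply: le_measure; rewrite ?inE//; [exact: cube_measurable|move=> x []].
Qed.

Let l0 : R := fine lam0.

Let lam0E : lam0 = l0%:E.
Proof. by rewrite /l0 fineK// gavg_sig_fin. Qed.

Let l0_gt0 : (0 < l0)%R.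
Proof. by rewrite -lte_fin -lam0E gavg_sig_gt0. Qed.

Let l m : R := (l0 * 2 ^+ m)%R.

Let l_gt0 m : (0 < l m)%R. Proof. by rewrite mulr_gt0// exprn_gt0. Qed.

Let l_ge m : lam0 <= (l m)%:E.
Proof. by rewrite lam0E lee_fin ler_peMr ?(ltW l0_gt0)// exprn_ege1// ler1n. Qed.

Let b m : R := (l m * fine (mu (E (l m))))%R.

Let b0 m : (0 <= b m)%R.
Proof. by rewrite mulr_ge0 ?(ltW (l_gt0 m))// fine_ge0. Qed.

Let bE m : (b m)%:E = (l m)%:E * mu (E (l m)).
Proof. by rewrite /b EFinM fineK. Qed.

Let K : R := (2 * (A * C ^+ 2))%R.

(** The dyadic levels below [lmax] add up to at most [2 * lmax], whose integral over [E (l m)] is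
    bounded by [level_lmax]. *)
Let tail_le m M : (\sum_(k < M) b (m + k)%N <= K * b m)%R.
Proof.
rewrite -lee_fin -sumEFin.
have lmk k : l (m + k)%N = (l m * 2 ^+ k)%R by rewrite /l exprD mulrA.
pose F k x := if (l (m + k)%N)%:E < lmax j x then (l (m + k)%N)%:E else 0.
have F0 k x : 0 <= F k x by rewrite /F; case: ifPn => // _; rewrite lee_fin ltW.
have mF k : measurable_fun setT (F k).
  apply: measurable_fun_ifT => //; apply: measurable_fun_lte => //.
  exact: measurable_lmax.
have FE k : (b (m + k)%N)%:E = \int[mu]_(x in E (l m)) F k x.
  rewrite bE -integral_cst//; apply/eqP; rewrite eq_le; apply/andP; split.
    apply: le_integral_any => [x _|//|x [xz lx] _]; first by rewrite lee_fin ltW.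
    split; last by rewrite /F lx.
    split => //; apply: le_lt_trans lx; rewrite lee_fin lmk ler_peMr ?(ltW (l_gt0 m))//.
    by rewrite exprn_ege1// ler1n.
  apply: le_integral_any => [//|x _|x [xz lx]]; first by rewrite lee_fin ltW.
  by rewrite /F; case: ifPn => [lx' _|_ /eqP//]; split.
under eq_bigr do rewrite FE.
rewrite -ge0_integral_sum//; last by move=> k; exact: measurable_funS (mF k).
apply: (@le_trans _ _ (\int[mu]_(x in E (l m)) (2%:E * lmax j x))).
  apply: le_integral_dom => [x _|x _]; first exact: sume_ge0.
  have fx := lmax_fin j x.
  have lx0 : (0 <= fine (lmax j x))%R by apply: fine_ge0; exact: lmax_ge0.
  have := dyadic_levels_le (l_gt0 m) lx0 (@ltr01 R).
  rewrite powRr1// powR_inv1 ?ler0n// (_ : (1 - 2^-1 = 2^-1)%R); last by lra.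
  rewrite invrK mulrC EFinM fineK//; apply: le_trans.
  apply: le_trans (@nneseries_lim_ge _ _ xpredT 0%N M _); last first.
    by move=> k _ _; case: ifPn => // _; rewrite lee_fin powR_ge0.
  rewrite big_mkord; apply: lee_sum => k _.
  rewrite /F lmk -{1}(fineK fx) lte_fin; case: ifPn => // _.
  by rewrite powRr1// mulr_ge0 ?exprn_ge0 ?(ltW (l_gt0 m)).
rewrite ge0_integralZl//; last 2 first.
- exact: measurable_funS (measurable_lmax j).
- by move=> x _; exact: lmax_ge0.
rewrite /K -mulrA EFinM lee_wpmul2l//.
apply: le_trans (level_lmax (l_ge m)) _.
by rewrite [(A * (C ^+ 2 * l m))%R]mulrA EFinM -muleA -bE -EFinM.
Qed.

(* The tails of [b] decay geometrically, which pays for the weights [q ^ m]. *)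
Lemma reverse_holder_cube (e : R) : (0 < e)%R -> (e <= 1)%R -> (4 * (A * C ^+ 2) * e <= 1)%R ->
  \int[mu]_(x in Q) ((sig x)%:E * lmax j x `^ e) <=
  (2 * C ^+ 2 * l0 `^ (1 + e))%:E * mu Q.
Proof.
move=> e0 e1 eA; pose q : R := (2 `^ e)%R.
have q1 : (1 <= q)%R by rewrite -(@powRr0 R 2) /q ler_powR ?ler1n// ltW.
have qe : (q <= 1 + e)%R.
  have := @powR_tangent R 2 1 e; rewrite ler0n ltr01 e0 e1 powR1 mul1r divr1.
  by move=> /(_ isT isT isT isT); rewrite -/q; lra.
have A0 : (0 <= A)%R := le_trans ler01 A1.
have K0 : (0 <= K)%R by rewrite !mulr_ge0// sqr_ge0.
(* [q - 1 <= e] by concavity, so the smallness of [e] is exactly what [geometric_weight_sum] asks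
   for. *)
have qK : (2 * (q - 1) * K <= 1)%R.
  apply: le_trans eA; rewrite /K; have : (0 <= A * C ^+ 2)%R by rewrite mulr_ge0// sqr_ge0.
  move: (A * C ^+ 2)%R => Z Z0; have : (Z * (q - 1) <= Z * e)%R by rewrite ler_wpM2l//; lra.
  lra.
have wsum M : (\sum_(k < M) q ^+ k * b k <= 2 * (K * b 0%N))%R.
  have := geometric_weight_sum b0 q1 qK tail_le M 0%N.
  under eq_bigr do rewrite add0n; move=> /le_trans; apply.
  by rewrite ler_pM2l// tail_le.
have mQ : measurable Q by exact: cube_measurable.
pose F m x := if (l m)%:E < lmax j x then (q ^+ m)%:E else 0.
have F0 m x : 0 <= F m x.
  by rewrite /F; case: ifPn => // _; rewrite lee_fin exprn_ge0// (le_trans ler01).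
have mF m : measurable_fun setT (F m).
  apply: measurable_fun_ifT => //; apply: measurable_fun_lte => //.
  exact: measurable_lmax.
have q10 : (0 <= q - 1)%R by rewrite subr_ge0.
have q10E : 0 <= (q - 1)%:E by rewrite lee_fin.
have l0e : 0 <= (l0 `^ e)%:E by rewrite lee_fin powR_ge0.
(* Pointwise: telescoping of the powers of q up to the level of [lmax j x]. *)
have pw x : lmax j x `^ e <= (l0 `^ e)%:E * (1 + (q - 1)%:E * \sum_(0 <= m <oo) F m x).
  have fx := lmax_fin j x; set w := fine (lmax j x).
  have wE : lmax j x = w%:E by rewrite fineK.
  have w0 : (0 <= w)%R by apply: fine_ge0; exact: lmax_ge0.
  have S0 : 0 <= \sum_(0 <= m <oo) F m x by apply: nneseries_ge0.
  rewrite wE poweR_EFin.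
  have ex : exists k, (w <= l k)%R.
    have [k hk] := ex_le_exp2 (w / l0).
    by exists k; rewrite /l -ler_pdivrMl// mulrC.
  case: (ex_minnP ex) => n wn nmin.
  have tel M : (1 + (q - 1) * (\sum_(m < M) q ^+ m) = q ^+ M)%R.
    elim: M => [|M ih]; first by rewrite big_ord0 mulr0 addr0 expr0.
    by rewrite big_ord_recr /= mulrDr addrA ih exprS; ring.
  apply: (@le_trans _ _ ((l0 `^ e)%:E * (q ^+ n)%:E)).
    rewrite -EFinM lee_fin (le_trans (le_powR (ltW e0) w0 wn))//.
    rewrite /l powRM ?exprn_ge0 ?(ltW l0_gt0)// ler_wpM2l ?powR_ge0//.
    by rewrite /q powRXn.
  rewrite lee_wpmul2l// -tel EFinD EFinM leeD2l// lee_wpmul2l//.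
  rewrite -sumEFin; apply: le_trans (@nneseries_lim_ge _ _ xpredT 0%N n _); last by [].
  rewrite big_mkord; apply: lee_sum => m _; rewrite /F ifT// wE lte_fin ltNge.
  by apply/negP => /nmin; rewrite leqNgt ltn_ord.
have msF m : measurable_fun setT (fun x => (sig x)%:E * F m x).
  by apply: emeasurable_funM.
have s0 x : 0 <= (sig x)%:E by rewrite lee_fin.
have C20 : (0 <= C ^+ 2)%R by rewrite sqr_ge0.
apply: (@le_trans _ _ (\int[mu]_(x in Q) ((l0 `^ e)%:E *
    ((sig x)%:E + (q - 1)%:E * \sum_(0 <= m <oo) ((sig x)%:E * F m x))))).
  apply: le_integral_dom => [x _|x _]; first by rewrite mule_ge0// poweR_ge0.
  apply: le_trans (lee_wpmul2l (s0 x) (pw x)) _.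
  rewrite nneseriesZl// muleCA lee_wpmul2l// ge0_muleDr ?mule1 ?mule_ge0 ?nneseries_ge0//.
  by rewrite muleCA.
have sF0 m x : 0 <= (sig x)%:E * F m x by rewrite mule_ge0.
have mS : measurable_fun setT (fun x => \sum_(0 <= m <oo) ((sig x)%:E * F m x)).
  by apply: ge0_emeasurable_sum.
have S0 x : 0 <= \sum_(0 <= m <oo) ((sig x)%:E * F m x) by apply: nneseries_ge0.
have mqS : measurable_fun setT (fun x => (q - 1)%:E * \sum_(0 <= m <oo) ((sig x)%:E * F m x)).
  exact: measurable_funeM.
rewrite ge0_integralZl//; last 2 first.
- by apply: measurable_funS (emeasurable_funD msigE mqS).
- by move=> x _; rewrite adde_ge0// mule_ge0.
rewrite ge0_integralD//; last 3 first.
- exact: measurable_funS msigE.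
- by move=> x _; rewrite mule_ge0.
- exact: measurable_funS mqS.
rewrite ge0_integralZl//; last exact: measurable_funS mS.
rewrite integral_nneseries//; last by move=> m; exact: measurable_funS (msF m).
have i1 : \int[mu]_(x in Q) (sig x)%:E <= (C ^+ 2 * l0)%:E * mu Q.
  apply: (@le_trans _ _ (\int[mu]_(x in star G j z0) (sig x)%:E)).
    by apply: le_integral_sub => //; exact: cube_sub_star.
  have B0 := star_measure sht G j z0.
  rewrite -(avg_mul B0) (_ : avg _ _ _ = lam0)// lam0E muleC mulrC EFinM -muleA.
  rewrite lee_wpmul2l ?lee_fin ?(ltW l0_gt0)//.
  apply: le_trans (star_cube_le G j x0) _; rewrite lee_wpmul2r// lee_fin.
  by rewrite expr2 ler_peMl.
have i2 : \sum_(0 <= m <oo) \int[mu]_(x in Q) ((sig x)%:E * F m x) <=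
    (C ^+ 2 * (2 * (K * b 0%N)))%:E.
  apply: nneseries_le_partial => [m|M]; first exact: integral_ge0.
  apply: (@le_trans _ _ (\sum_(0 <= m < M) (q ^+ m * (C ^+ 2 * b m))%:E)).
    apply: lee_sum => m _.
    have qm0 : (0 <= q ^+ m)%R by rewrite exprn_ge0// (le_trans ler01).
    rewrite EFinM.
    have h1 : \int[mu]_(x in E (l m)) (sig x)%:E <= (C ^+ 2 * b m)%:E.
      by apply: le_trans (level_sigma (l_ge m)) _; rewrite EFinM -muleA -bE -EFinM.
    apply: le_trans (lee_wpmul2l _ h1); last by rewrite lee_fin.
    rewrite -ge0_integralZl//; last exact: measurable_funS msigE.
    apply: le_integral_any => [x _|x _|x xQ].
    - by rewrite mule_ge0.
    - by rewrite mule_ge0.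
    - rewrite /F; case: ifPn => [lx _|_]; last by rewrite mule0 eqxx.
      by split; [split|rewrite muleC].
  rewrite sumEFin lee_fin big_mkord.
  rewrite (_ : (\sum_(i < M) _ = C ^+ 2 * \sum_(i < M) q ^+ i * b i)%R); last first.
    by rewrite mulr_sumr; apply: eq_bigr => i _; ring.
  by rewrite ler_wpM2l.
have b0Q : (b 0%N)%:E <= l0%:E * mu Q.
  rewrite bE /l expr0 mulr1 lee_wpmul2l ?lee_fin ?(ltW l0_gt0)//.
  by apply: le_measure; rewrite ?inE//; move=> x [].
have muQ := muB_fin Q0; set mQr := fine (mu Q).
have mQE : mu Q = mQr%:E by rewrite fineK.
move: i1 b0Q; rewrite mQE -!EFinM => i1; rewrite lee_fin => b0Q.
apply: (@le_trans _ _ ((l0 `^ e)%:E * ((C ^+ 2 * l0 * mQr)%:E + (q - 1)%:E * (C ^+ 2 * (2 * (K * b 0%N)))%:E))).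
  rewrite lee_wpmul2l// leeD// lee_wpmul2l//.
rewrite -[(q - 1)%:E * _]EFinM -EFinD -EFinM lee_fin.
have -> : (l0 `^ (1 + e) = l0 `^ e * l0)%R.
  by rewrite addrC powRD ?powRr1 ?(ltW l0_gt0)// (gt_eqF l0_gt0) implybT.
rewrite (_ : (2 * C ^+ 2 * _ * mQr = l0 `^ e * (C ^+ 2 * l0 * mQr + C ^+ 2 * (l0 * mQr)))%R); last by ring.
rewrite ler_wpM2l ?powR_ge0// lerD2l.
rewrite (_ : ((q - 1) * _ = C ^+ 2 * (2 * (q - 1) * K * b 0%N))%R); last by ring.
rewrite ler_wpM2l// (le_trans _ b0Q)// ler_piMl//.
Qed.

End cube_estimates.

End on_grid.

End reverse_holder.

(** * Reverse Hoelder inequality on balls *)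

Section reverse_holder_ball.
Context {R : realType} {d : measure_display} {T : measurableType d}.
Variables (mu : {measure set T -> \bar R}) (rho : T -> T -> R).
Hypothesis sht : space_of_homogeneous_type mu rho.
Local Open Scope ereal_scope.
Local Notation B := (qball rho).

(** Cubes of scale comparable to [r] cover the ball, and [reverse_holder_cube] holds on each. As the
    grids get finer, Lebesgue differentiation makes [lmax] exceed a fixed multiple of [sig] almost
    everywhere, and Fatou turns [sig * lmax ^ e] into [sig ^ (1 + e)]. The ball of radius [H * r]
    has to contain the stars of the covering cubes. *)
Theorem reverse_holder_ball : exists Cr H c0 : R,
  [/\ (0 < Cr)%R, (1 <= H)%R, (0 < c0)%R &
  forall (sig : T -> R) (A : R),
    measurable_fun setT sig -> (forall x, 0 <= sig x)%R ->
    (forall B, qballs rho B -> 0 < \int[mu]_(x in B) (sig x)%:E < +oo) -> (1 <= A)%R ->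
    (forall B, qballs rho B ->
      \int[mu]_(x in B) HLmax mu rho (sig \* \1_B)%R x <= A%:E * \int[mu]_(x in B) (sig x)%:E) ->
    forall e z r, (0 < e)%R -> (e <= 1)%R -> (e * A <= c0)%R -> (0 < r)%R ->
      \int[mu]_(x in B z r) ((sig x) `^ (1 + e))%:E <=
      Cr%:E * (avg mu (B z (H * r)%R) (EFin \o sig)) `^ (1 + e) * mu (B z r)].
Proof.
have [C [H [Lam [C1 H1 Lam1 gridE lvl]]]] := grids_exist sht.
have H0 : (0 < H)%R := lt_le_trans ltr01 H1.
have C0 : (0 < C)%R := lt_le_trans ltr01 C1.
have Lam0 : (0 < Lam)%R := lt_le_trans ltr01 Lam1.
have [CH CH1 hCH] := qball_dilate sht H.
have CH0 : (0 < CH)%R := lt_le_trans ltr01 CH1.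
exists (4 * C ^+ 3 * CH ^+ 3)%R, H, (4 * C ^+ 2)^-1%R; split => //.
- by rewrite !mulr_gt0// exprn_gt0.
- by rewrite invr_gt0 mulr_gt0// exprn_gt0.
move=> sig A msig sig0 sball A1 sigA e z r e0 e1 eA r0.
have msigE : measurable_fun setT (EFin \o sig) by exact/measurable_EFinP.
have s0 x : 0 <= (EFin \o sig) x by rewrite lee_fin.
have s0' x : 0 <= (sig x)%:E by rewrite lee_fin.
have eA' : (4 * (A * C ^+ 2) * e <= 1)%R.
  move: eA; rewrite -[leRHS]mul1r ler_pdivlMr ?mulr_gt0 ?exprn_gt0//.
  by apply: le_trans; rewrite le_eqVlt; apply/orP; left; apply/eqP; ring.
have Hr0 : (0 < H * r)%R by rewrite mulr_gt0.
have Bz := qball_measure sht z r0.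
have BHz := qball_measure sht z Hr0.
have mBz := qball_measurable sht z r0.
have qBH : qballs rho (B z (H * r)%R) by exists z, (H * r)%R.
have /andP[sBpos sBfin] := sball _ qBH.
set av := avg mu _ _.
have avfin : av \is a fin_num.
  by rewrite /av avgE// fin_numM//= ge0_fin_numE ?integral_ge0.
have av0 : 0 <= av by apply: avg_ge0.
pose a := fine av; have a0 : (0 <= a)%R by exact: fine_ge0.
have avE : av = a%:E by rewrite fineK.
have [N0 hN0] := ex_le_exp2 (r * Lam)^-1%R.
pose ep N : R := (2 ^- (N + N0))%R.
have ep0 N : (0 < ep N)%R by rewrite invr_gt0 exprn_gt0.
have ep_le N : (ep N <= r * Lam)%R.
  rewrite /ep -[leRHS]invrK lef_pV2 ?posrE ?invr_gt0 ?mulr_gt0 ?exprn_gt0//.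
  by apply: le_trans hN0 _; rewrite ler_weXn2l ?ler1n// leq_addl.
pose G N : grid mu rho C H Lam (ep N) := projT1 (cid (gridE (ep N) (ep0 N))).
have /choice[j hj] : forall N, exists i, (ep N * Lam ^+ i <= r * Lam /\ r <= ep N * Lam ^+ i)%R.
  by move=> N; have [i h1 h2] := lvl _ _ (ep0 N) (ep_le N); exists i.
pose u N x := lmax sig (G N) (j N) x.
pose f N x := (sig x)%:E * u N x `^ e.
have u0 N x : 0 <= u N x by exact: (lmax_ge0 sht).
have mf N : measurable_fun setT (f N).
  apply: emeasurable_funM => //.
  apply: (@measurableT_comp _ _ _ _ _ _ (fun y : \bar R => y `^ e)) => //.
    exact: measurable_poweR.
  exact: measurable_lmax.
have f0 N x : 0 <= f N x by rewrite mule_ge0 ?poweR_ge0.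
pose K1 : R := (2 * C ^+ 2 * (CH * a) `^ (1 + e))%R.
have K10 : (0 <= K1)%R by rewrite mulr_ge0 ?powR_ge0// mulr_ge0// sqr_ge0.
have bound N : \int[mu]_(x in B z r) f N x <= K1%:E * (CH%:E * mu (B z r)).
  have [hj1 hj2] := hj N.
  (* The union of the cubes that meet the ball, over which the estimates on single cubes are
     glued. *)
  pose B' := [set x | exists2 y, B z r y & cen (G N) (j N) y = cen (G N) (j N) x].
  have mB' : measurable B'.
    rewrite (_ : B' = cen (G N) (j N) @^-1` [set c | exists2 y, B z r y & cen (G N) (j N) y = c])//.
    apply: (measurable_kap (@gidx_measurable _ _ _ _ _ _ _ _ _ (G N))) => x y.
    exact: cen_eq_gidx.
  have B'sub : B' `<=` B z (H * r)%R.
    move=> x [y zy yx]; have [_ h _] := star_cover (G N) hj1 hj2 zy.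
    by apply: h; rewrite yx; exact: cube_star.
  apply: (@le_trans _ _ (\int[mu]_(x in B') f N x)).
    by apply: le_integral_sub => // x zx; exists x.
  apply: (@le_trans _ _ (\int[mu]_(x in B') cst K1%:E x)); last first.
    rewrite integral_cst// lee_wpmul2l ?lee_fin//.
    apply: le_trans (hCH z r r0).
    by apply: le_measure; rewrite ?inE//; exact: (qball_measurable sht).
  apply: (@glue_le _ _ _ mu _ (@gidx_measurable _ _ _ _ _ _ _ _ _ (G N)) _
     (cen (G N) (j N)) _ B' (fun _ => f N) (cst K1%:E)) => //.
    by move=> x y; exact: cen_eq_gidx.
  move=> x [y zy yx].
  have -> : B' `&` cen (G N) (j N) @^-1` [set cen (G N) (j N) x] =
      cen (G N) (j N) @^-1` [set cen (G N) (j N) x].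
    by apply/seteqP; split => [w []//|w wx]; split => //; exists y => //; rewrite yx wx.
  apply: le_trans (@reverse_holder_cube _ _ _ _ _ sht sig A msig sig0 sball A1 sigA
    _ _ _ _ (G N) C1 (j N) x e e0 e1 eA') _.
  rewrite integral_cst; last exact: cube_measurable.
  rewrite lee_wpmul2r// lee_fin /K1 ler_wpM2l ?mulr_ge0 ?exprn_ge0 ?(ltW C0)//.
  set l0 := fine _.
  have l0E : gavg (G N) (EFin \o sig) (j N) (cen (G N) (j N) x) = l0%:E.
    by rewrite fineK//; exact: (gavg_sig_fin sht).
  apply: le_powR; first by rewrite addr_ge0// ltW.
    by apply: fine_ge0; apply: gavg_ge0.
  have [h1 h2 h3] := star_cover (G N) hj1 hj2 zy.
  rewrite -lee_fin -l0E EFinM -avE /gavg -yx.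
  apply: avg_sub => //; first exact: star_measure.
  apply: le_trans (hCH z r r0) _; rewrite lee_wpmul2l ?lee_fin ?(ltW CH0)//.
  by apply: le_measure; rewrite ?inE//; exact: star_measurable.
have sigint Q : qballs rho Q -> mu.-integrable Q (EFin \o sig).
  move=> qQ; have /andP[_ Qy] := sball _ qQ.
  have mQ : measurable Q by exact: (sht_ball_measurable sht).
  apply/integrableP; split; first exact: measurable_funS msigE.
  under eq_integral do rewrite /= ger0_norm//.
  exact: Qy.
have [N [mN N00 hN]] := sht_differentiation sht sigint.
(* Accounts for the lower bound [sig x / (2 * C)] of [lmax]: the 2 comes from the differentiation
   limit, [C] from replacing [B x (ep m)] by its star of level 0. *)
pose c : R := ((2 * C) `^ (- e))%R.
have c0 : (0 < c)%R by rewrite powR_gt0// mulr_gt0.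
have p0 x : 0 <= ((sig x) `^ (1 + e))%:E by rewrite lee_fin powR_ge0.
have mp : measurable_fun setT (fun x => ((sig x) `^ (1 + e))%:E).
  exact: measurable_powR_comp.
have main : c%:E * \int[mu]_(x in B z r) ((sig x) `^ (1 + e))%:E <= K1%:E * (CH%:E * mu (B z r)).
  rewrite -ge0_integralZl//; last 2 first.
  - exact: measurable_funS mp.
  - by rewrite lee_fin ltW.
  apply: le_trans (ge0_integral_setD_null mBz mN N00 _) _.
    by move=> x _; rewrite mule_ge0// lee_fin ltW.
  apply: (@fatou_le _ _ _ mu _ f) => //.
  - exact: measurableD.
  - move=> m; apply: le_trans (bound m); exact: le_integral_sub.
  - by move=> x _; rewrite mule_ge0// lee_fin ltW.
  move=> x [zx Nx].
  have cvx : avg mu (B x r0) (EFin \o sig) @[r0 --> 0%R^'+] --> (sig x)%:E.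
    by apply: contrapT => h; apply: Nx; apply: hN.
  have [sx0|sx0] := eqVneq (sig x) 0%R.
    rewrite sx0 powR0 ?mule0; first by apply: (@le_limn_einf _ _ _ 0%N) => m _.
    by rewrite gt_eqF// addr_gt0.
  have sxp : (0 < sig x)%R by rewrite lt_neqAle eq_sym sx0 sig0.
  have /fine_cvgP[hfin hcv] := cvx.
  have half : (sig x / 2 < sig x)%R by rewrite ltr_pdivrMr// ltr_pMr// ltr1n.
  have hgt := cvgr_gt _ hcv _ half.
  have : \forall r0 \near (0%R : R)^'+, (sig x / 2)%:E < avg mu (B x r0) (EFin \o sig).
    near=> r1; rewrite -(@fineK _ (avg mu (B x r1) (EFin \o sig))); last first.
      by near: r1; exact: hfin.
    by rewrite lte_fin; near: r1; exact: hgt.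
  move=> /nbhs_ballP[del /= del0 hdel].
  have [M hM] := ex_le_exp2 (del^-1 + 1)%R.
  apply: (@le_limn_einf _ _ _ M) => m Mm.
  have epdel : (ep m < del)%R.
    rewrite /ep invf_plt ?posrE ?exprn_gt0//.
    apply: (@lt_le_trans _ _ (2 ^+ M)%R); first by apply: lt_le_trans hM; rewrite ltrDl.
    by rewrite ler_weXn2l ?ler1n// (leq_trans Mm)// leq_addr.
  have hav : (sig x / 2)%:E < avg mu (B x (ep m)) (EFin \o sig).
    by apply: hdel => //; rewrite /ball /= sub0r normrN gtr0_norm.
  have u_ge : (sig x / (2 * C))%:E <= u m x.
    have r1 : (ep m * Lam ^+ 0 <= ep m * Lam)%R.
      by rewrite expr0 mulr1 ler_peMr// ltW.
    have r2 : (ep m <= ep m * Lam ^+ 0)%R by rewrite expr0 mulr1.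
    have [h1 h2 h3] := star_cover (G m) r1 r2 (qball_center sht x (ep0 m)).
    have h4 := avg_sub (qball_measure sht x (ep0 m)) (star_measure sht (G m) _ _)
      (fun y _ => s0 y) h1 h3.
    rewrite invfM mulrA EFinM muleC lee_pdivrMl//.
    apply: le_trans (ltW hav) _; apply: le_trans h4 _.
    rewrite lee_wpmul2l ?lee_fin ?(ltW C0)//; exact: (lmax_ge sig (G m) x (leq0n (j m))).
  have q0 : (0 <= sig x / (2 * C))%R by rewrite divr_ge0// mulr_ge0// ltW.
  apply: (@le_trans _ _ ((sig x)%:E * ((sig x / (2 * C)) `^ e)%:E)).
    rewrite -!EFinM lee_fin powRM ?invr_ge0 ?mulr_ge0 ?(ltW C0)//.
    rewrite -powR_inv1 ?mulr_ge0 ?(ltW C0)// -powRrM mulN1r -/c powRD ?powRr1//.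
      by rewrite mulrC mulrA.
    by rewrite sx0 implybT.
  by rewrite lee_wpmul2l// -poweR_EFin le_poweR// ltW.
have cE : (c = ((2 * C) `^ e)^-1)%R by rewrite /c powRN.
have D0 : (0 < (2 * C) `^ e)%R by rewrite powR_gt0// mulr_gt0.
move: main; rewrite cE lee_pdivrMl//; move/le_trans; apply.
rewrite avE poweR_EFin !muleA -!EFinM lee_wpmul2r// lee_fin /K1.
rewrite [((CH * a) `^ _)%R]powRM ?(ltW CH0)//.
rewrite (_ : _ * _ * CH = ((2 * C) `^ e * (2 * C ^+ 2) * (CH `^ (1 + e) * CH)) * a `^ (1 + e))%R; last by ring.
rewrite ler_wpM2r ?powR_ge0//.
rewrite (_ : 4 * C ^+ 3 * CH ^+ 3 = ((2 * C) * (2 * C ^+ 2)) * (CH ^+ 2 * CH))%R; last by ring.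
have C20 : (0 <= C ^+ 2)%R by rewrite sqr_ge0.
have C2 : (1 <= 2 * C)%R by lra.
have le1 : ((2 * C) `^ e <= 2 * C)%R.
  by rewrite -[leRHS]powRr1 ?(le_trans ler01)// ler_powR.
have le2 : (CH `^ (1 + e) <= CH ^+ 2)%R.
  by rewrite -powR_mulrn ?(ltW CH0)// ler_powR//; lra.
apply: ler_pM; rewrite ?mulr_ge0 ?powR_ge0 ?(ltW CH0) ?(ltW C0)//.
  by rewrite ler_wpM2r// mulr_ge0.
by rewrite ler_wpM2r// ltW.
Unshelve. all: by end_near. Qed.

End reverse_holder_ball.

(** * Maximal functions of split kernels *)

Section maximal_kernel.
Context {R : realType} {d : measure_display} {T : measurableType d}.
Variables (mu : {measure set T -> \bar R}) (rho : T -> T -> R).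
Hypothesis sht : space_of_homogeneous_type mu rho.
Local Open Scope ereal_scope.

Section data.
Variables (p t K1 C2 : R) (F : T -> T -> R) (h : T -> R) (N : set T).
Hypotheses (p1 : (1 < p)%R) (t1 : (1 < t)%R) (K10 : (0 <= K1)%R) (C20 : (0 <= C2)%R).
Hypotheses (F0 : forall x y, (0 <= F x y)%R) (h0 : forall x, (0 <= h x)%R).
Hypothesis mh : measurable_fun setT h.
Hypothesis hfin : \int[mu]_x ((h x) `^ t)%:E < +oo.

(** The pairs belonging to different balls are unrelated; only [K1] and [C2] are common to all. This
    is why each stopping cube has to start afresh with its own pair. *)
Hypothesis split : forall B, qballs rho B -> exists phi psi : T -> R,
  [/\ measurable_fun setT phi, measurable_fun setT psi,
      forall x, (0 <= phi x)%R, forall x, (0 <= psi x)%R &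
  [/\ forall x, ~ N x -> {ae mu, forall y, B y -> (F x y <= phi x * psi y)%R},
      \int[mu]_(x in B) ((phi x) `^ p)%:E <= K1%:E * mu B &
      avg mu B (EFin \o psi) `^ p <= C2%:E * avg mu B (EFin \o h) `^ t]].

Let p0 : (0 < p)%R := lt_trans ltr01 p1.
Let t0 : (0 < t)%R := lt_trans ltr01 t1.

Definition kavg (B : set T) (x : T) := avg mu B (fun y => (F x y)%:E).

Let avg_h_fin B : qballs rho B -> avg mu B (EFin \o h) < +oo.
Proof.
move=> qB; have B0 := sht_ball_measure sht qB; have mB := sht_ball_measurable sht qB.
rewrite avgE//; apply: lte_mul_pinfty => //.
apply: (@le_lt_trans _ _ (\int[mu]_(x in B) (cst 1 x + ((h x) `^ t)%:E))).
  apply: le_integral_dom => [x _|x _]; first by rewrite lee_fin.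
  rewrite -EFinD lee_fin; have [h1|h1] := leP (h x) 1%R.
    by rewrite (le_trans h1)// lerDl powR_ge0.
  rewrite (@le_trans _ _ (h x `^ t)%R)// ?lerDr// -{1}[h x]powRr1//.
  by rewrite ler_powR ?ltW.
rewrite ge0_integralD//; last 2 first.
- by move=> x _; rewrite lee_fin powR_ge0.
- exact: measurable_powR_comp.
rewrite integral_cst// mul1e; apply: lte_add_pinfty; first by have /andP[] := B0.
apply: le_lt_trans hfin; apply: le_integral_sub => // x _.
by rewrite lee_fin powR_ge0.
Qed.

Section on_grid.
Context {C H Lam eps : R}.
Variable G : grid mu rho C H Lam eps.
Hypothesis C1 : (1 <= C)%R.
Variable Cv : R.
Hypothesis Cv1 : (1 <= Cv)%R.
Hypothesis weak : forall (g : T -> \bar R) (lam : R),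
  measurable_fun setT g -> (forall x, 0 <= g x) -> (0 < lam)%R ->
  lam%:E * mu [set x | lam%:E < gmax G g x] <= Cv%:E * \int[mu]_x g x.
Local Notation cube i z := (cen G i @^-1` [set z]).

Let C0 : (0 < C)%R := lt_le_trans ltr01 C1.
Let Cv0 : (0 < Cv)%R := lt_le_trans ltr01 Cv1.
(** Stopping at [K] times the average of [psi] leaves at most half of the cube stopped: [Cv] pays
    for the weak inequality and [C] for passing from the star to the cube. *)
Let K : R := (2 * C * Cv)%R.
Let K1' : (1 <= K)%R.
Proof.
rewrite /K -[leLHS]mul1r; apply: ler_pM => //.
by rewrite -[leLHS]mul1r; apply: ler_pM => //; rewrite ler1n.
Qed.
Let K0 : (0 < K)%R := lt_le_trans ltr01 K1'.
(** [C] compares the star with its cube, 2 the cube with its unstopped part, and the power of [K]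
    comes from the stopping height. *)
Let Cst : R := (2 * C * K `^ p * (K1 * C2))%R.
Let Cst0 : (0 <= Cst)%R.
Proof. by rewrite mulr_ge0 ?mulr_ge0 ?powR_ge0 ?(ltW C0). Qed.

Let Ht x := gmax G (EFin \o h) x `^ t.
Let Ht0 x : 0 <= Ht x. Proof. exact: poweR_ge0. Qed.
Let mHt : measurable_fun setT Ht.
Proof.
apply: (@measurableT_comp _ _ _ _ _ _ (fun y : \bar R => y `^ t)).
  exact: measurable_poweR.
exact: measurable_gmax.
Qed.

Definition majorant j z (Psi : T -> \bar R) :=
  [/\ forall x i, ~ N x -> cen G j x = z -> (i <= j)%N ->
        kavg (star G i (cen G i x)) x `^ p <= Psi x &
      \int[mu]_(x in cube j z) Psi x <= Cst%:E * \int[mu]_(x in cube j z) Ht x].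

(** [phi * lam] controls the levels above the stopping cubes, and the inductive majorants of these
    cubes control the remaining levels. The constant does not grow with [j]: the new term is charged
    to the integral of [Ht] over the unstopped part, the inductive ones to that over the stopped
    part. *)
Lemma majorant_step j z : (exists x0, cen G j x0 = z) ->
  (forall i z', (i < j)%N -> exists Psi, [/\ measurable_fun setT Psi,
     forall x, 0 <= Psi x & majorant i z' Psi]) ->
  exists Psi, [/\ measurable_fun setT Psi, forall x, 0 <= Psi x & majorant j z Psi].
Proof.
move=> [x0 x0z] IH.
(* Levels from [j] on get a dummy majorant, so that [Fk] is defined on all keys. *)
have /choice[Fk hFk] : forall k : nat * T, exists Psi, [/\ measurable_fun setT Psi,
    forall x, 0 <= Psi x & (k.1 < j)%N -> majorant k.1 k.2 Psi].
  move=> [i z'] /=; have [ij|ij] := ltnP i j.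
    by have [Psi [? ? ?]] := IH i z' ij; exists Psi.
  by exists (cst 0); split.
set B := star G j z.
have qB : qballs rho B by exact: star_ball.
have B0 := star_measure sht G j z; have mB := star_measurable sht G j z.
have [phi [psi [mphi mpsi phi0 psi0 [Fsplit phip psip]]]] := split qB.
have psi0E x : 0 <= (EFin \o psi) x by rewrite lee_fin.
have mpsiE : measurable_fun setT (EFin \o psi) by exact/measurable_EFinP.
have h0E x : 0 <= (EFin \o h) x by rewrite lee_fin.
have av0 : 0 <= avg mu B (EFin \o psi) by apply: avg_ge0.
have avfin : avg mu B (EFin \o psi) \is a fin_num.
  rewrite ge0_fin_numE//; apply: (@lty_poweRy _ _ p); first by rewrite gt_eqF.
  apply: le_lt_trans psip _; apply: lte_mul_pinfty; rewrite ?lee_fin//.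
  by apply: poweR_lty; exact: avg_h_fin.
pose a := fine (avg mu B (EFin \o psi)).
have aE : avg mu B (EFin \o psi) = a%:E by rewrite fineK.
have a0 : (0 <= a)%R by exact: fine_ge0.
pose lam : R := (K * a)%R.
have lam0 : (0 <= lam)%R by rewrite mulr_ge0// ltW.
(* Cut off so that the weak inequality sees only the integral over [B]; averages of levels up to [j]
   do not change, their stars being inside [B]. *)
pose g := (EFin \o psi) \_ B.
have g0 x : 0 <= g x by apply: erestrict_ge0.
have mg : measurable_fun setT g.
  by apply/(measurable_restrictT _ mB); exact: measurable_funS mpsiE.
pose v := gavg G g.
have vE i x : (i <= j)%N -> cen G j x = z ->
    v i (cen G i x) = avg mu (star G i (cen G i x)) (EFin \o psi).
  move=> ij xz; rewrite /v /gavg !avgE; try exact: star_measure.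
  congr (_ * _); apply: eq_integral => y; rewrite inE => yi.
  by rewrite /g patchE mem_set// /B -xz; exact: (star_nest_le ij yi).
pose Om := stopped G v lam%:E j z.
have mOm : measurable Om by exact: measurable_stopped.
set Q := cube j z.
have mQ : measurable Q by exact: cube_measurable.
have Q0 : 0 < mu Q < +oo by rewrite /Q -x0z; exact: (cube_measure sht).
have OmQ : Om `<=` Q by move=> x [].
have BQ : mu B <= C%:E * mu Q by rewrite /B /Q -x0z; exact: star_cube_le.
have half : mu Om + mu Om <= mu Q.
  (* The weak inequality requires a positive height. If [a = 0], all averages of [psi] inside [B]
     vanish and nothing is stopped. *)
  have [a0'|an0] := eqVneq a 0%R.
    rewrite (_ : Om = set0) ?measure0 ?adde0//; apply/seteqP; split => // x [xz].
    case sE : (stop _ _ _ _ _) => [i|//] _; have [ij li _] := stop_Some sE.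
    move: li; rewrite /lam a0' mulr0 vE//; last exact: ltnW.
    rewrite ltNge => /negP; apply; rewrite avg_le; last exact: star_measure.
    rewrite mule0 -(_ : \int[mu]_(y in B) (EFin \o psi) y = 0).
      apply: le_integral_sub => //; rewrite /B -xz; apply: star_nest_le; exact: ltnW.
    by rewrite -(avg_mul B0) aE a0' mule0.
  have ap : (0 < a)%R by rewrite lt_neqAle eq_sym an0.
  have lamp : (0 < lam)%R by rewrite mulr_gt0.
  have hw : lam%:E * mu Om <= Cv%:E * (a%:E * (C%:E * mu Q)).
    apply: (@le_trans _ _ (Cv%:E * \int[mu]_x g x)).
      apply: le_trans (weak mg g0 lamp); rewrite lee_wpmul2l ?lee_fin//.
      apply: le_measure; rewrite ?inE//.
        rewrite -[X in measurable X]setTI; apply: emeasurable_fun_o_infty => //.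
        exact: measurable_gmax.
      move=> x [xz]; case sE : (stop _ _ _ _ _) => [i|//] _.
      by have [ij li _] := stop_Some sE; apply: lt_le_trans li (gmax_ub _ _ _ _).
    rewrite lee_wpmul2l ?lee_fin ?(ltW Cv0)// -integral_mkcond -(avg_mul B0) aE muleC.
    by rewrite lee_wpmul2l ?lee_fin.
  have muQ := muB_fin Q0.
  have muO : mu Om \is a fin_num.
    rewrite ge0_fin_numE//; have /andP[_ Qy] := Q0; apply: le_lt_trans Qy.
    by apply: le_measure; rewrite ?inE.
  move: hw; rewrite -(fineK muQ) -(fineK muO) -!EFinM -EFinD !lee_fin /lam /K => hw.
  have cc : (0 < C * Cv * a)%R by rewrite !mulr_gt0.
  rewrite -(ler_pM2l cc); lra.
pose P1 x := ((phi x * lam) `^ p)%:E.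
pose P2 x := Fk (stop_key G v lam%:E j x) x.
have P20 x : 0 <= P2 x by have [_ + _] := hFk (stop_key G v lam%:E j x); apply.
have mP2 : measurable_fun setT P2.
  by apply: measurable_stop_glue => k; have [] := hFk k.
have P10 x : 0 <= P1 x by rewrite lee_fin powR_ge0.
have mP1 : measurable_fun setT P1.
  by apply: measurable_powR_comp; exact: measurable_funM.
pose Psi x := P1 x + (P2 \_ Om) x.
have mP2O : measurable_fun setT (P2 \_ Om).
  by apply/(measurable_restrictT _ mOm); exact: measurable_funS mP2.
have P2O0 x : 0 <= (P2 \_ Om) x by apply: erestrict_ge0.
exists Psi; split.
- exact: emeasurable_funD.
- by move=> x; rewrite adde_ge0.
split.
  move=> x i Nx xz ij.
  have kv k : (k <= j)%N -> kavg (star G k (cen G k x)) x <= (phi x)%:E * v k (cen G k x).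
    move=> kj; rewrite vE// /kavg.
    have S0 := star_measure sht G k (cen G k x).
    have mS := star_measurable sht G k (cen G k x).
    rewrite !avgE// muleCA lee_wpmul2l//.
    rewrite -ge0_integralZl ?lee_fin//; last exact: measurable_funS mpsiE.
    apply: ae_le_integral_any => // [y _|y _|]; rewrite ?lee_fin//.
      by rewrite mulr_ge0.
    apply: filterS (Fsplit x Nx) => y Fy yS; rewrite -EFinM lee_fin; apply: Fy.
    by rewrite /B -xz; exact: (star_nest_le kj yS).
  have kavg0 k : 0 <= kavg (star G k (cen G k x)) x.
    by apply: avg_ge0; [exact: star_measure|move=> y _; rewrite lee_fin].
  have b1 k : (k <= j)%N -> v k (cen G k x) <= lam%:E ->
      kavg (star G k (cen G k x)) x `^ p <= P1 x.
    move=> kj vk; rewrite /P1 -poweR_EFin; apply: le_poweR => //; first exact: ltW.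
    by apply: le_trans (kv k kj) _; rewrite EFinM lee_wpmul2l ?lee_fin.
  have bj : v j (cen G j x) <= lam%:E.
    by rewrite vE// xz aE lee_fin /lam ler_peMl.
  have P1Psi : P1 x <= Psi x by rewrite /Psi leeDl.
  case sE : (stop G v lam%:E j x) => [k|]; last first.
    apply: le_trans P1Psi; apply: b1 => //.
    by move: ij; rewrite leq_eqVlt => /predU1P[->//|ij]; exact: stop_None sE ij.
  have [kj lk hk] := stop_Some sE.
  have [ik|ki] := leqP i k; last first.
    apply: le_trans P1Psi; apply: b1 => //.
    move: ij; rewrite leq_eqVlt => /predU1P[->//|ij]; by apply: hk; rewrite ki.
  have Omx : Om x by split => //; rewrite sE.
  have P2E : P2 x = Fk (k, cen G k x) x by rewrite /P2 /stop_key /stop_lvl sE.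
  apply: (@le_trans _ _ (P2 x)); last by rewrite /Psi patchE mem_set// leeDr.
  by rewrite P2E; have [_ _ /(_ kj)[+ _]] := hFk (k, cen G k x); apply.
rewrite ge0_integralD//; last 2 first.
- exact: measurable_funS mP1.
- exact: measurable_funS mP2O.
have mQO : measurable (Q `\` Om) by exact: measurableD.
have i2 : \int[mu]_(x in Q) (P2 \_ Om) x <= Cst%:E * \int[mu]_(x in Om) Ht x.
  apply: (@le_trans _ _ (\int[mu]_(x in Om) P2 x)).
    apply: le_integral_any => // x Qx; rewrite patchE; case: ifPn => [/set_mem Ox _|_].
      by split.
    by rewrite eqxx.
  rewrite -ge0_integralZl ?lee_fin//; last exact: measurable_funS mHt.
  apply: (@stop_glue _ _ _ mu rho _ _ _ _ G v lam%:E j z Fk (fun x => Cst%:E * Ht x)) => //.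
  - by move=> k; have [] := hFk k.
  - exact: measurable_funeM.
  - by move=> k; have [_ + _] := hFk k.
  - by move=> x; rewrite mule_ge0 ?lee_fin.
  move=> x i xz sE; have [ij _ _] := stop_Some sE.
  rewrite ge0_integralZl ?lee_fin//; last 2 first.
  - exact: cube_measurable.
  - exact: measurable_funS mHt.
  by have [_ _ /(_ ij)[_]] := hFk (i, cen G i x).
have i1 : \int[mu]_(x in Q) P1 x <= Cst%:E * \int[mu]_(x in Q `\` Om) Ht x.
  pose w := fine (avg mu B (EFin \o h)).
  have wE : avg mu B (EFin \o h) = w%:E.
    by rewrite fineK// ge0_fin_numE ?avg_h_fin//; apply: avg_ge0.
  have w0 : (0 <= w)%R by apply: fine_ge0; apply: avg_ge0.
  have muQ := muB_fin Q0.
  have finsub A : measurable A -> A `<=` Q -> mu A \is a fin_num.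
    move=> mA AQ; rewrite ge0_fin_numE//; have /andP[_ Qy] := Q0.
    by apply: le_lt_trans Qy; apply: le_measure; rewrite ?inE.
  have fO := finsub _ mOm OmQ; have fD := finsub _ mQO (@subDsetl _ Q Om).
  have QE : mu Q = mu Om + mu (Q `\` Om).
    rewrite -measureU//; first by rewrite setDUK.
    by apply/seteqP; split => // x [Ox [_]].
  have Q2 : mu Q <= 2%:E * mu (Q `\` Om).
    move: half; rewrite QE -(fineK fO) -(fineK fD) -EFinM -!EFinD !lee_fin; lra.
  have Iw : (w `^ t)%:E * mu (Q `\` Om) <= \int[mu]_(x in Q `\` Om) Ht x.
    rewrite -integral_cst//; apply: le_integral_dom => [x _|x [Qx _]].
      by rewrite lee_fin powR_ge0.
    rewrite -poweR_EFin; apply: le_poweR; rewrite ?lee_fin// ?(ltW t0)//.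
    by rewrite -wE; have := gmax_ub G (EFin \o h) j x; rewrite /gavg Qx.
  have aw : (a `^ p <= C2 * w `^ t)%R.
    rewrite -lee_fin EFinM -[leLHS](poweR_EFin a p) -[X in _ <= _ * X](poweR_EFin w t) -wE -aE.
    exact: psip.
  apply: (@le_trans _ _ ((lam `^ p)%:E * (K1%:E * mu B))).
    apply: (@le_trans _ _ ((lam `^ p)%:E * \int[mu]_(x in Q) (phi x `^ p)%:E)).
      rewrite -ge0_integralZl//; last 3 first.
      - exact: measurable_powR_comp.
      - by move=> x _; rewrite lee_fin powR_ge0.
      - by rewrite lee_fin powR_ge0.
      by apply: le_integral_dom => // x _; rewrite /P1 -EFinM lee_fin powRM// mulrC.
    rewrite lee_wpmul2l ?lee_fin ?powR_ge0//; apply: le_trans phip.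
    apply: le_integral_sub; first by move=> x _; rewrite lee_fin powR_ge0.
    by rewrite /Q /B -x0z; exact: cube_sub_star.
  apply: (@le_trans _ _ (Cst%:E * ((w `^ t)%:E * mu (Q `\` Om)))); last first.
    by rewrite lee_wpmul2l ?lee_fin.
  apply: (@le_trans _ _ ((lam `^ p)%:E * (K1%:E * (C%:E * (2%:E * mu (Q `\` Om)))))).
    rewrite lee_wpmul2l ?lee_fin ?powR_ge0// lee_wpmul2l ?lee_fin//.
    by apply: le_trans BQ _; rewrite lee_wpmul2l ?lee_fin ?(ltW C0).
  rewrite !muleA -!EFinM lee_wpmul2r// lee_fin /lam powRM ?(ltW K0)//.
  rewrite (_ : (Cst * w `^ t = (2 * C * K `^ p * K1) * (C2 * w `^ t))%R); last by rewrite /Cst; ring.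
  rewrite (_ : (_ * 2 = (2 * C * K `^ p * K1) * a `^ p)%R); last by ring.
  by rewrite ler_wpM2l// mulr_ge0 ?mulr_ge0 ?powR_ge0 ?(ltW C0).
apply: le_trans (leeD i1 i2) _.
rewrite -ge0_muleDr ?integral_ge0// -ge0_integral_setU//.
- by rewrite setUC setDUK.
- by rewrite setUC setDUK//; exact: measurable_funS mHt.
- by apply/disj_setPS => x [[_ nO] Ox].
Qed.

Lemma majorant_exists j z :
  exists Psi, [/\ measurable_fun setT Psi, forall x, 0 <= Psi x & majorant j z Psi].
Proof.
have [n] := ubnP j; elim: n j z => // n IH j z jn.
have [ex|nex] := pselect (exists x0, cen G j x0 = z).
  by apply: majorant_step => // i z' ij; apply: IH; exact: leq_trans ij (jn : (j <= n)%N).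
exists (cst 0); split => //; split => [x i _ xz|]; first by case: nex; exists x.
rewrite (_ : cube j z = set0) ?integral_set0 ?mule0//.
by apply/seteqP; split => // x xz; case: nex; exists x.
Qed.

(** The majorants of all cubes of level [j], glued together, dominate the levels up to [j]; their
    lower limit in [j] dominates all levels and keeps the bound. *)
Lemma grid_majorant : exists Psi, [/\ measurable_fun setT Psi, forall x, 0 <= Psi x,
  forall x i, ~ N x -> kavg (star G i (cen G i x)) x `^ p <= Psi x &
  \int[mu]_x Psi x <= Cst%:E * \int[mu]_x Ht x].
Proof.
have /choice[Fk hFk] : forall k : nat * T, exists Psi, [/\ measurable_fun setT Psi,
    forall x, 0 <= Psi x & majorant k.1 k.2 Psi].
  by move=> k; exact: majorant_exists.
pose f j x := Fk (j, cen G j x) x.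
have mf j : measurable_fun setT (f j).
  apply: (@measurable_glue _ _ _ (@gidx_measurable _ _ _ _ _ _ _ _ _ G) _
     (cen G j) _ _ _ (fun z => Fk (j, z))).
    by move=> x y; exact: cen_eq_gidx.
  by move=> z; have [] := hFk (j, z).
have f0 j x : 0 <= f j x by have [_ + _] := hFk (j, cen G j x); apply.
exists (fun x => limn_einf (f^~ x)); split.
- exact: measurable_limn_einf.
- by move=> x; apply: (@le_limn_einf _ _ _ 0%N) => m _.
- move=> x i Nx; apply: (@le_limn_einf _ _ _ i) => j ij.
  by have [_ _ [+ _]] := hFk (j, cen G j x); apply.
apply: (@fatou_le _ _ _ mu setT f) => //; last first.
  by move=> x _; apply: (@le_limn_einf _ _ _ 0%N) => m _.
move=> j; rewrite -ge0_integralZl ?lee_fin//.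
apply: (@glue_le _ _ _ mu _ (@gidx_measurable _ _ _ _ _ _ _ _ _ G) _
   (cen G j) _ setT (fun z => Fk (j, z))) => //.
- by move=> x y; exact: cen_eq_gidx.
- by move=> z; have [] := hFk (j, z).
- exact: measurable_funeM.
- by move=> z; have [_ + _] := hFk (j, z).
- by move=> x; rewrite mule_ge0 ?lee_fin.
move=> x _; rewrite setTI ge0_integralZl ?lee_fin//; last 2 first.
- exact: cube_measurable.
- exact: measurable_funS mHt.
by have [_ _ [_]] := hFk (j, cen G j x).
Qed.

End on_grid.
End data.

(** A ball containing [x] lies in the star of matching level around [x] once [ep m] is small enough,
    and its average is at most [C] times that of the star. Off [N] the [p]-th power of the supremum
    is thus at most the lower limit of the grid majorants times the [p]-th power of [C]. *)
Theorem maximal_kernel (p : R) : (1 < p)%R -> exists2 Cm : R, (0 < Cm)%R &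
  forall (t K1 C2 : R) (F : T -> T -> R) (h : T -> R) (N : set T),
  (1 < t)%R -> (t <= p)%R -> (0 <= K1)%R -> (0 <= C2)%R ->
  (forall x y, (0 <= F x y)%R) -> (forall x, (0 <= h x)%R) ->
  measurable_fun setT h -> \int[mu]_x ((h x) `^ t)%:E < +oo ->
  measurable N -> mu N = 0 ->
  (forall B, qballs rho B -> exists phi psi : T -> R,
  [/\ measurable_fun setT phi, measurable_fun setT psi,
      forall x, (0 <= phi x)%R, forall x, (0 <= psi x)%R &
  [/\ forall x, ~ N x -> {ae mu, forall y, B y -> (F x y <= phi x * psi y)%R},
      \int[mu]_(x in B) ((phi x) `^ p)%:E <= K1%:E * mu B &
      avg mu B (EFin \o psi) `^ p <= C2%:E * avg mu B (EFin \o h) `^ t]]) ->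
  \int[mu]_x (ereal_sup [set kavg F B x | B in [set B | qballs rho B /\ B x]]) `^ p <=
    (Cm * (K1 * C2) / Num.min 1 (t - 1))%:E * \int[mu]_x ((h x) `^ t)%:E.
Proof.
move=> p1; have p0 : (0 < p)%R := lt_trans ltr01 p1.
have [C [H [Lam [C1 _ Lam1 gridE lvl]]]] := grids_exist sht.
have C0 : (0 < C)%R := lt_le_trans ltr01 C1.
have Lam0 : (0 < Lam)%R := lt_le_trans ltr01 Lam1.
have [Cv Cv1 hCv] := grid_weak sht.
have [Cs Cs0 hCs] := grid_strong sht p.
have Cv0 : (0 < Cv)%R := lt_le_trans ltr01 Cv1.
exists (C `^ p * (2 * C * (2 * C * Cv) `^ p) * Cs)%R.
  by rewrite !(mulr_gt0, powR_gt0).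
move=> t K1 C2 F h N t1 tp K10 C20 F0 h0 mh hfin mN N0 split.
have t10 : (0 < Num.min 1 (t - 1))%R by rewrite lt_min ltr01 subr_gt0.
pose ep m : R := (2 ^- m)%R.
have ep0 m : (0 < ep m)%R by rewrite invr_gt0 exprn_gt0.
pose G m : grid mu rho C H Lam (ep m) := projT1 (cid (gridE (ep m) (ep0 m))).
have /choice[Psi hPsi] := fun m => grid_majorant p1 t1 K10 C20 F0 h0 mh hfin split
  C1 Cv1 (hCv _ _ _ _ (G m)).
set Cst := (2 * C * (2 * C * Cv) `^ p * (K1 * C2))%R in hPsi.
have Cst0 : (0 <= Cst)%R by rewrite mulr_ge0 ?mulr_ge0 ?powR_ge0 ?(ltW C0).
pose f m x := (C `^ p)%:E * Psi m x.
have Psi0 m x : 0 <= Psi m x by have [_ + _ _] := hPsi m; apply.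
have mPsi m : measurable_fun setT (Psi m) by have [] := hPsi m.
have Cp0 : (0 <= C `^ p)%R by exact: powR_ge0.
apply: le_trans (ge0_integral_setD_null measurableT mN N0 _) _.
  by move=> x _; exact: poweR_ge0.
apply: (@fatou_le _ _ _ mu _ f).
- exact: measurableD.
- by move=> m; exact: measurable_funeM.
- by move=> m x; rewrite mule_ge0 ?lee_fin.
- move=> m; apply: (@le_trans _ _ (\int[mu]_x f m x)).
    by apply: le_integral_sub => // x _; rewrite mule_ge0 ?lee_fin.
  rewrite ge0_integralZl ?lee_fin//.
  have [_ _ _ h1] := hPsi m.
  apply: (@le_trans _ _ ((C `^ p)%:E * (Cst%:E * ((Cs / Num.min 1 (t - 1))%:E * \int[mu]_x ((h x) `^ t)%:E)))).
    rewrite lee_wpmul2l ?lee_fin//; apply: le_trans h1 _.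
    by rewrite lee_wpmul2l ?lee_fin//; exact: hCs.
  rewrite !muleA -!EFinM le_eqVlt; apply/orP; left; apply/eqP.
  by congr (_%:E * _); rewrite /Cst; ring.
- by move=> x _; exact: poweR_ge0.
move=> x [_ Nx].
set b := limn_einf _.
have b0 : 0 <= b by apply: (@le_limn_einf _ _ _ 0%N) => m _; rewrite mule_ge0 ?lee_fin.
suff hs : ereal_sup [set kavg F B x | B in [set B | qballs rho B /\ B x]] <= b `^ p^-1.
  rewrite -[b]poweRe1// -(@mulVf _ p) ?gt_eqF// poweRrM ?gt_eqF ?invr_gt0//.
  apply: le_poweR => //; first exact: ltW.
  have [[B [qB Bx]]|nB] := pselect (exists B, qballs rho B /\ B x).
    apply: le_trans (ereal_sup_ubound _); last by exists B.
    by apply: avg_ge0; [exact: (sht_ball_measure sht)|move=> y _; rewrite lee_fin].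
  by case: nB; exists (qball rho x 1%R); split; [exists x, 1%R|exact: (qball_center sht)].
apply: ge_ereal_sup => _ [B [[z [r [r0 ->]]] zx] <-].
have Bz := qball_measure sht z r0.
have k0 : 0 <= kavg F (qball rho z r) x.
  by apply: avg_ge0 => // y _; rewrite lee_fin.
suff : kavg F (qball rho z r) x `^ p <= b.
  move=> hb; rewrite -[leLHS]poweRe1// -(@mulfV _ p) ?gt_eqF// poweRrM ?gt_eqF ?invr_gt0//.
  by apply: le_poweR => //; rewrite ?poweR_ge0 ?invr_ge0 ?(ltW p0).
have [M hM] := ex_le_exp2 (r * Lam)^-1%R.
apply: (@le_limn_einf _ _ _ M) => m Mm.
have ep_le : (ep m <= r * Lam)%R.
  rewrite /ep -[leRHS]invrK lef_pV2 ?posrE ?invr_gt0 ?mulr_gt0 ?exprn_gt0//.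
  by apply: le_trans hM _; rewrite ler_weXn2l ?ler1n.
have [i i1 i2] := lvl _ _ (ep0 m) ep_le.
have [h1 _ h3] := star_cover (G m) i1 i2 zx.
have S0 := star_measure sht (G m) i (cen (G m) i x).
apply: (@le_trans _ _ ((C%:E * kavg F (star (G m) i (cen (G m) i x)) x) `^ p)).
  apply: le_poweR => //; first exact: ltW.
  by apply: avg_sub => // y _; rewrite lee_fin.
rewrite poweRM ?lee_fin ?(ltW C0)//; last first.
  by apply: avg_ge0 => // y _; rewrite lee_fin.
rewrite poweR_EFin lee_wpmul2l ?lee_fin//.
by have [_ _ + _] := hPsi m; apply.
Qed.

End maximal_kernel.

Lemma powR_sum_le {R : realType} (p : R) (n : nat) (a : 'I_n -> R) :
  0 < p -> (forall i, 0 <= a i) ->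
  (\sum_i a i) `^ p <= n%:R `^ p * \sum_i a i `^ p.
Proof.
move=> p0 a0; case: n a a0 => [|n] a a0.
  by rewrite !big_ord0 mulr0 powR0 ?gt_eqF.
have [j _ jmax] := @Order.TotalTheory.arg_maxP _ _ _ ord0 xpredT a isT.
have h1 : \sum_i a i <= n.+1%:R * a j.
  rewrite (le_trans (ler_sum _ (fun i _ => jmax i isT)))//.
  by rewrite sumr_const card_ord mulr_natl.
apply: le_trans (le_powR (ltW p0) (sumr_ge0 _ (fun i _ => a0 i)) h1) _.
rewrite powRM// ler_wpM2l ?powR_ge0// (bigD1 j)//= lerDl sumr_ge0// => i _.
exact: powR_ge0.
Qed.

(** * Minkowski and Hoelder inequalities for averages *)

Section averaged_norms.
Context {R : realType} {d : measure_display} {T : measurableType d}.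
Variable mu : {measure set T -> \bar R}.
Local Open Scope ereal_scope.

Lemma integral_gt0 (B : set T) (f : T -> R) : measurable B -> 0 < mu B ->
  measurable_fun setT f -> (forall x, 0 <= f x)%R -> {ae mu, forall x, (0 < f x)%R} ->
  0 < \int[mu]_(x in B) (f x)%:E.
Proof.
move=> mB B0 mf f0 [N [mN N0 hN]].
have mfE : measurable_fun B (EFin \o f).
  by apply/measurable_EFinP; exact: measurable_funS mf.
rewrite lt_neqAle eq_sym integral_ge0 ?andbT; last by move=> x _; rewrite lee_fin.
apply/negP => /eqP I0.
have /(ae_eq_integral_abs mu mB mfE)[N' [mN' N'0 hN']] :
    \int[mu]_(x in B) `|(EFin \o f) x| = 0.
  by rewrite -I0; apply: eq_integral => x _; rewrite /= ger0_norm.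
move: B0; rewrite lt_neqAle => /andP[/negP + _]; apply; rewrite eq_sym; apply/eqP.
apply: (@subset_measure0 _ _ _ mu B (N `|` N')) => //.
- exact: measurableU.
- move=> x Bx; apply: contrapT => /not_orP[Nx N'x].
  have fx : (0 < f x)%R by apply: contrapT => h; exact/Nx/hN.
  apply: N'x; apply: hN' => /(_ Bx) /= [fx0].
  by move: fx; rewrite fx0 ltxx.
- exact: null_set_setU.
Qed.

Section on_set.
Variable B : set T.
Hypotheses (mB : measurable B) (B0 : 0 < mu B < +oo).

Let m := fine (mu B).
Let m0 : (0 < m)%R. Proof. exact: fine_muB_gt0. Qed.

(** Normalised so that its [L^r] norm on the whole space is the averaged norm of [f] on [B]. *)
Let rst (r : R) (f : T -> R) x : R := (m `^ (- r^-1) * f x * \1_B x)%R.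

Let mrst r (f : T -> R) : measurable_fun setT f -> measurable_fun setT (rst r f).
Proof.
move=> mf; apply: measurable_funM; last exact: measurable_indic.
exact: measurable_funM.
Qed.

Let rstE r (f : T -> R) : (0 < r)%R -> measurable_fun setT f -> (forall x, 0 <= f x)%R ->
  'N[mu]_r%:E[EFin \o rst r f] = avg mu B (fun x => ((f x) `^ r)%:E) `^ r^-1.
Proof.
move=> r0 mf f0; rewrite Lnorm.unlock; congr (_ `^ _).
rewrite avgE// -ge0_integralZl//; last 2 first.
- exact: measurable_powR_comp.
- by move=> x _; rewrite lee_fin powR_ge0.
rewrite [RHS]integral_mkcond; apply: eq_integral => x _.
rewrite patchE /rst /= indicE; case: ifPn => _; last first.
  by rewrite mulr0 normr0 powR0 ?gt_eqF.
rewrite mulr1 ger0_norm ?mulr_ge0 ?powR_ge0// powRM ?powR_ge0// -powRrM mulNr mulVf ?gt_eqF//.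
by rewrite powR_inv1 ?EFinM// ltW.
Qed.

Lemma avg_minkowski r (f g : T -> R) : (1 <= r)%R ->
  measurable_fun setT f -> measurable_fun setT g ->
  (forall x, 0 <= f x)%R -> (forall x, 0 <= g x)%R ->
  avg mu B (fun x => ((f x + g x) `^ r)%:E) `^ r^-1 <=
  avg mu B (fun x => ((f x) `^ r)%:E) `^ r^-1 + avg mu B (fun x => ((g x) `^ r)%:E) `^ r^-1.
Proof.
move=> r1 mf mg f0 g0; have r0 : (0 < r)%R := lt_le_trans ltr01 r1.
have fg0 x : (0 <= f x + g x)%R by rewrite addr_ge0.
rewrite -[leLHS](rstE r0 (measurable_funD mf mg) fg0).
rewrite -[X in _ <= X + _](rstE r0 mf f0) -[X in _ <= _ + X](rstE r0 mg g0).
rewrite (_ : rst r (f \+ g)%R = (rst r f \+ rst r g)%R).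
  exact: minkowski_EFin (mrst _ mf) (mrst _ mg) r1.
by apply/funext => x; rewrite /rst /= mulrDr mulrDl.
Qed.

Lemma avg_hoelder s r (f g : T -> R) : (0 < s)%R -> (0 < r)%R -> (s^-1 + r^-1 = 1)%R ->
  measurable_fun setT f -> measurable_fun setT g ->
  (forall x, 0 <= f x)%R -> (forall x, 0 <= g x)%R ->
  avg mu B (fun x => (f x * g x)%:E) <=
  avg mu B (fun x => ((f x) `^ s)%:E) `^ s^-1 * avg mu B (fun x => ((g x) `^ r)%:E) `^ r^-1.
Proof.
move=> s0 r0 sr mf mg f0 g0.
rewrite -[X in _ <= X * _](rstE s0 mf f0) -[X in _ <= _ * X](rstE r0 mg g0).
apply: le_trans (hoelder mu (mrst s mf) (mrst r mg) s0 r0 sr).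
rewrite (_ : (rst s f \* rst r g)%R = rst 1 (fun x => f x * g x)%R); last first.
  apply/funext => x; rewrite /rst /= invr1 -sr opprD powRD; last by rewrite (gt_eqF m0) implybT.
  rewrite [LHS](_ : _ = m `^ (- s^-1) * m `^ (- r^-1) * (f x * g x) * (\1_B x * \1_B x))%R; last by ring.
  by congr (_ * _)%R; rewrite indicE; case: (_ \in _); rewrite ?mulr1 ?mulr0.
rewrite rstE//; last 2 first.
- exact: measurable_funM.
- by move=> x; rewrite mulr_ge0.
rewrite invr1 poweRe1; last by apply: avg_ge0 => // x _; rewrite lee_fin powR_ge0.
by apply: le_avg => // x _; rewrite ?lee_fin ?powRr1 ?mulr_ge0.
Qed.

End on_set.
End averaged_norms.

(** * From the Christ-Goldberg operator to split kernels *)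

Section christ_goldberg.
Context {R : realType} {d : measure_display} {T : measurableType d}.
Variables (mu : {measure set T -> \bar R}) (rho : T -> T -> R).
Hypothesis sht : space_of_homogeneous_type mu rho.
Local Open Scope ereal_scope.

Lemma CGmax_ge0 n (p : R) (W : T -> 'M[R]_n) f x : 0 <= CGmax mu rho p W f x.
Proof.
have B1 : qballs rho (qball rho x 1%R) by exists x, 1%R.
apply: (@le_trans _ _ (avg mu (qball rho x 1%R) (fun y =>
   (enorm (mxpow (W x) p^-1 *m mxpow (W y) (- p^-1) *m f y))%:E))).
  by apply: avg_ge0 => [|y _]; [exact: (sht_ball_measure sht)|rewrite lee_fin enorm_ge0].
by apply: ereal_sup_ubound; exists (qball rho x 1%R) => //; split => //; exact: (qball_center sht).
Qed.

Lemma vLnormE n (p : R) (f : T -> 'cV[R]_n) :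
  vLnorm mu p f = (\int[mu]_x ((enorm (f x)) `^ p)%:E) `^ p^-1.
Proof.
rewrite /vLnorm Lnorm.unlock; congr (_ `^ _); apply: eq_integral => x _ /=.
by rewrite ger0_norm ?enorm_ge0.
Qed.

Lemma sume_const n (X : \bar R) : \sum_(i < n) X = n%:R%:E * X.
Proof.
elim: n => [|n ih]; first by rewrite big_ord0 mul0e.
by rewrite big_ord_recr/= ih -natr1 EFinD ge0_muleDl ?lee_fin// mul1e.
Qed.

Lemma avg_sum_le (B : set T) n (g : 'I_n -> T -> R) (X : \bar R) :
  measurable B -> 0 < mu B < +oo ->
  (forall i, measurable_fun setT (g i)) -> (forall i x, 0 <= g i x)%R ->
  (forall i, avg mu B (fun x => (g i x)%:E) <= X) ->
  avg mu B (fun x => (\sum_i g i x)%:E) <= n%:R%:E * X.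
Proof.
move=> mB B0 mg g0 gX; rewrite avg_le//.
under eq_integral do rewrite -sumEFin.
rewrite ge0_integral_sum//; last 2 first.
- by move=> i; apply/measurable_EFinP; exact: measurable_funS (mg i).
- by move=> i x _; rewrite lee_fin.
apply: (@le_trans _ _ (\sum_(i < n) mu B * X)).
  by apply: lee_sum => i _; rewrite -avg_le.
by rewrite sume_const muleCA.
Qed.

(** [maximal_kernel] applied to sums over the axes. [K] bounds an integral of [p]-th powers and
    enters once, whereas [L] bounds an average and enters to the power [p]. *)
Theorem CGmax_axes n (p : R) : (0 < n)%N -> (1 < p)%R -> exists2 Cm : R, (0 < Cm)%R &
  forall (W : T -> 'M[R]_n) (f : T -> 'cV[R]_n) (t K L : R) (N : set T),
  (1 < t)%R -> (t <= p)%R -> (0 <= K)%R -> (0 <= L)%R -> in_vLp mu p f ->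
  measurable N -> mu N = 0 ->
  (forall B, qballs rho B -> exists a b : 'I_n -> T -> R,
    [/\ forall i, measurable_fun setT (a i), forall i, measurable_fun setT (b i),
        forall i x, (0 <= a i x)%R, forall i x, (0 <= b i x)%R &
    [/\ forall x, ~ N x -> {ae mu, forall y, B y ->
          (enorm (mxpow (W x) p^-1 *m mxpow (W y) (- p^-1) *m f y) <=
           \sum_i a i x * (b i y * enorm (f y)))%R},
        forall i, \int[mu]_(x in B) ((a i x) `^ p)%:E <= K%:E * mu B &
        forall i, avg mu B (fun y => (b i y * enorm (f y))%:E) <=
          L%:E * avg mu B (fun y => ((enorm (f y)) `^ (p / t))%:E) `^ (t / p)]]) ->
  'N[mu]_p%:E[CGmax mu rho p W f] <=
    ((Cm * K * L `^ p / Num.min 1 (t - 1)) `^ p^-1)%:E * vLnorm mu p f.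
Proof.
move=> n0 p1; have p0 : (0 < p)%R := lt_trans ltr01 p1.
have [Cm Cm0 hCm] := maximal_kernel sht p1.
have nR : (0 < n%:R :> R)%R by rewrite ltr0n.
exists (Cm * (n%:R `^ p * n%:R) * n%:R `^ p)%R.
  by rewrite !(mulr_gt0, powR_gt0).
move=> W f t K L N t1 tp K0 L0 [mf fp] mN N0 hB.
have t0 : (0 < t)%R := lt_trans ltr01 t1.
have me : measurable_fun setT (fun x => enorm (f x)) by exact: measurable_enorm.
pose h x := ((enorm (f x)) `^ (p / t))%R.
have h0 x : (0 <= h x)%R by exact: powR_ge0.
have mh : measurable_fun setT h.
  by apply/measurable_EFinP; exact: measurable_powR_comp.
have hE x : (h x `^ t = enorm (f x) `^ p)%R.
  by rewrite /h -powRrM -mulrA mulVf ?gt_eqF// mulr1.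
have If : \int[mu]_x ((h x) `^ t)%:E = \int[mu]_x ((enorm (f x)) `^ p)%:E.
  by apply: eq_integral => x _; rewrite hE.
have Ifin : \int[mu]_x ((h x) `^ t)%:E < +oo.
  rewrite If; apply: (@lty_poweRy _ _ p^-1); first by rewrite gt_eqF ?invr_gt0.
  by rewrite -vLnormE.
pose F x y := enorm (mxpow (W x) p^-1 *m mxpow (W y) (- p^-1) *m f y).
have main := hCm t (n%:R `^ p * (n%:R * K))%R ((n%:R * L) `^ p)%R F h N t1 tp _ _
  (fun x y => enorm_ge0 _) h0 mh Ifin mN N0 _.
have {}main : \int[mu]_x CGmax mu rho p W f x `^ p <=
    (Cm * (n%:R `^ p * (n%:R * K) * (n%:R * L) `^ p) / Num.min 1 (t - 1))%:E *
    \int[mu]_x ((h x) `^ t)%:E.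
  apply: main; first by rewrite !mulr_ge0 ?powR_ge0 ?(ltW nR).
    exact: powR_ge0.
  move=> B qB; have [a [b [ma mb a0 b0 [FB aK bL]]]] := hB B qB.
  have mB := sht_ball_measurable sht qB; have B0 := sht_ball_measure sht qB.
  have mbf i : measurable_fun setT (fun y => b i y * enorm (f y))%R by exact: measurable_funM.
  have bf0 i y : (0 <= b i y * enorm (f y))%R by rewrite mulr_ge0 ?enorm_ge0.
  exists (fun x => \sum_i a i x)%R, (fun y => \sum_i b i y * enorm (f y))%R; split.
  - by apply: measurable_sum => i.
  - by apply: measurable_sum => i.
  - by move=> x; exact: sumr_ge0.
  - by move=> x; exact: sumr_ge0.
  split.
  - move=> x Nx; apply: filterS (FB x Nx) => y Fy By; apply: le_trans (Fy By) _.
    rewrite mulr_suml ler_sum// => i _; rewrite ler_wpM2l//.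
    by rewrite (bigD1 i)//= lerDl sumr_ge0.
  - apply: (@le_trans _ _ (\int[mu]_(x in B) ((n%:R `^ p)%:E * \sum_(i < n) ((a i x) `^ p)%:E))).
      apply: le_integral_dom => [x _|x _]; first by rewrite lee_fin powR_ge0.
      by rewrite sumEFin -EFinM lee_fin powR_sum_le.
    have map i : measurable_fun B (fun x => ((a i x) `^ p)%:E).
      exact: measurable_powR_comp.
    have ap0 i x : B x -> 0 <= ((a i x) `^ p)%:E by rewrite lee_fin powR_ge0.
    rewrite ge0_integralZl//; last 2 first.
    - exact: emeasurable_sum.
    - by move=> x Bx; apply: sume_ge0 => i _; exact: ap0.
    rewrite ge0_integral_sum// EFinM -muleA lee_wpmul2l ?lee_fin ?powR_ge0//.
    apply: (@le_trans _ _ (\sum_(i < n) K%:E * mu B)); first by apply: lee_sum => i _.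
    by rewrite sume_const EFinM muleA.
  - have av := avg_sum_le mB B0 mbf bf0 bL.
    rewrite powRM ?(ltW nR)// EFinM.
    apply: (@le_trans _ _ ((n%:R%:E * (L%:E * avg mu B (EFin \o h) `^ (t / p))) `^ p)).
      apply: le_poweR => //; first exact: ltW.
      by apply: avg_ge0 => // y _; rewrite lee_fin; exact: sumr_ge0.
    set X := avg mu B (EFin \o h); clearbody X.
    rewrite !poweRM ?mule_ge0 ?poweR_ge0 ?lee_fin ?(ltW nR)//.
    by rewrite !poweR_EFin muleA -poweRrM mulfVK ?gt_eqF.
have CE x : `|CGmax mu rho p W f x| = CGmax mu rho p W f x by rewrite gee0_abs ?CGmax_ge0.
rewrite Lnorm.unlock; under eq_integral do rewrite CE.
rewrite vLnormE -If -poweR_EFin -poweRM; last 2 first.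
- rewrite lee_fin divr_ge0 ?mulr_ge0 ?powR_ge0 ?(ltW nR) ?(ltW Cm0)//.
  by rewrite le_min ler01 subr_ge0 ltW.
- by apply: integral_ge0 => x _; rewrite lee_fin powR_ge0.
apply: le_poweR; first by rewrite invr_ge0 ltW.
  by apply: integral_ge0 => x _; exact: poweR_ge0.
apply: le_trans main _; rewrite powRM ?(ltW nR)//.
by rewrite le_eqVlt; apply/orP; left; apply/eqP; congr (_%:E * _); ring.
Qed.

End christ_goldberg.

(** * Reducing norms and matrix weights *)

Section reducing_norms.
Context {R : realType} {d : measure_display} {T : measurableType d} {n : nat}.
Variable mu : {measure set T -> \bar R}.
Local Open Scope ereal_scope.

Lemma measurable_enorm_mxv (M : T -> 'M[R]_n) (z : 'cV[R]_n) :
  (forall i j, measurable_fun setT (fun x => M x i j)) ->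
  measurable_fun setT (fun x => enorm (M x *m z)).
Proof. by move=> mM; apply: measurable_enorm_mul. Qed.

Variable B : set T.
Hypotheses (mB : measurable B) (B0 : 0 < mu B < +oo).

Lemma ae_ex (P : T -> Prop) : {ae mu, forall y, P y} -> exists2 y, B y & P y.
Proof.
move=> [N [mN N0 hN]]; apply: contrapT => h.
have /andP[+ _] := B0; rewrite lt_neqAle => /andP[/negP + _]; apply; rewrite eq_sym; apply/eqP.
apply: (@subset_measure0 _ _ _ mu B N) => // y By; apply: hN => Py.
by apply: h; exists y.
Qed.

Lemma avg_scale (f : T -> R) (k : R) : (0 <= k)%R -> measurable_fun setT f ->
  (forall x, 0 <= f x)%R ->
  avg mu B (fun x => (k * f x)%:E) = k%:E * avg mu B (fun x => (f x)%:E).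
Proof.
move=> k0 mf f0; rewrite !avgE// muleCA; congr (_ * _).
rewrite -ge0_integralZl ?lee_fin// => [|x _]; last by rewrite lee_fin.
by apply/measurable_EFinP; exact: measurable_funS mf.
Qed.

Lemma avg_enormZ r (M : T -> 'M[R]_n) (k : R) z : (0 < r)%R ->
  (forall i j, measurable_fun setT (fun x => M x i j)) ->
  avg mu B (fun y => ((enorm (M y *m (k *: z))) `^ r)%:E) =
  (`|k| `^ r)%:E * avg mu B (fun y => ((enorm (M y *m z)) `^ r)%:E).
Proof.
move=> r0 mM; rewrite -avg_scale ?powR_ge0//.
- congr (avg _ _ _); apply/funext => y.
  by rewrite -scalemxAr enormZ powRM// enorm_ge0.
- apply/measurable_EFinP; apply: measurable_powR_comp; exact: measurable_enorm_mxv.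
- by move=> x; exact: powR_ge0.
Qed.

(* The averaged operator norm need not be measurable, hence the scaling is
   done on the left-hand side. *)
Lemma avg_enorm_opnorm r (M : T -> 'M[R]_n) (A : 'M[R]_n) (u : 'cV[R]_n) : (0 < r)%R ->
  (forall i j, measurable_fun setT (fun x => M x i j)) ->
  avg mu B (fun y => ((enorm (M y *m (A *m u))) `^ r)%:E) <=
  (enorm u `^ r)%:E * avg mu B (fun y => ((opnorm (M y *m A)) `^ r)%:E).
Proof.
move=> r0 mM; have [->|u0] := eqVneq u 0%R.
  rewrite mulmx0 enorm0 powR0 ?gt_eqF// mul0e -(scale0r (0 : 'cV[R]_n)) avg_enormZ//.
  by rewrite normr0 powR0 ?gt_eqF// mul0e.
have eu : (0 < enorm u)%R by rewrite enorm_gt0.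
pose v : 'cV[R]_n := ((enorm u)^-1 *: u)%R.
have v1 : (enorm v <= 1)%R.
  by rewrite enormZ gtr0_norm ?invr_gt0// mulVf// gt_eqF.
have -> : A *m u = (enorm u *: (A *m v))%R.
  by rewrite scalemxAr /v scalerA mulfV ?scale1r// gt_eqF.
rewrite (avg_enormZ (enorm u) (A *m v) r0 mM) (ger0_norm (enorm_ge0 u)).
apply: lee_wpmul2l; first by rewrite lee_fin powR_ge0.
apply: le_avg => // y _.
  by rewrite lee_fin powR_ge0.
by rewrite lee_fin le_powR ?(ltW r0) ?enorm_ge0// mulmxA opnorm_ub.
Qed.

(** By Minkowski's inequality a finite averaged norm is a seminorm, to which
    [seminorm_orthogonal_axes] applies. *)
Lemma avg_norm_axes r (M : T -> 'M[R]_n) : (1 <= r)%R ->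
  (forall i j, measurable_fun setT (fun x => M x i j)) ->
  (forall z, avg mu B (fun y => ((enorm (M y *m z)) `^ r)%:E) < +oo) ->
  exists Nm : 'cV[R]_n -> R, [/\ forall z, (0 <= Nm z)%R,
    forall z, avg mu B (fun y => ((enorm (M y *m z)) `^ r)%:E) = (Nm z `^ r)%:E &
    exists2 U : 'M[R]_n, orthmx U &
      forall i z, (Nm (col i U^T) * `|dot (col i U^T) z| <= 2 ^+ n * Nm z)%R].
Proof.
move=> r1 mM fin; have r0 : (0 < r)%R := lt_le_trans ltr01 r1.
pose a z := avg mu B (fun y => ((enorm (M y *m z)) `^ r)%:E).
have a0 z : 0 <= a z by apply: avg_ge0 => // y _; rewrite lee_fin powR_ge0.
have afin z : a z = (fine (a z))%:E by rewrite fineK// ge0_fin_numE// fin.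
have [Nm [Nm0 NmE Nmr]] : exists Nm : 'cV[R]_n -> R, [/\ forall z, (0 <= Nm z)%R,
    forall z, (Nm z)%:E = a z `^ r^-1 & forall z, a z = (Nm z `^ r)%:E].
  exists (fun z => (fine (a z)) `^ r^-1)%R; split => z.
  - exact: powR_ge0.
  - by rewrite [a z in RHS]afin poweR_EFin.
  - by rewrite [LHS]afin -powRrM mulVf ?gt_eqF// powRr1// fine_ge0.
exists Nm; split => //.
apply: seminorm_orthogonal_axes.
  move=> u v; rewrite -lee_fin EFinD 3!NmE.
  apply: le_trans (avg_minkowski mB B0 r1 (measurable_enorm_mxv u mM)
    (measurable_enorm_mxv v mM) (fun=> enorm_ge0 _) (fun=> enorm_ge0 _)).
  apply: le_poweR; first by rewrite invr_ge0 ltW.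
    exact: a0.
  apply: le_avg => // y _; rewrite lee_fin; first exact: powR_ge0.
  by rewrite le_powR ?(ltW r0) ?enorm_ge0// mulmxDr ler_enormD.
move=> k u; apply: EFin_inj; rewrite EFinM !NmE /a (avg_enormZ k u r0 mM).
rewrite poweRM ?lee_fin ?powR_ge0//; last exact: a0.
by rewrite poweR_EFin -powRrM mulfV ?gt_eqF// powRr1.
Qed.

Variable W : T -> 'M[R]_n.
Hypothesis WW : matrix_weight mu W.

Let mW : forall i j, measurable_fun setT (fun x => W x i j).
Proof. by case: WW. Qed.

Let aepd : {ae mu, forall x, posdefmx (W x)}.
Proof. by case: WW. Qed.

Let mWp s : forall i j, measurable_fun setT (fun x => mxpow (W x) s i j).
Proof. by move=> i j; exact: measurable_mxpow. Qed.

Section q_gt1.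
Variables (q c : R).
Hypothesis q1 : (1 < q)%R.
Local Notation q' := (conj_exp q).
Local Notation O x :=
  (avg mu B (fun y => ((opnorm (mxpow (W y) (- q^-1) *m mxpow (W x) q^-1)) `^ q')%:E)).
Hypothesis Wc : avg mu B (fun x => O x `^ (q / q')) <= c%:E.

Let q0 : (0 < q)%R := lt_trans ltr01 q1.
Let q'0 : (0 < q')%R. Proof. by rewrite /conj_exp divr_gt0// subr_gt0. Qed.
Let q'1 : (1 <= q')%R.
Proof. by rewrite /conj_exp ler_pdivlMr ?subr_gt0// mul1r gerBl. Qed.

(** Since [z = W^{1/q}(x) (W^{-1/q}(x) z)], an infinite average at one [z] makes [O x] infinite for
    almost every [x], against [Wc]. *)
Lemma Ap_avg_fin z : avg mu B (fun y => ((enorm (mxpow (W y) (- q^-1) *m z)) `^ q')%:E) < +oo.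
Proof.
rewrite ltey; apply/negP => /eqP oo.
have [N [mN N0 hN]] := aepd.
have OE x : ~ N x -> O x = +oo.
  move=> Nx; have pd : posdefmx (W x) by apply: contrapT => h; exact/Nx/hN.
  apply/eqP; rewrite -leye_eq leNgt; apply/negP => Oy.
  have := avg_enorm_opnorm (mxpow (W x) q^-1) (mxpow (W x) (- q^-1) *m z) q'0 (mWp (- q^-1)).
  rewrite mulmxA mxpowNK// mul1mx oo leye_eq => /eqP h.
  have : (enorm (mxpow (W x) (- q^-1) *m z) `^ q')%:E * O x < +oo.
    by apply: lte_mul_pinfty; rewrite ?lee_fin ?powR_ge0.
  by rewrite h ltxx.
have /andP[Bp By] := B0.
have mD : measurable (B `\` N) by exact: measurableD.
have BN : 0 < mu (B `\` N).
  rewrite lt_neqAle eq_sym measure_ge0 andbT; apply/negP => /eqP D0.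
  move: Bp; rewrite -(setDUK (_ : B `&` N `<=` B)); last by move=> x [].
  rewrite null_set_setU ?ltxx//.
  - exact: measurableI.
  - apply: measurableD => //; exact: measurableI.
  - by apply: (@subset_measure0 _ _ _ mu _ N) => //; exact: measurableI.
  - by rewrite setDIr setDv set0U.
move: Wc; rewrite avg_le//; apply/negP; rewrite -ltNge.
apply: (@lt_le_trans _ _ +oo).
  by apply: lte_mul_pinfty => //; [exact: (muB_fin B0)|exact: ltry].
apply: (@le_trans _ _ (\int[mu]_(x in B `\` N) cst +oo x)).
  by rewrite integral_cst// gt0_mulye.
apply: le_integral_any => [x _|x _|x [Bx Nx] _].
- exact: leey.
- exact: poweR_ge0.
by split => //; rewrite OE// poweRyr// gt_eqF// divr_gt0.
Qed.

Let mE s z : measurable_fun setT (fun x => enorm (mxpow (W x) s *m z)).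
Proof. exact: measurable_enorm_mxv. Qed.

Lemma ae_enorm_gt0 s z : z != 0%R -> {ae mu, forall x, (0 < enorm (mxpow (W x) s *m z))%R}.
Proof. by move=> z0; apply: filterS aepd => x pd; exact: enorm_mxpow_gt0. Qed.

Lemma orthmx_col_neq0 (U : 'M[R]_n) i : orthmx U -> col i U^T != 0%R.
Proof. by move=> oU; rewrite -enorm_gt0 enorm_orthmx_col. Qed.

(** For fixed [x], the norm [Nm] of [W^{1/q}(x) u] is at most [|u|] times the [q']-th root of [O x].
    The axis inequality turns this into a bound on [Nm e |<e, W^{1/q}(x) u>|], and [dual_axis_bound]
    into one on [Nm e |W^{1/q}(x) e|], to be integrated in [x]. *)
Theorem Ap_reducing : exists (U : 'M[R]_n) (nu : 'I_n -> R),
  [/\ orthmx U, forall i, (0 < nu i)%R,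
      forall i, avg mu B (fun y => ((enorm (mxpow (W y) (- q^-1) *m col i U^T)) `^ q')%:E) =
        (nu i `^ q')%:E &
      forall i, \int[mu]_(x in B) ((nu i * enorm (mxpow (W x) q^-1 *m col i U^T)) `^ q)%:E <=
        ((2 ^+ n) `^ q * c)%:E * mu B].
Proof.
have [Nm [Nm0 NmE [U oU hU]]] := avg_norm_axes q'1 (mWp (- q^-1)) Ap_avg_fin.
exists U, (fun i => Nm (col i U^T)); split => // i.
  rewrite lt_neqAle Nm0 andbT eq_sym; apply/negP => /eqP N0.
  have := NmE (col i U^T); rewrite N0 powR0 ?gt_eqF// => a0.
  have /andP[Bp _] := B0.
  have : 0 < \int[mu]_(y in B) ((enorm (mxpow (W y) (- q^-1) *m col i U^T)) `^ q')%:E.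
    apply: integral_gt0 => //.
    - by apply/measurable_EFinP; exact: measurable_powR_comp.
    - by move=> x; exact: powR_ge0.
    - by apply: filterS (ae_enorm_gt0 (- q^-1) (orthmx_col_neq0 i oU)) => x; exact: powR_gt0.
  by rewrite -(avg_mul B0) a0 mule0 ltxx.
set e := col i U^T.
have t0 : (0 < (2 ^+ n) `^ q :> R)%R by rewrite powR_gt0// exprn_gt0.
have key x : posdefmx (W x) ->
    ((Nm e * enorm (mxpow (W x) q^-1 *m e)) `^ q)%:E <= ((2 ^+ n) `^ q)%:E * O x `^ (q / q').
  move=> pd.
  have O0 : 0 <= O x by apply: avg_ge0 => // y _; rewrite lee_fin powR_ge0.
  have [Oy|] := ltP (O x) +oo; last first.
    rewrite leye_eq => /eqP ->; rewrite poweRyr ?gt0_muley ?leey//.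
    by rewrite gt_eqF// divr_gt0.
  have OE : O x = (fine (O x))%:E by rewrite fineK// ge0_fin_numE.
  set o := fine (O x) in OE.
  have o0 : (0 <= o)%R by exact: fine_ge0.
  rewrite OE poweR_EFin -EFinM lee_fin.
  have -> : (o `^ (q / q') = (o `^ q'^-1) `^ q)%R by rewrite -powRrM mulrC.
  rewrite -powRM ?powR_ge0 ?exprn_ge0//.
  apply: le_powR; first exact: ltW.
    by rewrite mulr_ge0 ?enorm_ge0.
  apply: dual_axis_bound; first exact: mxpow_tr.
    by rewrite mulr_ge0 ?powR_ge0 ?exprn_ge0.
  move=> u; apply: le_trans (hU _ _) _.
  rewrite -mulrA ler_wpM2l ?exprn_ge0//.
  have := avg_enorm_opnorm (mxpow (W x) q^-1) u q'0 (mWp (- q^-1)).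
  rewrite NmE OE -EFinM lee_fin => h.
  have -> : (Nm (mxpow (W x) q^-1 *m u) = (Nm (mxpow (W x) q^-1 *m u) `^ q') `^ q'^-1)%R.
    by rewrite -powRrM mulfV ?gt_eqF// powRr1.
  have -> : (o `^ q'^-1 * enorm u = (enorm u `^ q' * o) `^ q'^-1)%R.
    by rewrite powRM ?powR_ge0// -powRrM mulfV ?gt_eqF// powRr1 ?enorm_ge0// mulrC.
  by apply: le_powR; rewrite ?powR_ge0 ?invr_ge0 ?(ltW q'0).
(* [O] may be non-measurable, so the constant is moved into the integral of the measurable side. *)
rewrite EFinM -muleA -lee_pdivrMl// -ge0_integralZl ?lee_fin//; last 2 first.
- by apply: measurable_powR_comp; apply: measurable_funM.
- by move=> x _; rewrite lee_fin powR_ge0.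
move: Wc; rewrite avg_le// muleC; apply: le_trans; apply: ae_le_integral_any => //.
- by move=> x _; rewrite -EFinM lee_fin mulr_ge0 ?powR_ge0// invr_ge0 ltW.
- by move=> x _; exact: poweR_ge0.
by apply: filterS aepd => x pd _; rewrite lee_pdivrMl//; exact: key.
Qed.

End q_gt1.

(** The roles are exchanged: the axes belong to the average of [W], and the inverse is bounded
    pointwise, as the [A_1] condition is an essential supremum in [y]. *)
Theorem A1_reducing (c : R) :
  {ae mu, forall y, B y -> avg mu B (fun x => (opnorm (W x *m invmx (W y)))%:E) <= c%:E} ->
  exists (U : 'M[R]_n) (nu : 'I_n -> R),
  [/\ (0 <= c)%R, orthmx U, forall i, (0 < nu i)%R,
      forall i, avg mu B (fun y => (enorm (W y *m col i U^T))%:E) = (nu i)%:E &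
      {ae mu, forall y, B y -> forall i,
        (nu i * enorm (mxpow (W y) (- 1) *m col i U^T) <= 2 ^+ n * c)%R}].
Proof.
move=> Wc.
have avg1 (g : T -> R) : (forall y, 0 <= g y)%R ->
    avg mu B (fun y => ((g y) `^ 1)%:E) = avg mu B (fun y => (g y)%:E).
  by move=> g0; congr (avg _ _ _); apply/funext => y; rewrite powRr1.
have key y u : posdefmx (W y) ->
    avg mu B (fun x => (opnorm (W x *m invmx (W y)))%:E) <= c%:E ->
    avg mu B (fun x => ((enorm (W x *m (mxpow (W y) (- 1) *m u))) `^ 1)%:E) <=
    (c * enorm u)%:E.
  move=> pd yc; apply: le_trans (avg_enorm_opnorm _ _ ltr01 mW) _.
  rewrite avg1; last by move=> x; exact: opnorm_ge0.
  rewrite (powRr1 (enorm_ge0 u)) (mulrC c) EFinM -(mxpow_inv pd).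
  by apply: lee_wpmul2l => //; rewrite lee_fin enorm_ge0.
(* A single good point of [B] shows that [c] is nonnegative and, on inverting [W y0], that all
   averages are finite. *)
have [y0 By0 [pd0 c0]] := ae_ex (filterI aepd Wc).
have c_ge0 : (0 <= c)%R.
  rewrite -lee_fin; apply: le_trans (c0 By0).
  by apply: avg_ge0 => // x _; rewrite lee_fin opnorm_ge0.
have fin z : avg mu B (fun y => ((enorm (W y *m z)) `^ 1)%:E) < +oo.
  have := key y0 (mxpow (W y0) 1 *m z) pd0 (c0 By0).
  by rewrite mulmxA mxpowKN// mul1mx => /le_lt_trans; apply; rewrite ltry.
have [Nm [Nm0 NmE [U oU hU]]] := avg_norm_axes (lexx _) mW fin.
have NmE1 z : avg mu B (fun y => (enorm (W y *m z))%:E) = (Nm z)%:E.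
  by rewrite -avg1 ?NmE ?powRr1// => y; exact: enorm_ge0.
exists U, (fun i => Nm (col i U^T)); split => // [i|].
  rewrite lt_neqAle Nm0 andbT eq_sym; apply/negP => /eqP N0.
  have := NmE1 (col i U^T); rewrite N0 => a0.
  have /andP[Bp _] := B0.
  have : 0 < \int[mu]_(y in B) (enorm (W y *m col i U^T))%:E.
    apply: integral_gt0 => //.
    - exact: measurable_enorm_mxv.
    - by move=> x; exact: enorm_ge0.
    - apply: filterS aepd => x pd; rewrite -(mxpow1 pd).
      by apply: enorm_mxpow_gt0 => //; exact: orthmx_col_neq0.
  by rewrite -(avg_mul B0) a0 mule0 ltxx.
apply: filterS (filterI aepd Wc) => y [pd yc] By i.
apply: dual_axis_bound; first exact: mxpow_tr.
  by rewrite mulr_ge0 ?exprn_ge0.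
move=> u; apply: le_trans (hU _ _) _; rewrite -mulrA ler_wpM2l ?exprn_ge0//.
by have := key y u pd (yc By); rewrite NmE powRr1.
Qed.

End reducing_norms.

(** * Bounds for weights in A_1 and in A_q with q < p *)

Section weighted_bounds.
Context {R : realType} {d : measure_display} {T : measurableType d}.
Variables (mu : {measure set T -> \bar R}) (rho : T -> T -> R).
Hypothesis sht : space_of_homogeneous_type mu rho.
Variable n : nat.
Hypothesis n_gt0 : (0 < n)%N.
Local Open Scope ereal_scope.

Lemma ae_eq_integral_any (D : set T) (f g : T -> \bar R) :
  measurable D -> (forall x, D x -> 0 <= f x) -> (forall x, D x -> 0 <= g x) ->
  {ae mu, forall x, f x = g x} -> \int[mu]_(x in D) f x = \int[mu]_(x in D) g x.
Proof.
move=> mD f0 g0 fg; apply/eqP; rewrite eq_le; apply/andP; split.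
  by apply: ae_le_integral_any => //; apply: filterS fg => x -> _.
by apply: ae_le_integral_any => //; apply: filterS fg => x -> _.
Qed.

Lemma ess_sup_on_ae (B : set T) (g : T -> \bar R) (c : R) :
  ess_sup_on mu B g <= c%:E -> {ae mu, forall y, B y -> g y <= c%:E}.
Proof.
move=> gc.
have hk (k : nat) : {ae mu, forall y, B y -> g y <= (c + k.+1%:R^-1)%:E}.
  have : ess_sup_on mu B g < (c + k.+1%:R^-1)%:E.
    by apply: le_lt_trans gc _; rewrite lte_fin ltrDl invr_gt0 ltr0n.
  move=> /ereal_inf_lt[c' hc' /ltW cc'].
  by apply: filterS hc' => y hy By; exact: le_trans (hy By) cc'.
apply: filterS (ae_foralln hk) => y hy By; apply/lee_addgt0Pr => e e0.
have [k hk'] := ex_le_nat e^-1.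
apply: le_trans (hy k By) _; rewrite EFinD leeD2l// lee_fin invf_ple ?posrE ?ltr0n//.
by rewrite (le_trans hk')// ler_nat.
Qed.

Lemma powR_balance (m x y th : R) : (0 < m)%R -> (0 <= x)%R -> (0 <= y)%R ->
  ((m * x) `^ th * (y / m) `^ th = x `^ th * y `^ th)%R.
Proof.
move=> m0 x0 y0; rewrite -!powRM ?mulr_ge0 ?invr_ge0 ?(ltW m0)//; congr (powR _ th).
by field; rewrite gt_eqF.
Qed.

(** Splitting along the axes, then Jensen on each unit axis to pass from the power [a] to [a * th].
    The numbers [m i] cancel; they normalise the two factors. *)
Lemma matrix_kernel_axes (A B U : 'M[R]_n) (m : 'I_n -> R) (a th : R) u :
  posdefmx A -> posdefmx B -> orthmx U -> (forall i, 0 < m i)%R -> (0 < th)%R -> (th <= 1)%R ->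
  (enorm (mxpow A (a * th) *m mxpow B (- (a * th)) *m u) <=
   \sum_i (m i * enorm (mxpow A a *m col i U^T)) `^ th *
     ((enorm (mxpow B (- a) *m col i U^T) / m i) `^ th * enorm u))%R.
Proof.
move=> Apd Bpd oU m0 th0 th1.
apply: le_trans (enorm_mul_split _ _ oU (mxpow_tr Bpd _)) _.
apply: ler_sum => i _; rewrite mulrA ler_wpM2r ?enorm_ge0//.
have e1 := enorm_orthmx_col i oU.
have hA := enorm_mxpow_interp Apd a th0 th1 e1.
have := enorm_mxpow_interp Bpd (- a) th0 th1 e1; rewrite mulNr => hB.
rewrite (powR_balance th (m0 i) (enorm_ge0 _) (enorm_ge0 _)).
exact: ler_pM (enorm_ge0 _) (enorm_ge0 _) hA hB.
Qed.

Lemma CGmax_A1 (p : R) : (1 < p)%R -> exists2 C : R, (0 < C)%R &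
  forall W : T -> 'M[R]_n, matrix_weight mu W -> A1_const mu rho W < +oo ->
  forall f, in_vLp mu p f ->
  'N[mu]_p%:E[CGmax mu rho p W f] <= C%:E * A1_const mu rho W `^ p^-1 * vLnorm mu p f.
Proof.
move=> p1; have p0 : (0 < p)%R := lt_trans ltr01 p1.
have [Cm Cm0 hCm] := CGmax_axes sht n_gt0 p1.
have m0 : (0 < Num.min 1 (p - 1))%R by rewrite lt_min ltr01 subr_gt0.
exists ((Cm * 2 ^+ n / Num.min 1 (p - 1)) `^ p^-1)%R.
  by rewrite powR_gt0// divr_gt0// mulr_gt0// exprn_gt0.
move=> W WW Wy f fp.
have ess_ge0 B : qballs rho B -> 0 <= ess_sup_on mu B (fun y =>
    avg mu B (fun x => (opnorm (W x *m invmx (W y)))%:E)).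
  move=> qB; have mB := sht_ball_measurable sht qB; have B0 := sht_ball_measure sht qB.
  apply: le_ereal_inf_tmp => c' /= hc'.
  have [y By h] := ae_ex mB B0 hc'; apply: le_trans (h By).
  by apply: avg_ge0 => // x _; rewrite lee_fin opnorm_ge0.
have W0 : 0 <= A1_const mu rho W.
  have qB : qballs rho (qball rho point 1%R) by exists point, 1%R.
  by apply: le_trans (ess_ge0 _ qB) _; apply: ereal_sup_ubound; exists (qball rho point 1%R).
pose c := fine (A1_const mu rho W).
have cE : A1_const mu rho W = c%:E by rewrite fineK// ge0_fin_numE.
have c0 : (0 <= c)%R by exact: fine_ge0.
have [N [mN N0 hN]] := WW.2.
have pdN x : ~ N x -> posdefmx (W x) by move=> Nx; apply: contrapT => h; exact/Nx/hN.
rewrite cE poweR_EFin -EFinM -powRM//; last first.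
  by rewrite divr_ge0 ?mulr_ge0 ?exprn_ge0 ?(ltW Cm0) ?(ltW m0).
rewrite (_ : _ / _ * c = Cm * (2 ^+ n * c) * 1 `^ p / Num.min 1 (p - 1))%R; last first.
  by rewrite powR1; ring.
apply: (hCm W f p (2 ^+ n * c)%R 1%R N) => //; first by rewrite mulr_ge0 ?exprn_ge0.
move=> B qB.
have mB := sht_ball_measurable sht qB; have B0 := sht_ball_measure sht qB.
have WB : {ae mu, forall y, B y -> avg mu B (fun x => (opnorm (W x *m invmx (W y)))%:E) <= c%:E}.
  by apply: ess_sup_on_ae; rewrite -cE; apply: ereal_sup_ubound; exists B.
have [U [nu [_ oU nu0 nuE nuW]]] := A1_reducing mB B0 WW WB.
have cp : (0 < 2 ^+ n * c)%R.
  have [y By [pd h]] := ae_ex mB B0 (filterI WW.2 nuW).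
  apply: lt_le_trans (h By (Ordinal n_gt0)); rewrite mulr_gt0// enorm_mxpow_gt0//.
  exact: orthmx_col_neq0.
(* With this choice [A1_reducing] bounds the factor in [y] by 1, so no room is lost in Hoelder and
   [t = p]; the [p]-th power of the factor in [x] has average [2 ^+ n * c]. *)
pose m i : R := (2 ^+ n * c / nu i)%R.
have mp i : (0 < m i)%R by rewrite divr_gt0.
have pi0 : (0 < p^-1)%R by rewrite invr_gt0.
have pi1 : (p^-1 <= 1)%R by rewrite invf_le1// ltW.
have mWp s i j : measurable_fun setT (fun x => mxpow (W x) s i j).
  by apply: measurable_mxpow; exact: WW.1.
have ma i : measurable_fun setT (fun x => m i * enorm (mxpow (W x) 1 *m col i U^T))%R.
  by apply: measurable_funM => //; exact: measurable_enorm_mxv.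
exists (fun i x => (m i * enorm (mxpow (W x) 1 *m col i U^T)) `^ p^-1)%R, (fun _ _ => 1%R).
split => //.
- by move=> i; apply/measurable_EFinP; exact: measurable_powR_comp.
- by move=> i x; exact: powR_ge0.
split.
- move=> x Nx; apply: filterS (filterI WW.2 nuW) => y [pdy hy] By.
  have := matrix_kernel_axes 1 (f y) (pdN x Nx) pdy oU mp pi0 pi1.
  rewrite mul1r => /le_trans; apply; apply: ler_sum => i _.
  rewrite ler_wpM2l ?powR_ge0// ler_wpM2r ?enorm_ge0//.
  rewrite [leRHS](_ : _ = 1 `^ p^-1)%R; last by rewrite powR1.
  rewrite le_powR ?(ltW pi0)//.
    by rewrite divr_ge0 ?enorm_ge0 ?(ltW (mp i)).
  rewrite ler_pdivrMr// mul1r /m ler_pdivlMr// mulrC; exact: hy.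
- move=> i.
  have -> : \int[mu]_(x in B) (((m i * enorm (mxpow (W x) 1 *m col i U^T)) `^ p^-1) `^ p)%:E =
      \int[mu]_(x in B) ((m i)%:E * (enorm (W x *m col i U^T))%:E).
    apply: ae_eq_integral_any => // [x _|x _|].
    - by rewrite lee_fin powR_ge0.
    - by rewrite -EFinM lee_fin mulr_ge0 ?enorm_ge0 ?(ltW (mp i)).
    apply: filterS WW.2 => x pd; rewrite -powRrM mulVf ?gt_eqF// powRr1 ?mxpow1 ?EFinM//.
    by rewrite mulr_ge0 ?enorm_ge0 ?(ltW (mp i)).
  rewrite ge0_integralZl//; last 3 first.
  - apply/measurable_EFinP; apply: measurable_funS (_ : measurable_fun setT _) => //.
    by apply: measurable_enorm_mxv; exact: WW.1.
  - by move=> x _; rewrite lee_fin enorm_ge0.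
  - by rewrite lee_fin ltW.
  rewrite -(avg_mul B0) nuE muleCA muleC -EFinM lee_wpmul2r//.
  by rewrite lee_fin /m divfK ?gt_eqF.
- move=> i; rewrite mul1e divff ?gt_eqF// poweRe1; last first.
    by apply: avg_ge0 => // y _; rewrite lee_fin powR_ge0.
  by apply: le_avg => // y _; rewrite mul1r ?powRr1 ?lee_fin ?enorm_ge0.
Qed.

Lemma Ap_gt1_const_ge0 p (W : T -> 'M[R]_n) : 0 <= Ap_gt1_const mu rho p W.
Proof.
have qB : qballs rho (qball rho point 1%R) by exists point, 1%R.
apply: (@le_trans _ _ (avg mu (qball rho point 1%R) (fun x =>
   avg mu (qball rho point 1%R) (fun y =>
     (opnorm (mxpow (W y) (- p^-1) *m mxpow (W x) p^-1) `^ conj_exp p)%:E)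
     `^ (p / conj_exp p)))).
  by apply: avg_ge0 => [|x _]; [exact: (sht_ball_measure sht)|exact: poweR_ge0].
by apply: ereal_sup_ubound; exists (qball rho point 1%R).
Qed.

Lemma CGmax_Aq (p q : R) : (1 < q)%R -> (q < p)%R -> exists2 C : R, (0 < C)%R &
  forall W : T -> 'M[R]_n, matrix_weight mu W -> Ap_gt1_const mu rho q W < +oo ->
  forall f, in_vLp mu p f ->
  'N[mu]_p%:E[CGmax mu rho p W f] <= C%:E * Ap_gt1_const mu rho q W `^ p^-1 * vLnorm mu p f.
Proof.
move=> q1 qp; have q0 : (0 < q)%R := lt_trans ltr01 q1.
have p0 : (0 < p)%R := lt_trans q0 qp; have p1 : (1 < p)%R := lt_trans q1 qp.
have [Cm Cm0 hCm] := CGmax_axes sht n_gt0 p1.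
(* Forced by Hoelder: with [s = p / (q - 1)], [th * s = q'] makes the normalised axis have average
   one, and the conjugate exponent of [s] is [p / t]. *)
pose t : R := (p - q + 1)%R.
have t1 : (1 < t)%R by rewrite /t; lra.
have tp : (t <= p)%R by rewrite /t; lra.
have m0 : (0 < Num.min 1 (t - 1))%R by rewrite lt_min ltr01 subr_gt0.
have two0 : (0 < 2 ^+ n :> R)%R by rewrite exprn_gt0.
exists ((Cm * (2 ^+ n) `^ q / Num.min 1 (t - 1)) `^ p^-1)%R.
  by rewrite powR_gt0// divr_gt0// mulr_gt0// powR_gt0.
move=> W WW Wy f fp.
have W0 := Ap_gt1_const_ge0 q W.
pose c := fine (Ap_gt1_const mu rho q W).
have cE : Ap_gt1_const mu rho q W = c%:E by rewrite fineK// ge0_fin_numE.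
have c0 : (0 <= c)%R by exact: fine_ge0.
have [N [mN N0 hN]] := WW.2.
have pdN x : ~ N x -> posdefmx (W x) by move=> Nx; apply: contrapT => h; exact/Nx/hN.
rewrite cE poweR_EFin -EFinM -powRM//; last first.
  by rewrite divr_ge0 ?mulr_ge0 ?powR_ge0 ?(ltW Cm0) ?(ltW m0).
rewrite (_ : _ / _ * c = Cm * ((2 ^+ n) `^ q * c) * 1 `^ p / Num.min 1 (t - 1))%R; last first.
  by rewrite powR1; ring.
apply: (hCm W f t ((2 ^+ n) `^ q * c)%R 1%R N) => //; first by rewrite mulr_ge0 ?powR_ge0.
move=> B qB.
have mB := sht_ball_measurable sht qB; have B0 := sht_ball_measure sht qB.
have WB : avg mu B (fun x => avg mu B (fun y =>
    (opnorm (mxpow (W y) (- q^-1) *m mxpow (W x) q^-1) `^ conj_exp q)%:E)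
    `^ (q / conj_exp q)) <= c%:E.
  by rewrite -cE; apply: ereal_sup_ubound; exists B.
have [U [nu [oU nu0 nuE nuW]]] := Ap_reducing mB B0 WW q1 WB.
pose th : R := (q / p)%R.
have th0 : (0 < th)%R by rewrite divr_gt0.
have th1 : (th <= 1)%R by rewrite ler_pdivrMr// mul1r ltW.
have qth : (q^-1 * th = p^-1)%R by rewrite /th mulrA mulVf ?mul1r// gt_eqF.
have mE s i : measurable_fun setT (fun x => enorm (mxpow (W x) s *m col i U^T)).
  by apply: measurable_enorm_mxv => j k; apply: measurable_mxpow; exact: WW.1.
have ma i : measurable_fun setT (fun x => nu i * enorm (mxpow (W x) q^-1 *m col i U^T))%R.
  exact: measurable_funM.
have mb i : measurable_fun setT (fun x => enorm (mxpow (W x) (- q^-1) *m col i U^T) / nu i)%R.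
  exact: measurable_funM.
have b0 i x : (0 <= enorm (mxpow (W x) (- q^-1) *m col i U^T) / nu i)%R.
  by rewrite divr_ge0 ?enorm_ge0 ?(ltW (nu0 i)).
exists (fun i x => (nu i * enorm (mxpow (W x) q^-1 *m col i U^T)) `^ th)%R,
  (fun i x => (enorm (mxpow (W x) (- q^-1) *m col i U^T) / nu i) `^ th)%R.
split.
- by move=> i; apply/measurable_EFinP; exact: measurable_powR_comp.
- by move=> i; apply/measurable_EFinP; exact: measurable_powR_comp.
- by move=> i x; exact: powR_ge0.
- by move=> i x; exact: powR_ge0.
split.
- move=> x Nx; apply: filterS WW.2 => y pdy By.
  by have := matrix_kernel_axes q^-1 (f y) (pdN x Nx) pdy oU nu0 th0 th1; rewrite qth.
- move=> i; apply: le_trans (nuW i).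
  apply: le_integral_dom => x _; rewrite lee_fin ?powR_ge0//.
  by rewrite -powRrM /th divfK ?gt_eqF.
- move=> i.
  have q1' : (q - 1 != 0)%R by rewrite subr_eq0 gt_eqF.
  have s0 : (0 < p / (q - 1))%R by rewrite divr_gt0// subr_gt0.
  have r0 : (0 < p / t)%R by rewrite divr_gt0// (lt_trans ltr01).
  have sr : ((p / (q - 1))^-1 + (p / t)^-1 = 1)%R.
    by rewrite !invf_div -mulrDl /t (_ : q - 1 + (p - q + 1) = p)%R ?mulfV ?gt_eqF//; ring.
  have := avg_hoelder mB B0 s0 r0 sr
    (_ : measurable_fun setT (fun x => (enorm (mxpow (W x) (- q^-1) *m col i U^T) / nu i) `^ th)%R)
    (measurable_enorm fp.1) (fun=> powR_ge0 _ _) (fun=> enorm_ge0 _).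
  rewrite invf_div; move=> /(_ _)/le_trans; apply.
    by apply/measurable_EFinP; exact: measurable_powR_comp.
  rewrite [(p / t)^-1%R]invf_div; apply: lee_wpmul2r; first exact: poweR_ge0.
  have -> : avg mu B (fun x => (((enorm (mxpow (W x) (- q^-1) *m col i U^T) / nu i) `^ th)
      `^ (p / (q - 1)))%:E) = 1; last by rewrite poweR1r.
  have E1 x : (((enorm (mxpow (W x) (- q^-1) *m col i U^T) / nu i) `^ th) `^ (p / (q - 1)) =
      nu i `^ (- conj_exp q) * (enorm (mxpow (W x) (- q^-1) *m col i U^T) `^ conj_exp q))%R.
    rewrite -powRrM (_ : th * _ = conj_exp q)%R; last first.
      by rewrite /th /conj_exp; field; rewrite q1' (gt_eqF p0).
    rewrite powRM ?enorm_ge0 ?invr_ge0 ?(ltW (nu0 i))// mulrC -powR_inv1 ?(ltW (nu0 i))//.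
    by rewrite -powRrM mulN1r.
  under eq_fun do rewrite E1.
  rewrite avg_scale// ?powR_ge0//.
  + rewrite nuE -EFinM -powRD ?addNr ?powRr0//.
    by rewrite (gt_eqF (nu0 i)) implybT.
  + by apply/measurable_EFinP; exact: measurable_powR_comp.
  + by move=> x; exact: powR_ge0.
Qed.

End weighted_bounds.

(** * Bound by the A_p and A_infty constants *)

Section Ap_Ainfty_bound.
Context {R : realType} {d : measure_display} {T : measurableType d}.
Variables (mu : {measure set T -> \bar R}) (rho : T -> T -> R).
Hypothesis sht : space_of_homogeneous_type mu rho.
Variable n : nat.
Hypothesis n_gt0 : (0 < n)%N.
Variable p : R.
Hypothesis p1 : (1 < p)%R.
Local Open Scope ereal_scope.
Local Notation p' := (conj_exp p).
Local Notation V W := (fun x => mxpow (W x) (- (p - 1)^-1)).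

Let p0 : (0 < p)%R := lt_trans ltr01 p1.
Let pp1 : (0 < p - 1)%R. Proof. by rewrite subr_gt0. Qed.
Let p'0 : (0 < p')%R. Proof. by rewrite /conj_exp divr_gt0. Qed.

Section one_weight.
Variable W : T -> 'M[R]_n.
Hypotheses (WW : matrix_weight mu W) (Wy : Ap_gt1_const mu rho p W < +oo).

Let c := fine (Ap_gt1_const mu rho p W).
Let W0 : 0 <= Ap_gt1_const mu rho p W := Ap_gt1_const_ge0 sht p W.

Lemma Ap_gt1_constE : Ap_gt1_const mu rho p W = c%:E.
Proof. by rewrite fineK// ge0_fin_numE. Qed.

Let WB B : qballs rho B -> avg mu B (fun x => avg mu B (fun y =>
    (opnorm (mxpow (W y) (- p^-1) *m mxpow (W x) p^-1) `^ p')%:E) `^ (p / p')) <= c%:E.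
Proof. by move=> qB; rewrite -Ap_gt1_constE; apply: ereal_sup_ubound; exists B. Qed.

(** Serves the case of an infinite A_infty constant: [0 * +oo] is 0 in the extended reals, so the
    other factors must be known to be positive. *)
Lemma Ap_gt1_const_gt0 : 0 < Ap_gt1_const mu rho p W.
Proof.
rewrite Ap_gt1_constE lte_fin.
have qB : qballs rho (qball rho point 1%R) by exists point, 1%R.
have mB := sht_ball_measurable sht qB; have B0 := sht_ball_measure sht qB.
have [U [nu [oU nu0 _ nuW]]] := Ap_reducing mB B0 WW p1 (WB qB).
pose i := Ordinal n_gt0.
have /andP[Bp _] := B0.
have mE : measurable_fun setT (fun x => enorm (mxpow (W x) p^-1 *m col i U^T)).
  by apply: measurable_enorm_mxv => j k; apply: measurable_mxpow; exact: WW.1.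
have : 0 < \int[mu]_(x in qball rho point 1%R)
    ((nu i * enorm (mxpow (W x) p^-1 *m col i U^T)) `^ p)%:E.
  apply: integral_gt0 => //.
  - apply/measurable_EFinP; apply: measurable_powR_comp; exact: measurable_funM.
  - by move=> x; exact: powR_ge0.
  - apply: filterS WW.2 => x pd; rewrite powR_gt0// mulr_gt0// enorm_mxpow_gt0//.
    exact: orthmx_col_neq0.
move=> /lt_le_trans/(_ (nuW i)) h; rewrite ltNge; apply/negP => c0.
move: h; apply/negP; rewrite -leNgt; apply: mule_le0_ge0 => //.
by rewrite lee_fin mulr_ge0_le0 ?powR_ge0.
Qed.

Let mV i j : measurable_fun setT (fun x => mxpow (mxpow (W x) (- (p - 1)^-1)) p'^-1 i j).
Proof.
apply: (@measurable_mxpow _ _ _ _ (fun x => mxpow (W x) (- (p - 1)^-1))) => i' j'.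
by apply: measurable_mxpow; exact: WW.1.
Qed.

(** Written as in the A_infty constant; almost everywhere the matrix is [W^{-1/p}], because
    [(p - 1) p' = p]. *)
Let sig e x : R := (enorm (mxpow (mxpow (W x) (- (p - 1)^-1)) p'^-1 *m e) `^ p')%R.

Let msig e : measurable_fun setT (sig e).
Proof.
by apply/measurable_EFinP; apply: measurable_powR_comp; exact: measurable_enorm_mxv.
Qed.

Let VE x : posdefmx (W x) ->
  mxpow (mxpow (W x) (- (p - 1)^-1)) p'^-1 = mxpow (W x) (- p^-1).
Proof.
move=> pd; rewrite mxpow_mxpow//; congr mxpow; rewrite /conj_exp.
by field; rewrite !gt_eqF.
Qed.

Let sigE B e : measurable B -> \int[mu]_(x in B) (sig e x)%:E =
  \int[mu]_(x in B) ((enorm (mxpow (W x) (- p^-1) *m e)) `^ p')%:E.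
Proof.
move=> mB; apply: ae_eq_integral_any => // [x _|x _|]; rewrite ?lee_fin ?powR_ge0//.
by apply: filterS WW.2 => x pd; rewrite /sig VE.
Qed.

Let sig_avg B e : measurable B -> avg mu B (EFin \o sig e) =
  avg mu B (fun x => ((enorm (mxpow (W x) (- p^-1) *m e)) `^ p')%:E).
Proof. by move=> mB; exact: (congr1 (fun I => (mu B)^-1 * I) (sigE e mB)). Qed.

Let sig_ball e B : e != 0%R -> qballs rho B -> 0 < \int[mu]_(x in B) (sig e x)%:E < +oo.
Proof.
move=> e0 qB; have mB := sht_ball_measurable sht qB; have B0 := sht_ball_measure sht qB.
have /andP[Bp By] := B0; apply/andP; split.
  apply: integral_gt0 => //; first by move=> x; exact: powR_ge0.
  by apply: filterS WW.2 => x pd; rewrite /sig VE// powR_gt0// enorm_mxpow_gt0.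
rewrite sigE// -(avg_mul B0); apply: lte_mul_pinfty => //; first exact: (muB_fin B0).
exact: (Ap_avg_fin mB B0 WW p1 (WB qB)).
Qed.

Local Notation A8 := (Ainfty_sc_const mu rho p' (V W)).

Let sig_inv e B : e != 0%R -> qballs rho B ->
  (\int[mu]_(x in B) (sig e x)%:E)^-1 = (fine (\int[mu]_(x in B) (sig e x)%:E))^-1%:E.
Proof.
move=> e0 qB; have /andP[sp sy] := sig_ball e0 qB.
rewrite -{1}[X in X^-1]fineK ?ge0_fin_numE ?(ltW sp)//.
by rewrite inver gt_eqF// fine_gt0// sp.
Qed.

(** On [B], the maximal function of the cut-off weight is at least the average over [B] itself. *)
Lemma Ainfty_sc_ge1 : 1 <= A8.
Proof.
pose e : 'cV[R]_n := const_mx 1%R.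
have e0 : e != 0%R.
  apply/eqP => /matrixP/(_ (Ordinal n_gt0) ord0); rewrite !mxE => /eqP.
  by rewrite oner_eq0.
pose B := qball rho point (1%R : R).
have qB : qballs rho B by exists point, 1%R.
have mB := sht_ball_measurable sht qB; have B0 := sht_ball_measure sht qB.
have /andP[sp sy] := sig_ball e0 qB.
apply: (@le_trans _ _ (Ainfty_const mu rho (sig e))); last first.
  by apply: ereal_sup_ubound; exists e.
apply: (@le_trans _ _ ((\int[mu]_(x in B) (sig e x)%:E)^-1 *
    \int[mu]_(x in B) HLmax mu rho (sig e \* \1_B)%R x)); last first.
  by apply: ereal_sup_ubound; exists B.
rewrite sig_inv// lee_pdivlMl; last by rewrite fine_gt0// sp.
rewrite mule1 fineK ?ge0_fin_numE ?(ltW sp)//.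
have s0 y : 0 <= (sig e y)%:E by rewrite lee_fin powR_ge0.
apply: (@le_trans _ _ (\int[mu]_(x in B) cst (avg mu B (EFin \o sig e)) x)).
  by rewrite integral_cst// muleC (avg_mul B0).
apply: le_integral_dom => x Bx; first by apply: avg_ge0 => // y _; exact: s0.
apply: (@le_trans _ _ (avg mu B (fun y => `|(sig e \* \1_B)%R y|%:E))); last first.
  by apply: ereal_sup_ubound; exists B.
apply: le_avg => // y By /=; first exact: s0.
by rewrite indicE mem_set// mulr1 ger0_norm// powR_ge0.
Qed.

Let sig_HL A e B : A8 = A%:E -> e != 0%R -> qballs rho B ->
  \int[mu]_(x in B) HLmax mu rho (sig e \* \1_B)%R x <= A%:E * \int[mu]_(x in B) (sig e x)%:E.
Proof.
move=> AE e0 qB; have /andP[sp sy] := sig_ball e0 qB.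
have : (\int[mu]_(x in B) (sig e x)%:E)^-1 *
    \int[mu]_(x in B) HLmax mu rho (sig e \* \1_B)%R x <= A%:E.
  rewrite -AE; apply: (@le_trans _ _ (Ainfty_const mu rho (sig e))).
    by apply: ereal_sup_ubound; exists B.
  by apply: ereal_sup_ubound; exists e.
rewrite sig_inv// lee_pdivrMl; last by rewrite fine_gt0// sp.
by rewrite fineK ?ge0_fin_numE ?(ltW sp)// muleC.
Qed.

Variables (Cr H c0 CH : R).
Hypotheses (Cr0 : (0 < Cr)%R) (H1 : (1 <= H)%R) (CH0 : (0 < CH)%R).
Hypothesis RHI : forall (sig : T -> R) (A : R),
    measurable_fun setT sig -> (forall x, 0 <= sig x)%R ->
    (forall B, qballs rho B -> 0 < \int[mu]_(x in B) (sig x)%:E < +oo) -> (1 <= A)%R ->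
    (forall B, qballs rho B ->
      \int[mu]_(x in B) HLmax mu rho (sig \* \1_B)%R x <= A%:E * \int[mu]_(x in B) (sig x)%:E) ->
    forall e z r, (0 < e)%R -> (e <= 1)%R -> (e * A <= c0)%R -> (0 < r)%R ->
      \int[mu]_(x in qball rho z r) ((sig x) `^ (1 + e))%:E <=
      Cr%:E * (avg mu (qball rho z (H * r)%R) (EFin \o sig)) `^ (1 + e) * mu (qball rho z r).
Hypothesis dilate : forall z r, (0 < r)%R ->
  mu (qball rho z (H * r)%R) <= CH%:E * mu (qball rho z r).

(** At least 1, so that raising it to an exponent at most 1 does not increase it: the bound stays
    independent of [e]. *)
Let L : R := (Num.max 1 Cr)%R.

(* Reverse Hoelder improves the integrability of [|W^{-1/p} e|] beyond [p'],
   which is what makes the exponent [t] of the averaged function exceed one. *)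
Lemma Ap_axes (A e t : R) (f : T -> 'cV[R]_n) (N : set T) :
  A8 = A%:E -> (0 < e)%R -> (e <= 1)%R -> (e * A <= c0)%R ->
  t = (1 + (p - 1) * (e / (1 + e)))%R -> in_vLp mu p f ->
  (forall x, ~ N x -> posdefmx (W x)) ->
  forall B, qballs rho B -> exists a b : 'I_n -> T -> R,
    [/\ forall i, measurable_fun setT (a i), forall i, measurable_fun setT (b i),
        forall i x, (0 <= a i x)%R, forall i x, (0 <= b i x)%R &
    [/\ forall x, ~ N x -> {ae mu, forall y, B y ->
          (enorm (mxpow (W x) p^-1 *m mxpow (W y) (- p^-1) *m f y) <=
           \sum_i a i x * (b i y * enorm (f y)))%R},
        forall i, \int[mu]_(x in B) ((a i x) `^ p)%:E <= ((2 ^+ n) `^ p * c * CH)%:E * mu B &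
        forall i, avg mu B (fun y => (b i y * enorm (f y))%:E) <=
          L%:E * avg mu B (fun y => ((enorm (f y)) `^ (p / t))%:E) `^ (t / p)]].
Proof.
move=> AE e0 e1 eA tE fp pdN _ [z [r [r0 ->]]].
set B := qball rho z r.
have qB : qballs rho B by exists z, r.
have mB := sht_ball_measurable sht qB; have B0 := sht_ball_measure sht qB.
have Hr0 : (0 < H * r)%R by rewrite mulr_gt0// (lt_le_trans ltr01).
set BH := qball rho z (H * r)%R.
have qBH : qballs rho BH by exists z, (H * r)%R.
have mBH := sht_ball_measurable sht qBH; have BH0 := sht_ball_measure sht qBH.
have BBH : B `<=` BH by apply: le_qball; rewrite ler_peMl ?(ltW r0).
(* Axes of the dilated ball, because reverse Hoelder bounds means over [B] by means over [BH]; the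
   first factor pays [CH] for it. *)
have [U [nu [oU nu0 nuE nuW]]] := Ap_reducing mBH BH0 WW p1 (WB qBH).
have mE i : measurable_fun setT (fun x => enorm (mxpow (W x) p^-1 *m col i U^T)).
  by apply: measurable_enorm_mxv => j k; apply: measurable_mxpow; exact: WW.1.
have mVe i : measurable_fun setT
    (fun x => enorm (mxpow (mxpow (W x) (- (p - 1)^-1)) p'^-1 *m col i U^T)).
  exact: measurable_enorm_mxv.
pose b i x : R := (enorm (mxpow (mxpow (W x) (- (p - 1)^-1)) p'^-1 *m col i U^T) / nu i)%R.
have mb i : measurable_fun setT (b i) by exact: measurable_funM.
have b0 i x : (0 <= b i x)%R by rewrite divr_ge0 ?enorm_ge0 ?(ltW (nu0 i)).
have c_ge0 : (0 <= c)%R by exact: fine_ge0.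
exists (fun i x => nu i * enorm (mxpow (W x) p^-1 *m col i U^T))%R, b; split => //.
- by move=> i; exact: measurable_funM.
- by move=> i x; rewrite mulr_ge0 ?enorm_ge0 ?(ltW (nu0 i)).
split.
- move=> x Nx; apply: filterS WW.2 => y pdy By.
  have := matrix_kernel_axes p^-1 (f y) (pdN x Nx) pdy oU nu0 ltr01 (lexx _).
  rewrite mulr1 => /le_trans; apply; apply: ler_sum => i _.
  rewrite /b VE// !powRr1//.
  + by rewrite divr_ge0 ?enorm_ge0 ?(ltW (nu0 i)).
  + by rewrite mulr_ge0 ?enorm_ge0 ?(ltW (nu0 i)).
- move=> i; apply: (@le_trans _ _ (((2 ^+ n) `^ p * c)%:E * mu BH)).
    by apply: le_trans (nuW i); apply: le_integral_sub => // x _; rewrite lee_fin powR_ge0.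
  rewrite [in leRHS]EFinM -muleA lee_wpmul2l ?dilate//.
  by rewrite lee_fin mulr_ge0 ?powR_ge0.
move=> i.
have e1' : (0 < 1 + e)%R by rewrite addr_gt0.
have s0 : (0 < p' * (1 + e))%R by rewrite mulr_gt0.
have t0 : (0 < t)%R by rewrite tE addr_gt0// mulr_gt0// divr_gt0.
have r0' : (0 < p / t)%R by rewrite divr_gt0.
(* [t] is the solution of this identity, [t = p - (p - 1) / (1 + e)]. *)
have sr : ((p' * (1 + e))^-1 + (p / t)^-1 = 1)%R.
  by rewrite [((p / t)^-1)%R]invf_div tE /conj_exp; field; rewrite (gt_eqF p0) (gt_eqF e1') (gt_eqF pp1).
have := avg_hoelder mB B0 s0 r0' sr (mb i) (measurable_enorm fp.1) (b0 i) (fun=> enorm_ge0 _).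
rewrite [((p / t)^-1)%R]invf_div => /le_trans; apply.
apply: lee_wpmul2r; first exact: poweR_ge0.
have bE x : (b i x `^ (p' * (1 + e)) = nu i `^ (- (p' * (1 + e))) * sig (col i U^T) x `^ (1 + e))%R.
  rewrite /b /sig -powRrM powRM ?enorm_ge0 ?invr_ge0 ?(ltW (nu0 i))// mulrC.
  by rewrite -powR_inv1 ?(ltW (nu0 i))// -powRrM mulN1r.
have avC : avg mu B (fun x => (b i x `^ (p' * (1 + e)))%:E) <= Cr%:E.
  under eq_fun do rewrite bE.
  rewrite avg_scale ?powR_ge0//; last 2 first.
  - by apply/measurable_EFinP; apply: measurable_powR_comp.
  - by move=> x; exact: powR_ge0.
  rewrite powRN lee_pdivrMl ?powR_gt0// avg_le//.
  have ei0 : col i U^T != 0%R by exact: orthmx_col_neq0.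
  have A1 : (1 <= A)%R by rewrite -lee_fin -AE; exact: Ainfty_sc_ge1.
  apply: le_trans (@RHI _ A (msig (col i U^T)) (fun=> powR_ge0 _ _)
    (fun B' => @sig_ball _ B' ei0) A1 (fun B' => @sig_HL A _ B' AE ei0) e z r e0 e1 eA r0) _.
  rewrite -/BH -/B.
  rewrite (etrans (sig_avg (col i U^T) mBH) (nuE i)).
  by rewrite poweR_EFin -powRrM muleC -EFinM (mulrC Cr).
have s1 : ((p' * (1 + e))^-1 <= 1)%R.
  rewrite invf_le1// -[leLHS]mul1r ler_pM// ?lerDl ?(ltW e0)//.
  by rewrite /conj_exp ler_pdivlMr// mul1r gerBl.
apply: (@le_trans _ _ (L%:E `^ (p' * (1 + e))^-1)).
  apply: le_poweR; first by rewrite invr_ge0 ltW.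
    by apply: avg_ge0 => // x _; rewrite lee_fin powR_ge0.
  by apply: le_trans avC _; rewrite lee_fin /L le_max lexx orbT.
have L1 : (1 <= L)%R by rewrite /L le_max lexx.
rewrite poweR_EFin lee_fin -[leRHS]powRr1 ?(le_trans ler01)//.
exact: ler_powR.
Qed.

End one_weight.

(** With [e] a fixed multiple of [1 / A], as reverse Hoelder permits, [t - 1] is at least a multiple
    of [1 / A], and [1 / min 1 (t - 1)] becomes one factor [A] under the [p]-th root. *)
Theorem CGmax_Ap : exists2 C : R, (0 < C)%R &
  forall W : T -> 'M[R]_n, matrix_weight mu W -> Ap_gt1_const mu rho p W < +oo ->
  forall f, in_vLp mu p f ->
  'N[mu]_p%:E[CGmax mu rho p W f] <=
    C%:E * Ap_gt1_const mu rho p W `^ p^-1 * Ainfty_sc_const mu rho p' (V W) `^ p^-1 *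
    vLnorm mu p f.
Proof.
have [Cm Cm0 hCm] := CGmax_axes sht n_gt0 p1.
have [Cr [H [c0 [Cr0 H1 c00 RHI]]]] := reverse_holder_ball sht.
have [CH CH1 dilate] := qball_dilate sht H.
have CH0 : (0 < CH)%R := lt_le_trans ltr01 CH1.
pose L : R := (Num.max 1 Cr)%R.
have L0 : (0 < L)%R by rewrite /L lt_max ltr01.
(* [e = k / A] will satisfy both [e <= 1] and [e * A <= c0]; [m1] bounds [min 1 (t - 1) / e] from
   below, as [1 + e <= 2]. *)
pose k : R := (Num.min 1 c0)%R.
have k0 : (0 < k)%R by rewrite lt_min ltr01.
pose m1 : R := (Num.min 1 ((p - 1) / 2))%R.
have m10 : (0 < m1)%R by rewrite lt_min ltr01 divr_gt0.
pose C : R := (Cm * ((2 ^+ n) `^ p * CH) * L `^ p / (m1 * k))%R.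
have C0 : (0 < C)%R.
  by rewrite /C divr_gt0 ?mulr_gt0 ?powR_gt0 ?exprn_gt0.
exists (C `^ p^-1)%R; first exact: powR_gt0.
move=> W WW Wy f fp.
have f0 : 0 <= vLnorm mu p f by rewrite vLnormE poweR_ge0.
have [N [mN N0 hN]] := WW.2.
have pdN x : ~ N x -> posdefmx (W x) by move=> Nx; apply: contrapT => h; exact/Nx/hN.
(* For [f] vanishing almost everywhere the right-hand side is 0 even when the A_infty constant is
   infinite; zero factors on the axes then show that the left-hand side vanishes. *)
have [vf0|vfn0] := eqVneq (vLnorm mu p f) 0.
  rewrite vf0 mule0.
  have ae0 : {ae mu, forall y, f y = 0%R}.
    have I0 : \int[mu]_x `|((enorm (f x)) `^ p)%:E| = 0.
      apply: (@poweR_eq0_eq0 _ _ p^-1); first by apply: integral_ge0.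
      rewrite -vf0 vLnormE; congr (_ `^ _); apply: eq_integral => x _.
      by rewrite gee0_abs// lee_fin powR_ge0.
    have mfp : measurable_fun setT (fun x => ((enorm (f x)) `^ p)%:E).
      by apply: measurable_powR_comp; exact: measurable_enorm fp.1.
    apply: filterS ((ae_eq_integral_abs mu measurableT mfp).1 I0) => x /(_ I) [] /eqP.
    by rewrite powR_eq0 enorm_eq0 => /andP[/eqP].
  have := hCm W f p 0%R 0%R set0 p1 (lexx _) (lexx _) (lexx _) fp measurable0 (measure0 mu).
  rewrite vf0 mule0; apply => B qB; exists (fun _ _ => 0%R), (fun _ _ => 0%R).
  have B0 := sht_ball_measure sht qB.
  split => //; split.
  - move=> x _; apply: filterS ae0 => y -> _.
    by rewrite mulmx0 enorm0 big1// => i _; rewrite mul0r.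
  - by move=> i; rewrite powR0 ?gt_eqF// integral0 mul0e.
  - by move=> i; rewrite mul0e avg_le// mule0; under eq_integral do rewrite mul0r; rewrite integral0.
have vfp : 0 < vLnorm mu p f by rewrite lt_neqAle eq_sym vfn0.
have Wp : 0 < Ap_gt1_const mu rho p W by exact: Ap_gt1_const_gt0.
pose c := fine (Ap_gt1_const mu rho p W).
have cE : Ap_gt1_const mu rho p W = c%:E by exact: Ap_gt1_constE.
have cp : (0 < c)%R by rewrite -lte_fin -cE.
have A1 := Ainfty_sc_ge1 WW Wy.
have [Ay|] := ltP (Ainfty_sc_const mu rho p' (V W)) +oo; last first.
  rewrite leye_eq => /eqP ->; rewrite poweRyr ?gt_eqF ?invr_gt0//.
  rewrite gt0_muley ?gt0_mulye ?leey//.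
  by rewrite cE poweR_EFin -EFinM lte_fin mulr_gt0// powR_gt0.
pose A := fine (Ainfty_sc_const mu rho p' (V W)).
have AE : Ainfty_sc_const mu rho p' (V W) = A%:E.
  by rewrite fineK// ge0_fin_numE// (le_trans _ A1).
have A1' : (1 <= A)%R by rewrite -lee_fin -AE.
have A0 : (0 < A)%R := lt_le_trans ltr01 A1'.
pose e : R := (k / A)%R.
have e0 : (0 < e)%R by rewrite divr_gt0.
have e1 : (e <= 1)%R.
  by rewrite ler_pdivrMr// mul1r (le_trans _ A1')// ge_min lexx.
have eA : (e * A <= c0)%R by rewrite divfK ?gt_eqF// ge_min lexx orbT.
pose t : R := (1 + (p - 1) * (e / (1 + e)))%R.
have e1' : (0 < 1 + e)%R by rewrite addr_gt0.
have t1 : (1 < t)%R by rewrite ltrDl mulr_gt0// divr_gt0.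
have tp : (t <= p)%R.
  rewrite /t -lerBrDl ler_piMr ?(ltW pp1)// ler_pdivrMr// mul1r lerDr//.
have min_ge : (m1 * e <= Num.min 1 (t - 1))%R.
  rewrite le_min; apply/andP; split.
    by rewrite mulr_ile1 ?(ltW m10) ?(ltW e0)// ge_min lexx.
  rewrite /t addrAC subrr add0r.
  apply: (@le_trans _ _ ((p - 1) / 2 * e)%R).
    by rewrite ler_wpM2r ?(ltW e0)// ge_min lexx orbT.
  rewrite -mulrA ler_wpM2l ?(ltW pp1)// mulrC ler_wpM2l ?(ltW e0)//.
  by rewrite lef_pV2 ?posrE//; lra.
have K0 : (0 <= (2 ^+ n) `^ p * c * CH)%R.
  by rewrite !mulr_ge0 ?powR_ge0 ?(ltW cp) ?(ltW CH0).
have := hCm W f t _ L N t1 tp K0 (ltW L0) fp mN N0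
  (@Ap_axes W WW Wy Cr H c0 CH H1 RHI dilate A e t f N AE e0 e1 eA erefl fp pdN).
move/le_trans; apply.
rewrite cE AE !poweR_EFin -!EFinM lee_wpmul2r// lee_fin.
rewrite -(powRM _ (ltW C0) (ltW cp)) -(powRM _ (ltW (mulr_gt0 C0 cp)) (ltW A0)).
have D0 : (0 <= Cm * ((2 ^+ n) `^ p * c * CH) * L `^ p)%R.
  by rewrite !mulr_ge0 ?powR_ge0 ?(ltW cp) ?(ltW CH0) ?(ltW Cm0).
apply: le_powR; first by rewrite invr_ge0 ltW.
  by rewrite mulr_ge0// invr_ge0 le_min ler01 subr_ge0 ltW.
apply: (@le_trans _ _ (Cm * ((2 ^+ n) `^ p * c * CH) * L `^ p / (m1 * e))%R).
  rewrite ler_wpM2l// lef_pV2 ?posrE ?(mulr_gt0 m10 e0)//.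
  by rewrite lt_min ltr01 subr_gt0.
rewrite le_eqVlt; apply/orP; left; apply/eqP; rewrite /C /e.
by field; rewrite (gt_eqF m10) (gt_eqF k0) (gt_eqF A0).
Qed.

End Ap_Ainfty_bound.

Theorem theorem2 (R : realType) (d : measure_display) (T : measurableType d)
    (mu : {measure set T -> \bar R}) (rho : T -> T -> R)
    (sht : space_of_homogeneous_type mu rho)
    (n : nat) (n_gt0 : (0 < n)%N) (p q : R) (q_ge1 : 1 <= q) (q_lt_p : q < p) :
  exists2 C : R, 0 < C &
    forall W : T -> 'M[R]_n, matrix_weight mu W ->
      ((Ap_const mu rho p W < +oo)%E ->
        forall f : T -> 'cV[R]_n, in_vLp mu p f ->
          ('N[mu]_p%:E[CGmax mu rho p W f] <=
             C%:E * Ap_const mu rho p W `^ p^-1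
             * Ainfty_sc_const mu rho (conj_exp p)
                 (fun x => mxpow (W x) (- (p - 1)^-1)) `^ p^-1
             * vLnorm mu p f)%E) /\
      ((Ap_const mu rho q W < +oo)%E ->
        forall f : T -> 'cV[R]_n, in_vLp mu p f ->
          ('N[mu]_p%:E[CGmax mu rho p W f] <=
             C%:E * Ap_const mu rho q W `^ p^-1 * vLnorm mu p f)%E).
Proof.
have p1 : 1 < p := le_lt_trans q_ge1 q_lt_p.
have [C1 C10 h1] := CGmax_Ap sht n_gt0 p1.
have [C2 C20 h2] : exists2 C : R, 0 < C & forall W : T -> 'M[R]_n, matrix_weight mu W ->
    (Ap_const mu rho q W < +oo)%E -> forall f : T -> 'cV[R]_n, in_vLp mu p f ->
    ('N[mu]_p%:E[CGmax mu rho p W f] <=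
       C%:E * Ap_const mu rho q W `^ p^-1 * vLnorm mu p f)%E.
  (* [Ap_const] branches at 1; both branches rest on the same choice [t = p - q + 1]. *)
  rewrite /Ap_const; have [q1|q1] := eqVneq q 1; first exact: CGmax_A1.
  by apply: CGmax_Aq => //; rewrite lt_neqAle eq_sym q1.
have N0 f : (0 <= vLnorm mu p f)%E by rewrite vLnormE poweR_ge0.
exists (Num.max C1 C2); first by rewrite lt_max C10.
have C1m : C1 <= Num.max C1 C2 by rewrite le_max lexx.
have C2m : C2 <= Num.max C1 C2 by rewrite le_max lexx orbT.
move=> W WW; split => [|Wy f fp].
  rewrite /Ap_const gt_eqF// => Wy f fp; apply: le_trans (h1 W WW Wy f fp) _.
  by rewrite !lee_wpmul2r ?poweR_ge0 ?lee_fin.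
apply: le_trans (h2 W WW Wy f fp) _.
by rewrite !lee_wpmul2r ?poweR_ge0 ?lee_fin.
Qed.
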